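(* If $\lambda_p:=p(2n-1)=1-\sigma$ is uniformly bounded from below by $0$ (i.e. bounded below by a positive constant) with $n^{-1/3}\ll\sigma\ll1$, then, with probability $1-\frac{15+o(1)}{16\sigma^3n}$, all the variables in $C_{n,p}$ are of type $(1,1)$ in the core. That is, $$\Pr[K_{n,p}=\emptyset]=1-\frac{15+o(1)}{16\sigma^3 n}.$$ In particular, $\Pr[K_{n,p}=\emptyset]=1-O((\sigma^3n)^{-1})$ for all $\sigma$ in the range $n^{-1/3}\ll\sigma<1$. We also have $$\Pr[F(n,p)\text{ is satisfiable}]=1-\frac{1+o(1)}{16\sigma^3 n}.$$
   Context: There are $n$ Boolean variables and $2n$ literals (each variable $x$ and its negation $\bar x$). A clause is a disjunction $(y\vee z)$ of two literals with different underlying variables. The random $2$-SAT formula $F(n,p)$ is obtained by selecting each of the $2^2\binom n2$ possible clauses with probability $p$, independently. A formula is satisfiable if some truth assignment of the $n$ variables satisfies all its clauses. A literal is pure in a formula if it belongs to at least one clause while its negation belongs to none. The pure literal algorithm repeatedly selects a pure literal, sets it true and removes all clauses containing it, until no pure literal is left. The formula $F_C(n,p)$ left when it stops on input $F(n,p)$ is the core, and $C_{n,p}$ is the set of underlying variables of the core. A variable $x$ is of type $(i,j)$ in a formula if $x$ appears in exactly $i$ clauses and $\bar x$ in exactly $j$ clauses. $K_{n,p}$ is the set of variables of the core whose type in the core is larger than $(1,1)$, i.e. is $(i,j)\geq(1,1)$ (componentwise) with $(i,j)\neq(1,1)$; it is the set of underlying variables of the kernel, the formula obtained from the core by replacing,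 successively for variables $x$ of type $(1,1)$, the two clauses $(x\vee y)\wedge(\bar x\vee z)$ by $(y\vee z)$. Asymptotics are as $n\to\infty$ with $p=p(n)$, $\sigma=\sigma(n)$; $f\ll g$ means $f/g\to0$. In the displayed asymptotics $o(1)$ tends to $0$ in the regime $\sigma\to0$, $\sigma^3n\to\infty$. *)

(* Defs.v *)
From mathcomp Require Import all_boot all_order all_algebra.
From Stdlib Require Import Relation_Operators.

Set Implicit Arguments.
Unset Strict Implicit.
Unset Printing Implicit Defensive.

Import Order.TTheory GRing.Theory Num.Theory.
Local Open Scope ring_scope.

(* (x, true) is the literal x and (x, false) is its negation. *)
Definition literal (n : nat) : finType := ('I_n * bool)%type.

Definition neg n (y : literal n) : literal n := (y.1, ~~ y.2).

(* The disjunction (y \/ z) is unordered: it is encoded as the set {y, z}. *)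
Definition clauses n : {set {set literal n}} :=
  [set [set u.1; u.2] | u : literal n * literal n & u.1.1 != u.2.1].

Definition formula (n : nat) : finType := {set {set literal n}}.

Definition satisfies n (a : {ffun 'I_n -> bool}) (F : formula n) : bool :=
  [forall c in F, [exists y in c, a y.1 == y.2]].

Definition satisfiable n (F : formula n) : bool :=
  [exists a : {ffun 'I_n -> bool}, satisfies a F].

Definition degree n (F : formula n) (y : literal n) : nat :=
  #|[set c in F | y \in c]|.

Definition var_type n (F : formula n) (x : 'I_n) : nat * nat :=
  (degree F (x, true), degree F (x, false)).

Definition pure n (F : formula n) (y : literal n) : bool :=
  (0 < degree F y)%N && (degree F (neg y) == 0)%N.

Definition remove_literal n (F : formula n) (y : literal n) : formula n :=
  [set c in F | y \notin c].

Definition pure_step n (F : formula n) : formula n :=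
  if [pick y | pure F y] is Some y then remove_literal F y else F.

(* Every effective step removes a clause, so #|F| steps are enough. The
   selection rule for the pure literal is immaterial, see [coreP]. *)
Definition core n (F : formula n) : formula n := iter #|F| (@pure_step n) F.

Definition core_vars n (F : formula n) : {set 'I_n} :=
  [set x | [exists c in core F, ((x, true) \in c) || ((x, false) \in c)]].

Definition kernel_vars n (F : formula n) : {set 'I_n} :=
  [set x in core_vars F |
    let: (i, j) := var_type (core F) x in
    [&& (1 <= i)%N, (1 <= j)%N & (i, j) != (1, 1)%N]].

(* Pr[F(n,p) \in E]: each clause is selected with probability p, independently
   (product measure on the sets of clauses). *)
Definition Pr (R : numDomainType) n (p : R) (E : pred (formula n)) : R :=
  \sum_(F in powerset (clauses n) | E F)
    \prod_(c in clauses n) (if c \in F then p else 1 - p).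

Definition pure_free n (F : formula n) : bool := [forall y, ~~ pure F y].

Definition pure_move n (F G : formula n) : Prop :=
  exists2 y, pure F y & G = remove_literal F y.

Definition pure_run n : formula n -> formula n -> Prop :=
  clos_refl_trans_1n _ (@pure_move n).

Lemma degreeS n (F G : formula n) y :
  F \subset G -> (degree F y <= degree G y)%N.
Proof.
move=> /subsetP sFG; apply/subset_leq_card/subsetP => c.
by rewrite !inE => /andP[/sFG -> ->].
Qed.

Lemma remove_subset n (F : formula n) y : remove_literal F y \subset F.
Proof. by apply/subsetP => c; rewrite inE => /andP[]. Qed.

Lemma remove_card n (F : formula n) y :
  pure F y -> (#|remove_literal F y| < #|F|)%N.
Proof.
move=> /andP[/card_gt0P[c]]; rewrite inE => /andP[cF yc] _.
apply/proper_card/properP; split; first exact: remove_subset.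
by exists c; rewrite // inE yc andbF.
Qed.

Lemma pure_free_remove n (F H : formula n) y :
  pure F y -> pure_free H -> H \subset F -> H \subset remove_literal F y.
Proof.
move=> /andP[_ ny] /forallP/(_ y) pH sHF; apply/subsetP => c cH.
rewrite inE (subsetP sHF) //=; apply: contra pH => yc.
apply/andP; split; first by apply/card_gt0P; exists c; rewrite inE cH.
by rewrite -leqn0 -(eqP ny) degreeS.
Qed.

Lemma pure_run_subset n (F G : formula n) : pure_run F G -> G \subset F.
Proof.
elim=> // {}F F1 {}G [y _ ->] _ sG.
exact: subset_trans sG (remove_subset _ _).
Qed.

Lemma pure_run_max n (F G H : formula n) :
  pure_run F G -> pure_free H -> H \subset F -> H \subset G.
Proof. by elim=> // {}F F1 {}G [y pFy ->] _ IH pH /(pure_free_remove pFy pH) /IH ->. Qed.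

Lemma core_run n (F : formula n) : pure_run F (core F) /\ pure_free (core F).
Proof.
suff gen k : (#|F| <= k)%N ->
    pure_run F (iter k (@pure_step n) F) /\ pure_free (iter k (@pure_step n) F).
  exact: gen.
elim: k F => [|k IH] F.
  rewrite leqn0 cards_eq0 => /eqP-> /=; split; first exact: rt1n_refl.
  apply/forallP => y; rewrite /pure negb_and -leqNgt leqn0 /degree.
  by rewrite (_ : [set c in _ | _] = set0) ?cards0 //; apply/setP => c; rewrite !inE.
move=> lF; rewrite iterSr; case: (pickP (pure F)) => [y0 py0|npF].
  have [y pFy ->] : exists2 y, pure F y & pure_step F = remove_literal F y.
    by rewrite /pure_step; case: pickP => [y pFy|/(_ y0)]; [exists y | rewrite py0].
  have [] := IH (remove_literal F y).
    by rewrite -ltnS (leq_trans (remove_card pFy)).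
  by move=> rH pH; split=> //; apply: rt1n_trans rH; exists y.
have stepF : pure_step F = F by rewrite /pure_step; case: pickP => // y; rewrite npF.
rewrite stepF; have -> : iter k (@pure_step n) F = F by elim: k {IH lF} => //= k ->.
by split; [exact: rt1n_refl | apply/forallP => y; rewrite npF].
Qed.

Lemma coreP n (F G : formula n) :
  (pure_run F G /\ pure_free G) <-> G = core F.
Proof.
have [rC pC] := core_run F; split=> [[rG pG]|->]; last by [].
apply/eqP; rewrite eqEsubset (pure_run_max rC pG (pure_run_subset rG)).
exact: pure_run_max rG pC (pure_run_subset rC).
Qed.

From mathcomp Require Import all_classical all_reals all_analysis.
Import numFieldNormedType.Exports.
Local Open Scope classical_set_scope.

Definition much_less (R : realType) (f g : nat -> R) : Prop :=
  (fun n => f n / g n) @ \oo --> (0 : R).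

(* Main.v *)
Require Import Defs.
From mathcomp Require Import all_boot all_order all_algebra.
From mathcomp Require Import fingroup perm zify ring lra.

Set Implicit Arguments.
Unset Strict Implicit.
Unset Printing Implicit Defensive.

(** In a pure-free formula every implication path can be prolonged until it meets
itself; hence, as soon as some literal lies in two clauses, the formula contains a
_bicycle_: a path on k distinct variables with k+1 clauses, whose two end clauses lead
back to the path.  The expected number of bicycles is of order 1/(sigma^3 n), and all
but O(1/(sigma^2 n)) of it comes from subdivisions of cubic kernels, i.e. three chains
joining the six literal slots x, x, -x, y, y, -y.  Such a subdivision is described by
exactly 3! 2^3 = 48 triples of chains, and there are 4n(n-1) 90 ways (resp. 4n(n-1) 6 ways,
if the kernel is to be unsatisfiable) to choose the six slots; with p ~ 1/(2n) and each
chain contributing 1/sigma this gives the constants 15/16 and 1/16.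

The upper bound on Pr[K <> 0] is the first moment; for unsatisfiability, a minimal
unsatisfiable subformula is connected, so it either is a bicycle or leaves a bicycle
along an ear, and the latter costs O(1/(sigma^3 n)^2).  For the lower bound, restrict to
chains of length at most n^(1/3): given such a subdivision, with probability 1 - o(1)
there is neither an ear attached to it nor another subdivision disjoint from it, and then
it is the only subdivision in the formula. *)

(** * Implication paths and chains of clauses *)

(** The cutoff [n^(1/3)] answers two opposite demands. A chain typically has length [1/sigma], far
    below the cutoff because [t = n^(-1/3)/sigma] tends to 0, so truncation loses only a fraction of
    order [t]. A truncated subdivision has [m = O(n^(1/3))] variables: keeping its words off these
    variables shifts [1 - 2np], which is about [sigma], by [O(mp) = O(t^2 sigma)], and an ear on it
    costs [m^2 p/sigma + mp/sigma^2 = O(t)]. So first-moment bounds alone show that almost every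
    short subdivision is isolated, and no variance is computed. All errors are explicit functions of
    [sigma] and [t], continuous at [(0,0)]. Every chain must have an inner variable. Each clause
    then reveals its chain, the subdivision determines its description up to the 48 relabellings,
    and its number of clauses is exact even over kernel clauses such as [x \/ x]. A bicycle
    violating this has a closing position fixed by the other one or by an end of the word, which
    saves a factor [1/sigma] in the first moment. *)

Section Trails.
Variable n : nat.
Implicit Types (x y z u v : literal n) (s c w : seq (literal n)) (S G : formula n).

Lemma negK : involutive (@neg n).
Proof. by case=> i b; rewrite /neg /= negbK. Qed.

Lemma neg_inj : injective (@neg n).
Proof. exact: can_inj negK. Qed.

Lemma neg_neq z : neg z != z.
Proof. by case: z => i b; rewrite xpair_eqE /= eqxx /=; case: b. Qed.

Lemma neq_neg z : z != neg z.
Proof. by rewrite eq_sym neg_neq. Qed.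

Lemma same_var y z : y.1 = z.1 -> y = z \/ y = neg z.
Proof.
case: y z => [i b] [j b'] /= ->; rewrite /neg /=.
by case: b b' => [] []; [left | right | right | left].
Qed.

Lemma set2_inj x y z : [set x; y] = [set x; z] -> y = z.
Proof.
move=> E; have: y \in [set x; z] by rewrite -E !inE eqxx orbT.
rewrite !inE => /orP[/eqP yx|/eqP //].
have: z \in [set x; y] by rewrite E !inE eqxx orbT.
by rewrite yx !inE orbb => /eqP->.
Qed.

Fixpoint steps z s : seq (literal n * literal n) :=
  if s is z' :: s' then (neg z, z') :: steps z' s' else [::].

Definition clause_of (u : literal n * literal n) : {set literal n} := [set u.1; u.2].

(* The clauses of the implications z -> s_0 -> s_1 -> ... *)
Definition trail z s := map clause_of (steps z s).

(** Kept as a list, so that [count_mem] sees multiplicities; for a duplicate-free trail these are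
    the degrees ([card_trail]). *)
Definition step_lits z s := flatten [seq [:: t.1; t.2] | t <- steps z s].

(** Contraposition: [y -> z] is also [-z -> -y], so the reversed word of negated literals runs
    through the same clauses backwards. *)
Definition revneg s := rev (map (@neg n) s).

(** The clause [u \/ v] subdivided by [c]: the path [-u -> c_0 -> ... -> v], whose clauses are
    [u \/ c_0], [-c_0 \/ c_1], and so on. Starting at [neg u] makes the two ends symmetric, see
    [chain_rev]. *)
Definition chain u c v := trail (neg u) (rcons c v).

Lemma size_steps z s : size (steps z s) = size s.
Proof. by elim: s z => //= a s IH z; rewrite IH. Qed.

Lemma size_trail z s : size (trail z s) = size s.
Proof. by rewrite size_map size_steps. Qed.

Lemma steps_cat z s s' : steps z (s ++ s') = steps z s ++ steps (last z s) s'.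
Proof. by elim: s z => //= a s IH z; rewrite IH. Qed.

Lemma trail_cat z s s' : trail z (s ++ s') = trail z s ++ trail (last z s) s'.
Proof. by rewrite /trail steps_cat map_cat. Qed.

Lemma size_revneg s : size (revneg s) = size s.
Proof. by rewrite size_rev size_map. Qed.

Lemma unzip1_revneg s : unzip1 (revneg s) = rev (unzip1 s).
Proof. by rewrite /revneg /unzip1 map_rev -map_comp. Qed.

Lemma revneg_cons z s : revneg (z :: s) = rcons (revneg s) (neg z).
Proof. by rewrite /revneg /= rev_cons. Qed.

Lemma revneg_rcons z s : revneg (rcons s z) = neg z :: revneg s.
Proof. by rewrite /revneg map_rcons rev_rcons. Qed.

Lemma trail_rev z s :
  trail (neg (last z s)) (revneg (belast z s)) = rev (trail z s).
Proof.
elim: s z => //= y s IH z; rewrite revneg_cons -cats1 trail_cat IH /trail /= rev_cons -cats1.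
congr (_ ++ [:: _]); rewrite /clause_of /= setUC; congr [set _; _].
case: s {IH} => [|y' s] /=; first by rewrite negK.
by rewrite revneg_cons last_rcons negK.
Qed.

Lemma chain_rev u c v : chain v (revneg c) u = rev (chain u c v).
Proof.
rewrite /chain -(trail_rev (neg u)) last_rcons; congr trail.
by rewrite belast_rcons revneg_cons negK.
Qed.

Lemma size_chain u c v : size (chain u c v) = (size c).+1.
Proof. by rewrite size_trail size_rcons. Qed.

Lemma step_lits_cons z y s : step_lits z (y :: s) = [:: neg z, y & step_lits y s].
Proof. by []. Qed.

Lemma trail_cons z y s : trail z (y :: s) = clause_of (neg z, y) :: trail y s.
Proof. by []. Qed.

Lemma chainE u c v : chain u c v = trail (neg u) (c ++ [:: v]).
Proof. by rewrite cats1. Qed.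

Lemma chain_cons u z s v :
  chain u (z :: s) v = clause_of (u, z) :: trail z (rcons s v).
Proof. by rewrite -[in RHS](negK u). Qed.

(** Each inner literal is the target of one step and, negated, the source of the next. *)
Lemma perm_step_lits z c v :
  perm_eq (step_lits z (rcons c v)) [:: neg z, v & c ++ map (@neg n) c].
Proof.
elim: c z => [|y c IH] z; rewrite ?rcons_cons step_lits_cons; first by rewrite !perm_cons.
rewrite perm_cons /=.
have /permPl-> : perm_eq (y :: step_lits y (rcons c v))
   (y :: [:: neg y, v & c ++ map (@neg n) c]) by rewrite perm_cons.
apply/seq.permP => a; rewrite /= !count_cat /=; lia.
Qed.

Lemma trail_litP z s y :
  reflect (exists2 d, d \in trail z s & y \in d) (y \in step_lits z s).
Proof.
apply: (iffP flatten_mapP) => [[u us]|[d /mapP[u us ->]] yd].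
  by rewrite !inE => yu; exists (clause_of u); [exact: map_f | rewrite !inE].
by exists u => //; move: yd; rewrite !inE.
Qed.

Lemma mem_chain_lits u c v y :
  y \in step_lits (neg u) (rcons c v) =
  [|| y == u, y == v, y \in c | neg y \in c].
Proof.
rewrite (perm_mem (perm_step_lits _ _ _)) !inE mem_cat negK.
congr [|| _, _, _ | _]; apply/mapP/idP => [[x xc ->]|yc]; first by rewrite negK.
by exists (neg y); rewrite ?negK.
Qed.

Lemma neg_in_chain c y : y.1 \in unzip1 c = (y \in c) || (neg y \in c).
Proof.
apply/mapP/orP => [[x xc]|[yc|yc]]; last 2 first.
- by exists y.
- by exists (neg y).
by move/same_var => [->|->]; rewrite ?negK; [left|right].
Qed.

Lemma chain_litP u c v y :
  reflect (exists2 d, d \in chain u c v & y \in d)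
          [|| y == u, y == v | y.1 \in unzip1 c].
Proof. by rewrite neg_in_chain -mem_chain_lits; exact: trail_litP. Qed.

Lemma chain_var_sub u c v d y : d \in chain u c v -> y \in d ->
  [|| y == u, y == v | y.1 \in unzip1 c].
Proof. by move=> dc yd; apply/chain_litP; exists d. Qed.

Lemma count_neg_map c y : count_mem y (map (@neg n) c) = count_mem (neg y) c.
Proof. by rewrite count_map; apply: eq_count => x /=; rewrite (can2_eq negK negK). Qed.

Lemma count_lit_uniq c y : uniq (unzip1 c) ->
  count_mem y c + count_mem (neg y) c = (y.1 \in unzip1 c).
Proof.
move=> uc; rewrite -(count_uniq_mem _ uc) count_map.
elim: c {uc} => //= x c <-; rewrite addnACA; congr (_ + _).
have [->|/eqP xy] := eqVneq x y; first by rewrite eqxx (negPf (neq_neg _)).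
have [->|/eqP xy'] := eqVneq x (neg y); first by rewrite /= eqxx.
by case: eqP => // /same_var[].
Qed.

Lemma count_step_lits z c v y : uniq (unzip1 c) ->
  count_mem y (step_lits z (rcons c v)) =
  (neg z == y) + (v == y) + (y.1 \in unzip1 c).
Proof.
move=> uc; rewrite (seq.permP (perm_step_lits _ _ _)) /= count_cat count_neg_map.
by rewrite count_lit_uniq // addnA.
Qed.

(** The first step contains [neg z], and the variable of [z] does not return later. *)
Lemma uniq_steps z s : uniq (z.1 :: unzip1 s) -> uniq (trail z s).
Proof.
elim: s z => //= y s IH z /and3P[nz ny us]; rewrite IH ?ny // andbT.
apply/negP => zt; have: neg z \in step_lits y s.
  by apply/trail_litP; exists (clause_of (neg z, y)); rewrite ?inE ?eqxx.
case/lastP: s zt us ny nz {IH} => // s v zt us ny nz.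
rewrite (perm_mem (perm_step_lits _ _ _)) !inE mem_cat => zin.
move: nz; rewrite inE negb_or => /andP[nzy]; rewrite /unzip1 map_rcons mem_rcons inE negb_or => /andP[nzv nzs].
case/or4P: zin => [/eqP/(congr1 fst)/= E|/eqP/(congr1 fst)/= E|zs|/mapP[x xs /(congr1 fst)/= E]].
- by rewrite E eqxx in nzy.
- by rewrite E eqxx in nzv.
- by move/(map_f fst): zs; rewrite (negPf nzs).
- by move: nzs; rewrite E (map_f fst).
Qed.

(* The first and the last clause are separated from the others by the literals c_0 and -c_k. *)
Lemma chain_uniq u c v : uniq (unzip1 c) -> 0 < size c ->
  [set u; head u c] != [set neg (last u c); v] -> uniq (chain u c v).
Proof.
case: c => // y c uc _; rewrite [head _ _]/= [last _ _]/= => ne.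
rewrite chain_cons -cats1 trail_cat.
rewrite [trail (last y c) _]trail_cons cats1 cons_uniq mem_rcons inE rcons_uniq negb_or.
apply/and3P; split; last exact: uniq_steps.
- rewrite ne /=; apply/negP => h.
  have: y \in step_lits y c.
    by apply/trail_litP; exists (clause_of (u, y)) => //; rewrite !inE eqxx orbT.
  case/lastP: c uc {ne h} => // c x uc.
  rewrite (perm_mem (perm_step_lits _ _ _)) !inE mem_cat (negPf (neq_neg _)) /=.
  move: uc => /= /andP[+ _]; rewrite /unzip1 map_rcons mem_rcons inE negb_or => /andP[yx yc].
  case/or3P=> [/eqP E|yc'|/mapP[t tc E]]; first by rewrite E eqxx in yx.
    by move/(map_f fst): yc'; rewrite (negPf yc).
  by move: yc; rewrite E /= (map_f fst).
apply/negP => h.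
have: neg (last y c) \in step_lits y c.
  by apply/trail_litP; exists (clause_of (neg (last y c), v)) => //; rewrite !inE eqxx.
case/lastP: c uc {ne h} => // c x uc; rewrite last_rcons.
rewrite (perm_mem (perm_step_lits _ _ _)) !inE mem_cat (negPf (neg_neq _)) /=.
move: uc; rewrite /= /unzip1 map_rcons mem_rcons inE rcons_uniq negb_or -andbA => /and4P[yx yc xc _].
case/or3P=> [/eqP /(congr1 fst)/= E|yc'|/mapP[t tc /neg_inj E]].
- by rewrite E eqxx in yx.
- by move/(map_f fst): yc'; rewrite /= (negPf xc).
- by move: xc; rewrite E (map_f fst).
Qed.

End Trails.

Arguments trail : simpl never.
Arguments step_lits : simpl never.
Arguments chain : simpl never.
Arguments revneg : simpl never.

(** * Lassos, ears and bicycles *)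

Section Structures.
Variable n : nat.
Implicit Types (x y z u v : literal n) (s c w : seq (literal n)) (S G M : formula n).
Implicit Type V : {set 'I_n}.

Lemma clauses_set2 y z : ([set y; z] \in clauses n) = (y.1 != z.1).
Proof.
apply/imsetP/idP => [[[a b]] /=|yz]; last by exists (y, z); rewrite ?inE.
rewrite inE /= => ab E; apply: contraNneq ab => yz.
have var t : t \in [set y; z] -> t.1 = z.1 by rewrite !inE => /orP[]/eqP->.
by rewrite (var a) ?(var b) // E !inE eqxx ?orbT.
Qed.

Lemma clause_split d y : d \in clauses n -> y \in d ->
  exists2 z, d = [set y; z] & y.1 != z.1.
Proof.
move=> dC yd; have /imsetP[[a b] _ /= E] := dC.
move: dC; rewrite E => dC; move: yd; rewrite E !inE => /orP[]/eqP->.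
  by exists b; rewrite -?clauses_set2.
by exists a; [rewrite setUC | rewrite -clauses_set2 setUC].
Qed.

Lemma pure_free_neg G y d : pure_free G -> d \in G -> y \in d ->
  exists2 d', d' \in G & neg y \in d'.
Proof.
move=> /forallP/(_ y); rewrite /pure negb_and -eqn0Ngt => pf dG yd.
have : 0 < degree G y by apply/card_gt0P; exists d; rewrite inE dG.
rewrite lt0n => /negPf dy; rewrite dy /= -lt0n in pf.
by case/card_gt0P: pf => d'; rewrite inE => /andP[]; exists d'.
Qed.

Lemma size_uniq_ord (r : seq 'I_n) : uniq r -> size r <= n.
Proof. by move/card_uniqP=> <-; rewrite -[n in _ <= n]card_ord max_card. Qed.

(** The last literal of a path lies in a clause, so by pure-freeness its negation does too, and the
    other literal of that clause prolongs the path. The path stops on [V] or on itself; [k] bounds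
    the remaining extensions, since the variables met are distinct. *)
Lemma lasso G V y d : G \subset clauses n -> pure_free G ->
    d \in G -> y \in d -> y.1 \notin V ->
  exists s z, [/\ uniq (unzip1 (y :: s)), {in y :: s, forall t, t.1 \notin V},
    {subset trail y (rcons s z) <= G} & (z.1 \in V) || (z.1 \in unzip1 (y :: s))].
Proof.
move=> GC pf dG yd yV.
suff gen k s : n <= size s + k -> uniq (unzip1 (y :: s)) ->
    {in y :: s, forall t, t.1 \notin V} -> {subset trail y s <= G} ->
    exists s z, [/\ uniq (unzip1 (y :: s)), {in y :: s, forall t, t.1 \notin V},
    {subset trail y (rcons s z) <= G} & (z.1 \in V) || (z.1 \in unzip1 (y :: s))].
  by apply: (gen n [::]) => // t; rewrite inE => /eqP->.
elim: k s => [|k IH] s; rewrite ?addn0 => le_n us sV sG.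
  by have := size_uniq_ord us; rewrite size_map /= ltnNge le_n.
(* For the empty path this clause is [d]; afterwards it is the last step. *)
have [d1 d1G ld1] : exists2 d1, d1 \in G & last y s \in d1.
  case/lastP: s sG {IH le_n us sV} => [|s t] sG; first by exists d.
  exists (clause_of (neg (last y s), t)); last by rewrite last_rcons !inE eqxx orbT.
  by apply: sG; rewrite -cats1 trail_cat mem_cat !inE eqxx orbT.
have [d2 d2G nd2] := pure_free_neg pf d1G ld1.
have [z Ez nz] := clause_split (subsetP GC _ d2G) nd2.
have sG' : {subset trail y (rcons s z) <= G}.
  move=> e; rewrite -cats1 trail_cat mem_cat => /orP[/sG //|].
  by rewrite inE => /eqP->; rewrite /clause_of /= -Ez.
have [zin|] := boolP ((z.1 \in V) || (z.1 \in unzip1 (y :: s))).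
  by exists s, z.
rewrite negb_or => /andP[zV zs].
apply: (IH (rcons s z)) => //; first by rewrite size_rcons addSnnS.
- by rewrite /unzip1 -rcons_cons map_rcons rcons_uniq zs us.
- by move=> t; rewrite -rcons_cons mem_rcons inE => /orP[/eqP->//|/sV].
Qed.

(* A path leaving the variables V and ending on V or on itself. *)
Definition ear V S G y w z :=
  [&& y.1 \in V, uniq (unzip1 w), all [predC V] (unzip1 w),
      (z.1 \in V) || (z.1 \in unzip1 w), all [in G] (chain y w z)
    & (w == [::]) ==> all [predC S] (chain y w z)].

Lemma ear_exists V S G d y : G \subset clauses n -> pure_free G ->
    d \in G -> d \notin S -> y \in d -> y.1 \in V ->
  exists x w z, ear V S G x w z.
Proof.
move=> GC pf dG dS yd yV; exists y.
have [z Ez yz] := clause_split (subsetP GC _ dG) yd.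
have [zV|zV] := boolP (z.1 \in V).
  exists [::], z; rewrite /ear yV zV /= /chain /= negK /clause_of /= -Ez dG /=.
  by rewrite dS.
have zd : z \in d by rewrite Ez !inE eqxx orbT.
have [s [z' [us sV sG zin]]] := lasso GC pf dG zd zV.
exists (z :: s), z'; rewrite /ear yV us zin andbT !andTb; apply/andP; split.
  by apply/allP => _ /mapP[t ts ->]; exact: sV.
by rewrite chain_cons /= /clause_of /= -Ez dG; exact/allP.
Qed.

(** This is what a nonempty word buys: every clause of the chain can be told apart from clauses over
    other variables. *)
Lemma chain_has_var u c v d : 0 < size c -> d \in chain u c v ->
  exists2 y, y \in d & y.1 \in unzip1 c.
Proof.
rewrite chainE trail_cat mem_cat => c0 /orP[/mapP[t tc ->]|]; last first.
  rewrite inE => /eqP->; exists (neg (last (neg u) c)); first by rewrite !inE eqxx.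
  by case: c c0 => // a c _; rewrite /= (map_f fst (mem_last a c)).
exists t.2; first by rewrite !inE eqxx orbT.
apply: map_f; elim: c (neg u) tc {c0} => //= a c IH x.
by rewrite !inE => /orP[/eqP->|/IH->]; rewrite ?eqxx ?orbT.
Qed.

Lemma head_neq_last u w : uniq (unzip1 w) -> 0 < size w -> neg (last u w) != head u w.
Proof.
case: w => // a w uw _ /=; case/lastP: w uw => [|w b]; first by rewrite neg_neq.
rewrite last_rcons /= /unzip1 map_rcons mem_rcons inE negb_or => /andP[/andP[ab _] _].
by apply: contraNneq ab => <-.
Qed.

Lemma chain_uniq_out u c v : uniq (unzip1 c) -> 0 < size c -> u.1 \notin unzip1 c ->
  uniq (chain u c v).
Proof.
move=> uc c0 uout; apply: chain_uniq => //; apply/eqP => E.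
have: neg (last u c) \in [set u; head u c] by rewrite E !inE eqxx.
rewrite !inE (negPf (head_neq_last u uc c0)) orbF => /eqP/(congr1 fst)/= E'.
by case: c c0 uout E' {uc E} => //= a c _ + E'; rewrite -E' (map_f fst (mem_last a c)).
Qed.

(** Each clause of a nonempty ear contains a variable outside [V], hence is not in [S]; for the
    one-clause ear this is the last conjunct of [ear]. The exact count gives an ear with [l] inner
    literals the extra factor [p^(l+1)]. *)
Lemma ear_card V S G y w z : G \subset clauses n -> S \subset G ->
    (forall d t, d \in S -> t \in d -> t.1 \in V) -> ear V S G y w z ->
  (S :|: [set d in chain y w z] \subset G) /\
  #|S :|: [set d in chain y w z]| = #|S| + (size w).+1.
Proof.
move=> GC SG SV /and5P[yV uw wV zV /andP[wG wS]].
have wV' t : t \in unzip1 w -> t \in V = false by move/(allP wV)/negPf.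
split; first by rewrite subUset SG; apply/subsetP => d; rewrite inE => /(allP wG).
have uc : uniq (chain y w z).
  case: (posnP (size w)) => [/size0nil-> //|w0]; apply: chain_uniq_out => //.
  by apply/negP => /wV'; rewrite yV.
rewrite cardsU -setIdE [X in _ - X](_ : _ = 0) ?subn0.
  by rewrite cardsE (card_uniqP uc) size_chain.
apply/eqP; rewrite cards_eq0; apply/eqP/setP => d; rewrite !inE.
apply/negbTE/negP => /andP[dS dw].
have [w0|w0] := posnP (size w).
  move: wS; rewrite (size0nil w0) eqxx => /allP/(_ d).
  by rewrite (size0nil w0) in dw; move=> /(_ dw); rewrite inE dS.
have [t td tw] := chain_has_var w0 dw.
by have := SV _ _ dS td; rewrite wV'.
Qed.

(** The inequality forbids the two end clauses to coincide. Without it a plain directed cycle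
    [w_0 -> ... -> w_k -> w_0] would qualify, with [u = -w_k] and [v = w_0]: it has one clause
    fewer, and all its variables are of type (1,1). *)
Definition bicycle G u w v :=
  [&& uniq (unzip1 w), 0 < size w, u.1 \in unzip1 w, v.1 \in unzip1 w,
      [set u; head u w] != [set neg (last u w); v] & all [in G] (chain u w v)].

Lemma bicycle_uniq G u w v : bicycle G u w v -> uniq (chain u w v).
Proof. by case/and5P=> uw w0 _ _ /andP[ne _]; exact: chain_uniq. Qed.

Lemma bicycle_card G u w v : bicycle G u w v ->
  #|[set d in chain u w v]| = (size w).+1.
Proof. by move/bicycle_uniq/card_uniqP; rewrite cardsE => ->; rewrite size_chain. Qed.

Lemma bicycle_exists G y : G \subset clauses n -> pure_free G ->
  1 < degree G y -> exists u w v, bicycle G u w v.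
Proof.
move=> GC pf /card_gt1P[d1 [d2 [+ + d12]]]; rewrite !inE => /andP[d1G yd1] /andP[d2G yd2].
have [s [z [us _ sG]]] := lasso GC pf d1G yd1 (negbT (in_set0 _)).
rewrite in_set0 /= => zs; set W := y :: s.
(* The closing clause of the lasso. Of the two clauses on [y] at least one differs from it and can
   serve as the opening clause. *)
pose cl := [set neg (last y s); z].
have [d [dG yd dcl]] : exists d, [/\ d \in G, y \in d & d != cl].
  by have [E|] := eqVneq d1 cl; [exists d2; rewrite -E eq_sym | exists d1].
have [u Eu yu] := clause_split (subsetP GC _ dG) yd.
have Gu : {subset trail (neg u) (W ++ [:: z]) <= G}.
  move=> e; rewrite cat_cons trail_cons inE cats1 => /orP[/eqP->|/sG //].
  by rewrite /clause_of /= negK setUC -Eu.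
have [uW|uW] := boolP (u.1 \in unzip1 W).
  exists u, W, z; rewrite /bicycle us uW zs !andTb; apply/andP; split; first by rewrite /= setUC -Eu.
  by rewrite chainE; apply/allP; exact: Gu.
have ud : u \in d by rewrite Eu !inE eqxx orbT.
pose V := [set t in unzip1 W].
have uV : u.1 \notin V by rewrite inE.
have [s' [z' [us' s'V s'G zs']]] := lasso GC pf dG ud uV.
(* If [u] is off the path, a second lasso leaves from [u]; by contraposition it becomes a path
   leading into [y], and is put in front. *)
pose W' := revneg (u :: s') ++ W.
have hW' : head z' W' = neg (last u s').
  by rewrite /W'; case/lastP: s' {us' s'V s'G zs' W'} => [|s' t] //; rewrite -rcons_cons revneg_rcons last_rcons.
have lW' : last z' W' = last y s by rewrite last_cat.
have vW' : unzip1 W' = rev (unzip1 (u :: s')) ++ unzip1 W.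
  by rewrite /W' /unzip1 map_cat -!/(unzip1 _) unzip1_revneg.
exists z', W', z; rewrite /bicycle hW' lW' vW'; apply/and5P; split.
- rewrite cat_uniq rev_uniq us' us andbT andTb; apply/hasPn => t tW.
  rewrite mem_rev; apply/negP => /mapP[r /s'V rV E]; move: rV.
  by rewrite -E inE tW.
- by rewrite size_cat addnS.
- by rewrite mem_cat mem_rev; move: zs'; rewrite inE orbC.
- by rewrite mem_cat zs orbT.
apply/andP; split.
  (* The end clauses differ: the new one contains the last literal of the second lasso, which is off
     [W], whereas the old one lives on [W]. *)
  have lV := s'V _ (mem_last u s').
  apply/eqP => E; have: neg (last u s') \in [set neg (last y s); z] by rewrite -E !inE eqxx orbT.
  rewrite !inE => /orP[/eqP/(congr1 fst)/= E1|/eqP/(congr1 fst)/= E1]; move: lV; rewrite E1 inE.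
    by rewrite /W (map_f fst (mem_last y s)).
  by rewrite zs.
apply/allP => e; rewrite chainE -catA trail_cat mem_cat => /orP[|].
  have := trail_rev u (rcons s' z'); rewrite last_rcons belast_rcons => ->.
  by rewrite mem_rev => /s'G.
by rewrite revneg_cons last_rcons; exact: Gu.
Qed.

Lemma count_clauses (L : seq (literal n * literal n)) y :
  all (fun t => t.1 != t.2) L ->
  count (fun d : {set literal n} => y \in d) (map (@clause_of n) L) =
  count_mem y (flatten [seq [:: t.1; t.2] | t <- L]).
Proof.
elim: L => //= t L IH /andP[ne /IH->]; rewrite !inE addnA; congr (_ + _).
rewrite ![y == _]eq_sym; case: (eqVneq t.1 y) ne => [->|_] //=.
by rewrite eq_sym => /negPf->.
Qed.

Lemma steps_neq z s : {subset trail z s <= clauses n} ->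
  all (fun t => t.1 != t.2) (steps z s).
Proof.
move=> sC; apply/allP => t ts; have := sC _ (map_f _ ts).
by rewrite clauses_set2; apply: contraNneq => ->.
Qed.

Lemma card_trail z s y : {subset trail z s <= clauses n} -> uniq (trail z s) ->
  #|[set d in trail z s | y \in d]| = count_mem y (step_lits z s).
Proof.
move=> sC us; rewrite -count_clauses ?steps_neq // -size_filter.
rewrite -(card_uniqP (filter_uniq _ us)); apply: eq_card => d.
by rewrite !inE mem_filter andbC.
Qed.

End Structures.

(** * Satisfiability, core and kernel *)

Section Satisfiability.
Variable n : nat.
Implicit Types (x y z u v : literal n) (s c w : seq (literal n)) (S G M F : formula n).
Implicit Type V : {set 'I_n}.
Implicit Type a : {ffun 'I_n -> bool}.

Definition holds a y := a y.1 == y.2.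

Lemma holds_neg a y : holds a (neg y) = ~~ holds a y.
Proof. by rewrite /holds /=; case: (a _) (y.2) => [] []. Qed.

Lemma satisfiesP a S :
  reflect (forall d, d \in S -> exists2 y, y \in d & holds a y) (satisfies a S).
Proof.
apply: (iffP forall_inP) => h d /h => [/exists_inP[y]|[y yd hy]].
  by exists y.
by apply/exists_inP; exists y.
Qed.

Lemma satisfiesS a S G : S \subset G -> satisfies a G -> satisfies a S.
Proof. by move=> /subsetP sSG /satisfiesP h; apply/satisfiesP => d /sSG/h. Qed.

Lemma satisfies_trail a z s (S := [set d in trail z s]) :
  satisfies a S = path (fun x y => holds a x ==> holds a y) z s.
Proof.
rewrite {}/S; elim: s z => [|y s IH] z.
  by apply/satisfiesP => d; rewrite inE.
rewrite /= -IH; apply/satisfiesP/andP => [h|[zy /satisfiesP h] d].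
  split; last first.
    by apply/satisfiesP => d; rewrite inE => dt; apply: h; rewrite inE trail_cons inE dt orbT.
  have [|t] := h (clause_of (neg z, y)); first by rewrite inE trail_cons mem_head.
  by rewrite !inE => /orP[]/eqP-> /=; rewrite ?holds_neg; [move/negPf-> | move->; rewrite implybT].
rewrite inE trail_cons inE => /orP[/eqP->|dt]; last by apply: h; rewrite inE.
move: zy; rewrite implybE => /orP[nz|hy].
  by exists (neg z); rewrite ?holds_neg // !inE eqxx.
by exists y; rewrite // !inE eqxx orbT.
Qed.

(** Threshold assignments, false up to some point of the path and true afterwards, satisfy every
    implication along it. *)
Lemma path_imply a z s A B : z :: s = A ++ B ->
    all (fun y => ~~ holds a y) A -> all (holds a) B ->
  path (fun x y => holds a x ==> holds a y) z s.
Proof.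
elim: s z A B => //= y s IH z [|x A] B /=.
  move=> <- _ /= /and3P[-> hy hs]; rewrite hy; apply: (IH y [::] (y :: s)) => //=.
  by rewrite hy.
by move=> [-> E] /andP[/negPf-> hA] hB; apply: IH E _ _.
Qed.

Lemma assignment_of s : uniq (unzip1 s) -> exists a, {in s, forall y, holds a y}.
Proof.
move=> us; exists [ffun i => (i, true) \in s] => -[i b] ys.
rewrite /holds ffunE /=; apply/eqP; case: b ys => // ys.
apply/negbTE/negP => ys'; have := count_lit_uniq (i, true) us.
rewrite (map_f fst ys') -[neg _]/(i, false) => E.
have : 0 < count_mem ((i, true) : literal n) s by rewrite -has_count has_pred1.
have : 0 < count_mem ((i, false) : literal n) s by rewrite -has_count has_pred1.
move: E; case: (count_mem _ s) => // k; case: (count_mem _ s) => // l.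
by rewrite addnS.
Qed.

Lemma unzip1_neg s : unzip1 (map (@neg n) s) = unzip1 s.
Proof. by rewrite /unzip1 -map_comp. Qed.

(** Each violated conclusion leaves room for a threshold assignment: all of [w] false if [neg u]
    lies in [w], all true if [v] does, and a switch at [u] if [neg v] comes before [u]. The
    conclusion fixes the signs and the order of the closing literals, which singles out the
    unsatisfiable kernel. *)
Lemma bicycle_unsat G u w v : bicycle G u w v ->
  ~~ satisfiable [set d in chain u w v] ->
  [/\ u \in w, neg v \in w & index u w <= index (neg v) w].
Proof.
case/and5P=> uw w0 uin vin _ /existsPn unsat.
have nsat a A B : neg u :: w ++ [:: v] = A ++ B ->
    all (fun y => ~~ holds a y) A -> all (holds a) B -> False.
  move=> E hA hB; have := unsat a; rewrite chainE satisfies_trail.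
  by rewrite (path_imply E).
have uw_in : u \in w.
  apply/negPn/negP => nuw.
  have nuw' : neg u \in w by move: uin; rewrite neg_in_chain (negPf nuw).
  have [|a ha] := @assignment_of (map (@neg n) w); first by rewrite unzip1_neg.
  have hw : all (fun y => ~~ holds a y) (neg u :: w).
    have h y : y \in w -> ~~ holds a y by rewrite -holds_neg => yw; apply/ha/map_f.
    by rewrite /= h //=; apply/allP.
  case: (boolP (holds a v)) => hv; first by apply: (nsat a (neg u :: w) [:: v]); rewrite //= hv.
  by apply: (nsat a (neg u :: w ++ [:: v]) [::]); rewrite ?cats0 // -cat_cons all_cat hw /= hv.
have vw_in : neg v \in w.
  apply/negPn/negP => nvw.
  have vw' : v \in w by move: vin; rewrite neg_in_chain (negPf nvw) orbF.
  have [a ha] := assignment_of uw.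
  have hw : all (holds a) (w ++ [:: v]).
    by rewrite all_cat /= andbT (ha v) // andbT; apply/allP.
  case: (boolP (holds a (neg u))) => hu.
    by apply: (nsat a [::] (neg u :: w ++ [:: v])); rewrite //= hu.
  by apply: (nsat a [:: neg u] (w ++ [:: v])); rewrite //= hu.
(* False before the position of [u], true from there on: [u] is true and [neg v] is false, so both
   end clauses hold. *)
split=> //; rewrite leqNgt; apply/negP => lt.
set m := index u w in lt; have dE := cat_take_drop m w.
have us : uniq (unzip1 (map (@neg n) (take m w) ++ drop m w)).
  by rewrite /unzip1 map_cat -!/(unzip1 _) unzip1_neg /unzip1 -map_cat dE.
have [a ha] := assignment_of us.
have hA y : y \in take m w -> ~~ holds a y.
  by move=> yw; rewrite -holds_neg; apply: ha; rewrite mem_cat map_f.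
have hB y : y \in drop m w -> holds a y by move=> yw; apply: ha; rewrite mem_cat yw orbT.
apply: (nsat a (neg u :: take m w) (drop m w ++ [:: v])).
- by rewrite /= catA dE.
- rewrite /= holds_neg hB /=; first by apply/allP.
  by rewrite (drop_nth u) ?index_mem // nth_index // mem_head.
rewrite all_cat /= andbT; apply/andP; split; first by apply/allP.
rewrite -[v]negK holds_neg; apply: hA.
have := dE => /esym Ew; move: vw_in; rewrite {1}Ew mem_cat => /orP[//|vd].
move: lt; rewrite {1}Ew index_cat; case: ifP => // _.
by rewrite size_take /m index_mem uw_in ltnNge leq_addr.
Qed.

Definition minimal_unsat M :=
  ~~ satisfiable M /\ forall S, S \proper M -> satisfiable S.

Lemma minimal_unsat_exists F : ~~ satisfiable F ->
  exists2 M : formula n, M \subset F & minimal_unsat M.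
Proof.
move=> uF; have [M /minsetP[uM minM] sMF] := @minset_exists _ (fun S => ~~ satisfiable S) F uF.
exists M => //; split=> // S /properP[sSM [d dM dS]]; case: (boolP (satisfiable S)) => // uS.
by move: dS; rewrite (minM S uS sSM) dM.
Qed.

(** An assignment of the clauses without the pure literal [y] survives setting [y] true, because
    [neg y] occurs nowhere. *)
Lemma minimal_unsat_pure_free M : minimal_unsat M -> pure_free M.
Proof.
move=> [uM minM]; apply/forallP => y; apply/negP => py.
have sR : remove_literal M y \proper M.
  by rewrite properEcard remove_subset remove_card.
have /existsP[a /satisfiesP ha] := minM _ sR.
case/existsP: uM; exists [ffun i => if i == y.1 then y.2 else a i].
apply/satisfiesP => d dM; have [yd|yd] := boolP (y \in d).
  by exists y; rewrite // /holds ffunE eqxx.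
have [|z zd hz] := ha d; first by rewrite inE dM.
exists z => //; rewrite /holds ffunE; case: (eqVneq z.1 y.1) => [/same_var[E|E]|//].
  by move: yd; rewrite -E zd.
case/andP: py => _; rewrite cards_eq0 => /eqP/setP/(_ d).
by rewrite !inE dM -E zd.
Qed.

(** Otherwise an assignment for [S], used on [V], and one for the other clauses, used off [V], could
    be glued together. *)
Lemma minimal_unsat_connected M S V : minimal_unsat M -> S \proper M -> S != set0 ->
    (forall d y, d \in S -> y \in d -> y.1 \in V) ->
  exists d y, [/\ d \in M, d \notin S, y \in d & y.1 \in V].
Proof.
move=> [uM minM] pS S0 SV; have sSM := proper_sub pS.
have /existsP[a /satisfiesP ha] := minM _ pS.
have pR : M :\: S \proper M.
  rewrite properE subsetDl; case/set0Pn: S0 => d dS; apply/subsetPn; exists d.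
    exact: (subsetP sSM).
  by rewrite inE dS.
have /existsP[b /satisfiesP hb] := minM _ pR.
case: (boolP [exists d in M :\: S, [exists y in d, y.1 \in V]]).
  case/exists_inP=> d; rewrite inE => /andP[dS dM] /exists_inP[y yd yV].
  by exists d, y.
rewrite negb_exists_in => /forall_inP out; case/existsP: uM.
exists [ffun i => if i \in V then a i else b i]; apply/satisfiesP => d dM.
have [dS|dS] := boolP (d \in S).
  by have [y yd hy] := ha d dS; exists y; rewrite // /holds ffunE (SV d).
have dR : d \in M :\: S by rewrite inE dS.
have [y yd hy] := hb d dR; exists y; rewrite // /holds ffunE.
by have := out d dR; rewrite negb_exists_in => /forall_inP/(_ y yd)/negPf->.
Qed.

(** If no literal lay in two clauses, a lasso would use up all occurrences of its variables; being
    satisfiable, it would be a proper part of [M] that no other clause touches. *)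
Lemma minimal_unsat_degree M : M \subset clauses n -> minimal_unsat M ->
  exists y, 1 < degree M y.
Proof.
move=> MC mM; have pf := minimal_unsat_pure_free mM; have [uM _] := mM.
have [y dy|small] := pickP (fun y => 1 < degree M y); first by exists y.
have [M0|[d dM]] := set_0Vmem M.
  by case/existsP: uM; exists [ffun=> true]; apply/satisfiesP => d; rewrite M0 inE.
have [y yd] : exists y, y \in d.
  by case/imsetP: (subsetP MC _ dM) => -[a b] _ ->; exists a; rewrite !inE eqxx.
have uniq_d x e e' : e \in M -> e' \in M -> x \in e -> x \in e' -> e = e'.
  move=> eM e'M xe xe'; apply/eqP/negPn/negP => ne; have /negP := negbT (small x).
  by case; apply/card_gt1P; exists e, e'; rewrite !inE eM e'M.
have [s [z [us _ sM]]] := lasso MC pf dM yd (negbT (in_set0 _)); rewrite in_set0 /= => zs.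
pose S := [set e in trail y (rcons s z)].
have sSM : S \subset M by apply/subsetP => e; rewrite inE => /sM.
have memS x : x \in step_lits y (rcons s z) -> exists2 e, e \in S & x \in e.
  by move=> /trail_litP[e eS xe]; exists e; rewrite ?inE.
have litS x : x.1 \in unzip1 (y :: s) -> x \in step_lits y (rcons s z).
  rewrite (perm_mem (perm_step_lits _ _ _)) neg_in_chain !inE mem_cat => xin.
  have [//|xy] := eqVneq x (neg y); have [//|xz] := eqVneq x z.
  have inm t : neg t \in s -> t \in map (@neg n) s by move=> ts; rewrite -[t]negK map_f.
  rewrite (can2_eq (@negK n) (@negK n)) (negPf xy) /= in xin.
  case/orP: xin => [/orP[/eqP E|->//]|/inm->]; last by rewrite orbT.
  (* The start y of the lasso has no incoming step, so it has to be the closing literal z. *)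
  exfalso; move: (zs : z.1 \in unzip1 (y :: s)); rewrite neg_in_chain !inE.
  rewrite -E eq_sym (negPf xz) /= => zs1.
  have zin : z \in neg y :: s ++ map (@neg n) s.
    rewrite inE mem_cat; case/orP: zs1 => [->|/orP[/eqP E2|/inm->]]; rewrite ?orbT //.
    by rewrite -E -E2 negK eqxx.
  have sC : {subset trail y (rcons s z) <= clauses n} by move=> e /sM/(subsetP MC).
  have ut : uniq (trail y (rcons s z)).
    rewrite -cats1 trail_cat cats1 rcons_uniq uniq_steps // andbT.
    apply/negP => h.
    have: neg (last y s) \in step_lits y s.
      by apply/trail_litP; exists (clause_of (neg (last y s), z)); rewrite // !inE eqxx.
    case/lastP: (s) us {h} => // s' t; rewrite last_rcons /= (perm_mem (perm_step_lits _ _ _)).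
    rewrite /unzip1 map_rcons rcons_uniq mem_rcons inE negb_or !inE mem_cat (negPf (neg_neq _)) /=.
    case/andP=> /andP[yt _] /andP[ts _] /or3P[/eqP/(congr1 fst)/= E'|/(map_f fst)/= h|/mapP[r rs /neg_inj E']].
    - by rewrite E' eqxx in yt.
    - by rewrite h in ts.
    - by rewrite E' (map_f fst) in ts.
  have: #|[set e in trail y (rcons s z) | z \in e]| <= 1.
    rewrite leqNgt; apply/negP => /card_gt1P[e [e' [+ + ne]]]; rewrite !inE => /andP[eS ze] /andP[eS' ze'].
    by rewrite (uniq_d z e e') ?eqxx ?sM in ne.
  rewrite card_trail // (seq.permP (perm_step_lits _ _ _)).
  have -> X : count_mem z [:: neg y, z & X] = (count_mem z (neg y :: X)).+1.
    by rewrite /= eqxx addnCA.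
  by rewrite ltnS leqn0; apply/negP; rewrite -lt0n -has_count has_pred1.
(* With all path literals false every step has a false premise, whatever the value of [z]. *)
have satS : satisfiable S.
  have [|a ha] := @assignment_of (map (@neg n) (y :: s)); first by rewrite unzip1_neg.
  have hA : all (fun t => ~~ holds a t) (y :: s).
    by apply/allP => t ts; rewrite -holds_neg; apply/ha/map_f.
  apply/existsP; exists a; rewrite satisfies_trail.
  case: (boolP (holds a z)) => hz.
    by apply: (@path_imply a y _ (y :: s) [:: z]); rewrite ?cats1 //= hz.
  apply: (@path_imply a y _ (y :: rcons s z) [::]); rewrite ?cats0 //.
  by rewrite -rcons_cons all_rcons hz.
have pS : S \proper M by rewrite properEneq sSM andbT; apply: contraNneq uM => <-.
pose V := [set i in unzip1 (y :: s)].
have SV e t : e \in S -> t \in e -> t.1 \in V.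
  rewrite !inE => et te.
  have: t \in step_lits y (rcons s z) by apply/trail_litP; exists e.
  rewrite (perm_mem (perm_step_lits _ _ _)) !inE mem_cat => /or4P[/eqP->|/eqP->|ts|/mapP[r rs ->]].
  - by rewrite eqxx.
  - exact: zs.
  - by rewrite (map_f fst ts) orbT.
  - by rewrite (map_f fst rs) orbT.
have S0 : S != set0.
  have [|e eS _] := memS (neg y); last by apply/set0Pn; exists e.
  by rewrite (perm_mem (perm_step_lits _ _ _)) mem_head.
have [e [x [eM eS xe xV]]] := minimal_unsat_connected mM pS S0 SV.
rewrite inE in xV; have [e' e'S xe'] := memS x (litS x xV).
by rewrite (uniq_d x e e' eM (subsetP sSM _ e'S) xe xe') e'S in eS.
Qed.

Lemma core_subset F : core F \subset F.
Proof. exact: pure_run_subset (core_run F).1. Qed.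

Lemma pure_free_core F : pure_free (core F).
Proof. exact: (core_run F).2. Qed.

Lemma sub_core F S : S \subset F -> pure_free S -> S \subset core F.
Proof. by move=> sSF pS; exact: pure_run_max (core_run F).1 pS sSF. Qed.

Lemma core_var_degree F x (y : 'I_n) : y \in core_vars F -> x.1 = y -> 0 < degree (core F) x.
Proof.
rewrite inE => /exists_inP[d dF] /orP h xy.
have [y' yd y'y] : exists2 y' : literal n, y' \in d & y'.1 = y.
  by case: h => h; [exists (y, true) | exists (y, false)].
have h2 : exists2 d', d' \in core F & x \in d'.
  have [->|->] := same_var (etrans xy (esym y'y)); first by exists d.
  exact: pure_free_neg (pure_free_core F) dF yd.
by case: h2 => d' d'F xd'; apply/card_gt0P; exists d'; rewrite inE d'F.
Qed.

(** The core has no pure literal, so the type of a core variable is at least (1,1); it differs from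
    (1,1) exactly when one of the two degrees exceeds 1. *)
Lemma kernel_degreeP F :
  reflect (exists y, 1 < degree (core F) y) (kernel_vars F != set0).
Proof.
apply: (iffP (set0Pn _)) => [[i]|[y dy]].
  rewrite inE /var_type => /andP[ic /and3P[d1 d2]]; rewrite xpair_eqE.
  have [le1|] := leqP (degree (core F) (i, true)) 1; last by exists (i, true).
  have [le2|] := leqP (degree (core F) (i, false)) 1; last by exists (i, false).
  by rewrite -[degree _ _ == 1]/(_ == _) !eqn_leq le1 d1 le2 d2.
have yc : y.1 \in core_vars F.
  case/card_gt1P: dy => d [_ [+ _ _]]; rewrite inE => /andP[dF yd].
  rewrite inE; apply/exists_inP; exists d => //.
  by case: y yd => i [] ->; rewrite ?orbT.
exists y.1; rewrite inE yc /var_type xpair_eqE.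
rewrite (core_var_degree (x := (y.1, true)) yc) // (core_var_degree (x := (y.1, false)) yc) //=.
by case: y dy {yc} => i [] /= /gtn_eqF->; rewrite ?andbF.
Qed.

Lemma all_type11 F :
  [forall x in core_vars F, var_type (core F) x == (1, 1)] = (kernel_vars F == set0).
Proof.
apply/forall_inP/eqP => [h|h x xc].
  apply/eqP; rewrite -subset0; apply/subsetP => x; rewrite inE => /andP[xc].
  by have := h x xc; rewrite /var_type => /eqP[-> ->].
apply/negPn/negP => ne; have: x \in kernel_vars F.
  rewrite inE xc; move: ne; rewrite /var_type => ->.
  by rewrite (core_var_degree (x := (x, true)) xc) // (core_var_degree (x := (x, false)) xc).
by rewrite h inE.
Qed.

(** The core contains every pure-free subformula, so a large degree found in [S] persists in the
    core. *)
Lemma kernel_nonempty F S y : S \subset F -> pure_free S -> 1 < degree S y ->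
  kernel_vars F != set0.
Proof.
move=> sSF pS dy; apply/kernel_degreeP; exists y; apply: leq_trans dy _.
exact: degreeS (sub_core sSF pS).
Qed.

Lemma kernel_bicycle F : F \subset clauses n -> kernel_vars F != set0 ->
  exists u w v, bicycle F u w v.
Proof.
move=> FC /kernel_degreeP[y dy].
have CC := subset_trans (core_subset F) FC.
have [u [w [v]]] := bicycle_exists CC (pure_free_core F) dy.
case/and5P=> uw w0 uin vin /andP[ne cG]; exists u, w, v.
rewrite /bicycle uw w0 uin vin ne /=; apply/allP => d /(allP cG).
exact: (subsetP (core_subset F)).
Qed.

Lemma unsat_bicycle F : F \subset clauses n -> ~~ satisfiable F ->
  exists u w v, bicycle F u w v /\
   (~~ satisfiable [set d in chain u w v] \/
    exists x c z, ear [set i in unzip1 w] [set d in chain u w v] F x c z).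
Proof.
move=> FC /minimal_unsat_exists[M sMF mM]; have MC := subset_trans sMF FC.
have pf := minimal_unsat_pure_free mM.
have [y dy] := minimal_unsat_degree MC mM.
have [u [w [v b]]] := bicycle_exists MC pf dy; exists u, w, v.
have [uw w0 uin vin /andP[ne /allP cG]] := and5P b.
split.
  rewrite /bicycle uw w0 uin vin ne /=; apply/allP => d /cG; exact: (subsetP sMF).
set S := [set d in _].
have SM : S \subset M by apply/subsetP => d; rewrite inE => /cG.
have [E|neq] := eqVneq S M; first by left; rewrite E; case: mM.
right; pose V := [set i in unzip1 w].
have SV d t : d \in S -> t \in d -> t.1 \in V.
  by rewrite !inE => dc /(chain_var_sub dc)/or3P[/eqP->|/eqP->|].
have pS : S \proper M by rewrite properEneq neq.
have S0 : S != set0 by rewrite -card_gt0 (bicycle_card b).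
have [d [x [dM dS xd xV]]] := minimal_unsat_connected mM pS S0 SV.
have [x' [c [z /and5P[xV' uc cV zV /andP[cM cS]]]]] := ear_exists MC pf dM dS xd xV.
exists x', c, z; rewrite /ear xV' uc cV zV cS andbT /=.
by apply/allP => e /(allP cM); exact: (subsetP sMF).
Qed.

End Satisfiability.

(** * Subdivisions of cubic kernels *)

Section Cubic.
Variable n : nat.
Implicit Types (x y z u v : literal n) (s w : seq (literal n)) (S G F : formula n).
Implicit Type V : {set 'I_n}.
Implicit Type a : {ffun 'I_n -> bool}.

Definition ends := {ffun 'I_3 -> literal n * literal n}.
(** Bounded sequences make the configurations a finite type over which one can sum; the bound [n]
    excludes nothing, as the variables of a word are distinct. *)
Definition chains := {ffun 'I_3 -> n.-bseq (literal n)}.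
Implicit Types (e : ends) (c : chains) (T : ends * chains).

Definition end_count e y := \sum_i (((e i).1 == y) + ((e i).2 == y)).

Definition end_var e (t : 'I_n) := [exists i, (t == (e i).1.1) || (t == (e i).2.1)].

(* The kernel formula with the three clauses e_i.1 \/ e_i.2 has one variable of type (2,1) or
   (1,2) on each of its two vertices; [b] restricts to the unsatisfiable kernels. *)
Definition cubic (b : bool) e :=
  [exists x, exists y, (x.1 != y.1) &&
     [forall z, end_count e z == count_mem z [:: x; x; neg x; y; y; neg y]]] &&
  (b ==> [forall a, exists i, ~~ holds a (e i).1 && ~~ holds a (e i).2]).

Definition separated e c :=
  [forall i, [&& 0 < size (c i), uniq (unzip1 (c i)) & all [predC end_var e] (unzip1 (c i))]] &&
  [forall i, forall j, (i != j) ==> all [predC unzip1 (c j)] (unzip1 (c i))].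

Definition subdivision e c : formula n :=
  \bigcup_i [set d in chain (e i).1 (c i) (e i).2].

Lemma end_countP e y : end_var e y.1 = (0 < end_count e y) || (0 < end_count e (neg y)).
Proof.
rewrite /end_count !lt0n !sum_nat_eq0 -negb_and.
apply/existsP/negP => [[i h] /andP[/forallP/(_ i) h1 /forallP/(_ i) h2]|h].
  move: h1 h2; rewrite !addn_eq0 !eqb0 => /andP[n1 n2] /andP[n3 n4].
  by case/orP: h => /eqP/same_var[] E; move: n1 n2 n3 n4; rewrite E ?negK ?eqxx.
apply/existsP; apply: contraT; rewrite negb_exists => /forallP out; case: h.
apply/andP; split; apply/forallP => i; have := out i; rewrite negb_or => /andP[n1 n2];
  by rewrite addn_eq0 !eqb0; apply/andP; split; [move: n1 | move: n2];
     apply: contraNneq => ->; rewrite /= eqxx.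
Qed.

Section Separated.
Variables (e : ends) (c : chains).
Hypothesis sep : separated e c.

Lemma chain_gt0 i : 0 < size (c i).
Proof. by case/andP: sep => /forallP/(_ i)/and3P[]. Qed.

Lemma chain_vars_uniq i : uniq (unzip1 (c i)).
Proof. by case/andP: sep => /forallP/(_ i)/and3P[]. Qed.

Lemma chain_var_end i t : t \in unzip1 (c i) -> end_var e t = false.
Proof. by case/andP: sep => /forallP/(_ i)/and3P[_ _ /allP h] _ /h/negPf. Qed.

Lemma chain_var_inj i j t : t \in unzip1 (c i) -> t \in unzip1 (c j) -> i = j.
Proof.
case/andP: sep => _ /forallP/(_ i)/forallP/(_ j)/implyP h ti tj.
by apply/eqP/negPn/negP => /h/allP/(_ t ti); rewrite /= tj.
Qed.

Lemma end_var1 i : end_var e (e i).1.1.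
Proof. by apply/existsP; exists i; rewrite eqxx. Qed.

Lemma end_var2 i : end_var e (e i).2.1.
Proof. by apply/existsP; exists i; rewrite eqxx orbT. Qed.

Lemma end1_notin i j : (e i).1.1 \notin unzip1 (c j).
Proof. by apply/negP => /chain_var_end; rewrite end_var1. Qed.

Lemma end2_notin i j : (e i).2.1 \notin unzip1 (c j).
Proof. by apply/negP => /chain_var_end; rewrite end_var2. Qed.

Lemma sep_chain_uniq i : uniq (chain (e i).1 (c i) (e i).2).
Proof. by apply: chain_uniq_out; rewrite ?chain_vars_uniq ?chain_gt0 ?end1_notin. Qed.

Lemma sep_chain_disjoint i j : i != j ->
  [disjoint [set d in chain (e i).1 (c i) (e i).2] & [set d in chain (e j).1 (c j) (e j).2]].
Proof.
move=> ij; apply/pred0P => d; rewrite /= !inE; apply/negbTE/negP => /andP[di dj].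
have [t td ti] := chain_has_var (chain_gt0 i) di.
have := chain_var_sub dj td; case/or3P=> [/eqP E|/eqP E|tj].
- by have := end1_notin j i; rewrite -E ti.
- by have := end2_notin j i; rewrite -E ti.
- by have := chain_var_inj ti tj; apply/eqP.
Qed.

Lemma card_bigcup_sep (A : 'I_3 -> {set {set literal n}}) :
    (forall i, A i \subset [set d in chain (e i).1 (c i) (e i).2]) ->
  #|\bigcup_i A i| = \sum_i #|A i|.
Proof.
move=> sA; rewrite -sum1_card partition_disjoint_bigcup; last first.
  move=> i j ij; apply: disjointWl (sA i) _; apply: disjointWr (sA j) _.
  exact: sep_chain_disjoint.
by apply: eq_bigr => i _; rewrite sum1_card.
Qed.

Lemma card_subdivision : #|subdivision e c| = \sum_i (size (c i)).+1.
Proof.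
rewrite card_bigcup_sep //; apply: eq_bigr => i _.
by rewrite cardsE (card_uniqP (sep_chain_uniq i)) size_chain.
Qed.

Lemma chain_clauses u s v : 0 < size s -> uniq (unzip1 s) -> u.1 \notin unzip1 s ->
  v.1 \notin unzip1 s -> {subset chain u s v <= clauses n}.
Proof.
move=> s0 us us' vs d; rewrite /chain.
have: uniq ((neg u).1 :: unzip1 s) by rewrite /= us us'.
have: v.1 != (last (neg u) s).1.
  by case: (s) s0 vs => //= a s' _; apply: contraNneq => ->; rewrite (map_f fst (mem_last a s')).
elim: s (neg u) {s0 us us' vs} => [|a s IH] y vs us; rewrite ?rcons_cons trail_cons inE.
  by move/eqP->; rewrite clauses_set2 eq_sym.
case/orP=> [/eqP->|]; last by apply: IH => //; case/andP: us.
by rewrite clauses_set2; move: us => /= /andP[+ _]; rewrite inE negb_or => /andP[].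
Qed.

Lemma subdivision_clauses : subdivision e c \subset clauses n.
Proof.
apply/bigcupsP => i _; apply/subsetP => d; rewrite inE.
by apply: chain_clauses; rewrite ?chain_gt0 ?chain_vars_uniq ?end1_notin ?end2_notin.
Qed.

(** The chains share no clause, so degrees add up; a chain contributes its two end literals and both
    literals of each inner variable once. *)
Lemma subdivision_degree y :
  degree (subdivision e c) y = end_count e y + \sum_i (y.1 \in unzip1 (c i)).
Proof.
rewrite /degree (_ : [set d in _ | _] =
    \bigcup_i [set d in chain (e i).1 (c i) (e i).2 | y \in d]); last first.
  apply/setP => d; rewrite inE; apply/andP/bigcupP => [[/bigcupP[i _ di] yd]|[i _]].
    by exists i; rewrite // inE yd andbT; move: di; rewrite inE.
  by rewrite inE => /andP[di yd]; split=> //; apply/bigcupP; exists i; rewrite // inE.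
rewrite card_bigcup_sep => [|i]; last by apply/subsetP => d; rewrite !inE => /andP[].
rewrite /end_count -big_split /=; apply: eq_bigr => i _.
rewrite card_trail; last exact: sep_chain_uniq.
  by rewrite count_step_lits ?chain_vars_uniq // negK.
by apply: chain_clauses; rewrite ?chain_gt0 ?chain_vars_uniq ?end1_notin ?end2_notin.
Qed.

Lemma subdivision_var d y : d \in subdivision e c -> y \in d ->
  end_var e y.1 \/ exists i, y.1 \in unzip1 (c i).
Proof.
case/bigcupP=> i _; rewrite inE => /chain_var_sub h /h/or3P[/eqP->|/eqP->|yi].
- by left; exact: end_var1.
- by left; exact: end_var2.
- by right; exists i.
Qed.

Lemma interior_degree i y : y.1 \in unzip1 (c i) -> degree (subdivision e c) y = 1.
Proof.
move=> yi; rewrite subdivision_degree.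
have := end_countP e y; rewrite (chain_var_end yi) => /esym/negbT.
rewrite negb_or -!eqn0Ngt => /andP[/eqP-> _]; rewrite add0n.
rewrite (bigD1 i) //= yi big1 // => j ji.
by apply/eqP; rewrite eqb0; apply: contraNN ji => /(chain_var_inj yi) ->.
Qed.

Lemma interior_unique i y d d' : y.1 \in unzip1 (c i) ->
  d \in subdivision e c -> d' \in subdivision e c -> y \in d -> y \in d' -> d = d'.
Proof.
move=> yi dS dS' yd yd'; apply/eqP/negPn/negP => ne.
suff: 1 < degree (subdivision e c) y by rewrite (interior_degree yi).
by apply/card_gt1P; exists d, d'; rewrite !inE dS dS'.
Qed.

Variable b : bool.
Hypothesis cub : cubic b e.

Lemma cubicE : exists x y, x.1 != y.1 /\
  forall z, end_count e z = count_mem z [:: x; x; neg x; y; y; neg y].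
Proof.
case/andP: cub => /existsP[x /existsP[y /andP[xy /forallP h]]] _.
by exists x, y; split=> // z; apply/eqP.
Qed.

Lemma end_count_neg y : 0 < end_count e y -> 0 < end_count e (neg y).
Proof.
have [x [z [_ E]]] := cubicE; rewrite !E.
by rewrite -!has_count !has_pred1 !inE !(can2_eq (@negK n) (@negK n)) !negK;
   case/or4P=> [->|->|->|/or3P[]->]; rewrite ?orbT.
Qed.

Lemma subdivision_pure_free : pure_free (subdivision e c).
Proof.
apply/forallP => y; rewrite /pure !subdivision_degree.
have [->|/end_count_neg] := posnP (end_count e y); last first.
  by rewrite lt0n addn_eq0 => /negPf->; rewrite andbF.
rewrite add0n addn_eq0 -[(neg y).1]/y.1; case: (\sum_i _) => //= k.
by rewrite andbF.
Qed.

Lemma cubic_degree : exists y, 1 < degree (subdivision e c) y.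
Proof.
have [x [y [_ E]]] := cubicE; exists x; rewrite subdivision_degree E /= eqxx.
by rewrite !addSn.
Qed.

(** The end variables can be read off the formula alone, so two configurations with the same
    subdivision have the same ends. *)
Lemma end_varP t : end_var e t <-> (exists2 y, y.1 = t & 1 < degree (subdivision e c) y).
Proof.
have [x [y [xy E]]] := cubicE; split=> [/existsP[i ti]|[z <-]].
  have tin z : z == (e i).1 \/ z == (e i).2 -> z \in [:: x; x; neg x; y; y; neg y].
    rewrite -has_pred1 has_count -E /end_count (bigD1 i) //= => -[]/eqP->;
    by rewrite eqxx ?addnS.
  have [z zt zin] : exists2 z, z.1 = t & z \in [:: x; x; neg x; y; y; neg y].
    by case/orP: ti => /eqP->; [exists (e i).1|exists (e i).2] => //; apply: tin; [left|right].
  have [xt|yt] : x.1 = t \/ y.1 = t.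
    by move: zin zt; rewrite !inE => /or4P[/eqP->|/eqP->|/eqP->|/or3P[]/eqP->]; auto.
  - by exists x; rewrite // subdivision_degree E /= eqxx !addSn.
  - by exists y; rewrite // subdivision_degree E /= eqxx !addSn !addnS.
move=> dz; case: (boolP (end_var e z.1)) => // /negP nz; exfalso.
have /card_gt0P[d] := ltnW dz; rewrite inE => /andP[dS zd].
case: (subdivision_var dS zd) => [//|[i zi]].
by rewrite (interior_degree zi) in dz.
Qed.

(** Membership in [V] is constant along each chain, and some chain joins the two end variables. *)
Lemma subdivision_connected V d0 y0 :
    (forall d y z, d \in subdivision e c -> y \in d -> z \in d -> y.1 \in V -> z.1 \in V) ->
    d0 \in subdivision e c -> y0 \in d0 -> y0.1 \in V ->
  forall d y, d \in subdivision e c -> y \in d -> y.1 \in V.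
Proof.
move=> closed d0S y0d y0V.
have closed_trail z s : {subset trail z s <= subdivision e c} ->
    (has (fun t => t.1 \in V) (z :: s)) -> all (fun t => t.1 \in V) (z :: s).
  elim: s z => [|t s IH] z sS; first by rewrite /= orbF => ->.
  have zt : (z.1 \in V) = (t.1 \in V).
    have dS : clause_of (neg z, t) \in subdivision e c by apply: sS; rewrite trail_cons mem_head.
    have zd : neg z \in clause_of (neg z, t) by rewrite !inE eqxx.
    have td : t \in clause_of (neg z, t) by rewrite !inE eqxx orbT.
    apply/idP/idP => h; first exact: (closed _ (neg z) t dS).
    exact: (closed _ t (neg z) dS).
  have sS' : {subset trail t s <= subdivision e c}.
    by move=> d ds; apply: sS; rewrite trail_cons inE ds orbT.
  rewrite [has _ _]/= [all _ _]/= zt; have := IH t sS' => /=.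
  by case: (t.1 \in V) => //= h /h.
have closed_chain i : [|| (e i).1.1 \in V, (e i).2.1 \in V | has (mem V) (unzip1 (c i))] ->
    [&& (e i).1.1 \in V, (e i).2.1 \in V & all (mem V) (unzip1 (c i))].
  have /(_ _) := closed_trail (neg (e i).1) (rcons (c i) (e i).2).
  rewrite /= has_rcons all_rcons /unzip1 has_map all_map; apply=> d di.
  by apply/bigcupP; exists i; rewrite // inE.
have [x [y [xy E]]] := cubicE.
have end_xy t : end_var e t -> t = x.1 \/ t = y.1.
  have inj z : z \in [:: x; x; neg x; y; y; neg y] -> z.1 = x.1 \/ z.1 = y.1.
    by rewrite !inE => /or4P[/eqP->|/eqP->|/eqP->|/or3P[]/eqP->]; auto.
  rewrite -[t]/(t, true).1 end_countP !E -!has_count !has_pred1.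
  by case/orP=> /inj.
(* Parity: three of the six chain ends lie at the variable of [x], so some chain has exactly one end
   there and its other end at the variable of [y]. *)
pose X (i : 'I_3) := ((e i).1.1 == x.1) + ((e i).2.1 == x.1).
have odd_X : \sum_i X i = 3.
  have -> : \sum_i X i = end_count e x + end_count e (neg x).
    rewrite /end_count -big_split /=; apply: eq_bigr => i _; rewrite /X.
    have split_var z : (z.1 == x.1) = (z == x) + (z == neg x) :> nat.
      have [->|zx] := eqVneq z x; first by rewrite eqxx (negPf (neq_neg _)).
      have [->|zx'] := eqVneq z (neg x); first by rewrite /= eqxx.
      by case: eqP => // /same_var[] E'; [rewrite E' eqxx in zx | rewrite E' eqxx in zx'].
    by rewrite !split_var addnACA.
  rewrite !E /= !eqxx (negPf (neg_neq _)) (negPf (neq_neg _)).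
  have out z : z.1 = y.1 -> ((z == x) = false) * ((z == neg x) = false).
    by move=> zy; split; apply: contraNF xy => /eqP E'; rewrite -zy E'.
  by rewrite !out.
have [i Xi] : exists i, odd (X i).
  apply/existsP; apply: contraT; rewrite negb_exists => /forallP even_X.
  have : odd (\sum_i X i) = false.
    elim/big_ind: _ => // [p q|i _]; first by rewrite oddD => -> ->.
    exact/negbTE/even_X.
  by rewrite odd_X.
have chain_eq j : ((e j).1.1 \in V) = ((e j).2.1 \in V).
  by apply/idP/idP => h; have := closed_chain j; rewrite h ?orbT => /(_ isT)/and3P[].
have xyV : (x.1 \in V) = (y.1 \in V).
  have := chain_eq i; move: Xi; rewrite /X.
  have [->|n1] := eqVneq (e i).1.1 x.1; have [->|n2] := eqVneq (e i).2.1 x.1 => //.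
    by case: (end_xy _ (end_var2 i)) => [E'|-> //]; rewrite E' eqxx in n2.
  by case: (end_xy _ (end_var1 i)) => [E'|-> //]; rewrite E' eqxx in n1.
have end_eq t : end_var e t -> (t \in V) = (x.1 \in V).
  by case/end_xy => ->.
have int_eq j t : t \in unzip1 (c j) -> (t \in V) = (x.1 \in V).
  move=> tj; rewrite -(end_eq _ (end_var1 j)); apply/idP/idP => h.
    have := closed_chain j; case/(_ _)/and3P => //.
    by apply/or3P/Or33/hasP; exists t.
  by have := closed_chain j; rewrite h => /(_ isT)/and3P[_ _ /allP/(_ t tj)].
have S_eq d z : d \in subdivision e c -> z \in d -> (z.1 \in V) = (x.1 \in V).
  by move=> dS /(subdivision_var dS)[/end_eq|[j /int_eq]].
by move=> d z dS zd; rewrite (S_eq d) // -(S_eq d0 y0).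
Qed.

End Separated.
End Cubic.

(** * Relabellings of a subdivision *)

Section Symmetries.
Variable n : nat.
Implicit Types (x y z u v : literal n) (s w : seq (literal n)) (S G F : formula n).
Implicit Type V : {set 'I_n}.
Implicit Type a : {ffun 'I_n -> bool}.
Implicit Types (e : ends n) (c : chains n).

Lemma trail_vars z s d y : d \in trail z s -> y \in d -> y.1 \in unzip1 (z :: s).
Proof.
elim: s z => // t s IH z; rewrite trail_cons inE => /orP[/eqP->|/IH h /h].
  by rewrite !inE => /orP[]/eqP->; rewrite /= eqxx ?orbT.
by rewrite [_ \in unzip1 (z :: _)]inE => ->; rewrite orbT.
Qed.

Lemma chain_outer u s v d y : 0 < size s -> d \in chain u s v -> y \in d ->
    y.1 \notin unzip1 s ->
  (y = u /\ d = [set u; head u s]) \/ (y = v /\ d = [set neg (last u s); v]).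
Proof.
case: s => // b s _; rewrite chain_cons -cats1 trail_cat inE mem_cat.
case/or3P=> [/eqP->|ds yd|].
- by rewrite !inE => /orP[] /eqP->; [left | case/negP; exact: mem_head].
- by rewrite (trail_vars ds yd).
rewrite inE => /eqP->; rewrite !inE => /orP[]/eqP->; last by right.
by case/negP; exact: (map_f fst (mem_last b s)).
Qed.

(* A walk is forced as long as its literals lie in a single clause. *)
Lemma walk_unique S (B : pred 'I_n) z s v s' v' :
    (forall y d d', ~~ B y.1 -> d \in S -> d' \in S -> y \in d -> y \in d' -> d = d') ->
    ~~ B z.1 -> all [predC B] (unzip1 s) -> all [predC B] (unzip1 s') ->
    B v.1 -> B v'.1 ->
    {subset trail z (rcons s v) <= S} -> {subset trail z (rcons s' v') <= S} ->
  s = s' /\ v = v'.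
Proof.
move=> uS + + + Bv Bv'.
have first_eq x t t' r r' : ~~ B x.1 -> {subset trail x (t :: r) <= S} ->
    {subset trail x (t' :: r') <= S} -> t = t'.
  move=> Bx h h'; apply: (@set2_inj _ (neg x)); apply: (uS (neg x)) => //.
  - by apply: h; rewrite trail_cons mem_head.
  - by apply: h'; rewrite trail_cons mem_head.
  - by rewrite !inE eqxx.
  - by rewrite !inE eqxx.
elim: s s' z => [|t s IH] [|t' s'] z Bz /=.
- by move=> _ _ h h'; rewrite (first_eq _ _ _ _ _ Bz h h').
- move=> _ /andP[+ _] h h'; rewrite -(first_eq _ _ _ _ _ Bz h h').
  by case/negP; rewrite unfold_in.
- move=> /andP[+ _] _ h h'; rewrite (first_eq _ _ _ _ _ Bz h h').
  by case/negP; rewrite unfold_in.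
move=> /andP[Bt Bs] /andP[Bt' Bs'] h h'.
have E := first_eq _ _ _ _ _ Bz h h'; rewrite -E in h' *.
have [||-> ->] := IH s' t Bt Bs Bs'; last by [].
- by move=> d dt; apply: h; rewrite trail_cons inE dt orbT.
- by move=> d dt; apply: h'; rewrite trail_cons inE dt orbT.
Qed.

Definition flip (r : bool) (u : literal n * literal n) := if r then (u.2, u.1) else u.

Lemma size_revneg_bseq (s : n.-bseq (literal n)) : size (revneg s) <= n.
Proof. by rewrite size_revneg size_bseq. Qed.

Definition chain_flip (r : bool) (s : n.-bseq (literal n)) : n.-bseq (literal n) :=
  if r then Bseq (size_revneg_bseq s) else s.

Definition relabelling := ({perm 'I_3} * {ffun 'I_3 -> bool})%type.

Lemma card_relabelling : #|{: relabelling}| = 48.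
Proof. by rewrite card_prod card_Sn card_ffun card_bool card_ord. Qed.

Definition relabel_ends (g : relabelling) e : ends n := [ffun i => flip (g.2 i) (e (g.1 i))].

Definition relabel_chains (g : relabelling) c : chains n :=
  [ffun i => chain_flip (g.2 i) (c (g.1 i))].

Lemma flip_chain r (u : literal n * literal n) (s : n.-bseq (literal n)) :
  chain (flip r u).1 (chain_flip r s) (flip r u).2 =i chain u.1 s u.2.
Proof. by case: r => // d; rewrite /= chain_rev mem_rev. Qed.

Lemma chain_flip_vars r (s : n.-bseq (literal n)) : unzip1 (chain_flip r s) =i unzip1 s.
Proof. by case: r => // t; rewrite /= unzip1_revneg mem_rev. Qed.

Lemma size_chain_flip r (s : n.-bseq (literal n)) : size (chain_flip r s) = size s.
Proof. by case: r; rewrite //= size_revneg. Qed.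

Lemma uniq_chain_flip r (s : n.-bseq (literal n)) :
  uniq (unzip1 (chain_flip r s)) = uniq (unzip1 s).
Proof. by case: r; rewrite //= unzip1_revneg rev_uniq. Qed.

Lemma relabel_subdivision g e c :
  subdivision (relabel_ends g e) (relabel_chains g c) = subdivision e c.
Proof.
rewrite /subdivision [RHS](reindex_inj (@perm_inj _ g.1)) /=.
apply: eq_bigr => i _; apply/setP => d; rewrite inE [in RHS]inE !ffunE.
exact: flip_chain.
Qed.

Lemma relabel_end_count g e y : end_count (relabel_ends g e) y = end_count e y.
Proof.
rewrite /end_count [RHS](reindex_inj (@perm_inj _ g.1)) /=; apply: eq_bigr => i _.
by rewrite ffunE; case: (g.2 i); rewrite //= addnC.
Qed.

Lemma relabel_end_var g e t : end_var (relabel_ends g e) t = end_var e t.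
Proof. by rewrite -[t]/(t, true).1 !end_countP !relabel_end_count. Qed.

Lemma relabel_cubic b g e : cubic b e -> cubic b (relabel_ends g e).
Proof.
case/andP=> /existsP[x /existsP[y /andP[xy /forallP h]]] hb; apply/andP; split.
  apply/existsP; exists x; apply/existsP; exists y; rewrite xy; apply/forallP => z.
  by rewrite relabel_end_count.
apply/implyP => /(implyP hb)/forallP {}hb; apply/forallP => a.
have /existsP[i hi] := hb a; apply/existsP; exists (g.1^-1%g i).
by rewrite !ffunE permKV; case: (g.2 _); rewrite //= andbC.
Qed.

Lemma relabel_separated g e c : separated e c ->
  separated (relabel_ends g e) (relabel_chains g c).
Proof.
move=> sep; apply/andP; split; apply/forallP => i.
  rewrite ffunE size_chain_flip uniq_chain_flip (chain_gt0 sep) (chain_vars_uniq sep) /=.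
  apply/allP => t; rewrite chain_flip_vars => /(chain_var_end sep) E.
  exact: (negbT (etrans (relabel_end_var g e t) E)).
apply/forallP => j; apply/implyP => ij; apply/allP => t; rewrite !ffunE /=.
rewrite chain_flip_vars => ti; rewrite chain_flip_vars; apply: contraNN ij => tj.
by rewrite -(inj_eq (@perm_inj _ g.1)) (chain_var_inj sep ti tj).
Qed.

(** Disjoint nonempty words identify the permutation. The directions are identified because no word
    over distinct variables equals its own contrapositive: its head would be the negation of its
    last literal. *)
Lemma relabel_inj e c g g' : separated e c ->
  relabel_chains g c = relabel_chains g' c -> g = g'.
Proof.
move=> sep E.
have Ei i : chain_flip (g.2 i) (c (g.1 i)) = chain_flip (g'.2 i) (c (g'.1 i)).
  by move/ffunP/(_ i): E; rewrite !ffunE.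
have E1 : g.1 = g'.1.
  apply/perm.permP => i; have := chain_gt0 sep (g.1 i).
  case Ec: (c (g.1 i) : seq _) => [|y s] // _.
  have yi : y.1 \in unzip1 (c (g.1 i)) by rewrite Ec mem_head.
  apply: (chain_var_inj sep yi).
  by rewrite -(chain_flip_vars (g'.2 i)) -Ei chain_flip_vars.
have no_flip i : revneg (c i) <> c i.
  have uc := chain_vars_uniq sep i; have c0 := chain_gt0 sep i.
  case Ec: (c i : seq _) uc c0 => [|y s] // uc _ Er.
  have := head_neq_last y uc isT; case/lastP: s Ec uc Er => [|s z] Ec uc Er.
    by move/eqP; case: Er.
  by move: Er; rewrite -rcons_cons revneg_rcons last_rcons => -[->]; rewrite eqxx.
have E2 : g.2 = g'.2.
  apply/ffunP => i; have := congr1 (@bseqval n _) (Ei i); rewrite E1.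
  by case: (g.2 i) (g'.2 i) => [] [] //= Er; case: (no_flip (g'.1 i)).
by case: g g' E1 E2 {E Ei} => [? ?] [? ?] /= -> ->.
Qed.

(** Both configurations have the same end variables, and from an end the walk is forced until the
    next end, as inner literals lie in a single clause. So every chain of one is a chain of the
    other, possibly reversed. *)
Lemma subdivision_relabel b e c e' c' : separated e c -> cubic b e ->
    separated e' c' -> cubic b e' -> subdivision e' c' = subdivision e c ->
  exists g, e' = relabel_ends g e /\ c' = relabel_chains g c.
Proof.
move=> sep cub sep' cub' ES; set S := subdivision e c.
have ev t : end_var e' t = end_var e t.
  by apply/idP/idP => [/(end_varP sep' cub')|/(end_varP sep cub)] h;
     [apply/(end_varP sep cub) | apply/(end_varP sep' cub')]; move: h; rewrite ES.
have uS y d d' : ~~ end_var e y.1 -> d \in S -> d' \in S -> y \in d -> y \in d' -> d = d'.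
  move=> ny dS d'S yd; case: (subdivision_var dS yd) => [h|[i yi]]; first by rewrite h in ny.
  exact: (interior_unique sep yi).
have chainS i : {subset chain (e i).1 (c i) (e i).2 <= S}.
  by move=> d di; apply/bigcupP; exists i; rewrite // inE.
have chainS' i : {subset chain (e' i).1 (c' i) (e' i).2 <= S}.
  by move=> d di; rewrite /S -ES; apply/bigcupP; exists i; rewrite // inE.
have int_all i : all [predC end_var e] (unzip1 (c i)).
  by apply/allP => t /(chain_var_end sep)/negbT.
have int_all' i : all [predC end_var e] (unzip1 (c' i)).
  by apply/allP => t /(chain_var_end sep'); rewrite ev => /negbT.
have match_chain i : exists jr : 'I_3 * bool,
    e' i = flip jr.2 (e jr.1) /\ c' i = chain_flip jr.2 (c jr.1).
  set u' := (e' i).1; have s0 := chain_gt0 sep' i.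
  have [h [s' Ec']] : exists h s', c' i = h :: s' :> seq _.
    by case: (c' i : seq _) s0 => // h s' _; exists h, s'.
  have dS : [set u'; h] \in S.
    by apply: (chainS' i); rewrite Ec' chain_cons mem_head.
  have /bigcupP[j _] := dS; rewrite inE => dj.
  have u'd : u' \in [set u'; h] by rewrite !inE eqxx.
  have u'j : u'.1 \notin unzip1 (c j).
    by apply/negP => /(chain_var_end sep); rewrite -ev end_var1.
  (* The first clause of chain [i] touches an end, so in chain [j] it is the first or the last
     clause; this decides the direction [r]. *)
  have [r [Eu Ed]] : exists r, u' = (flip r (e j)).1 /\
      [set u'; h] = [set (flip r (e j)).1; head h (chain_flip r (c j))].
    have cj0 := chain_gt0 sep j.
    case: (chain_outer cj0 dj u'd u'j) => -[E1 E2].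
      by exists false; split=> //; rewrite E2 /=; case: (c j : seq _) cj0.
    exists true; split=> //; rewrite E2 /= setUC; congr [set _; _].
    by case/lastP: (c j : seq _) cj0 => // t b' _; rewrite revneg_rcons last_rcons.
  exists (j, r); rewrite /=; rewrite -Eu in Ed; have Eh := set2_inj Ed.
  have [t Et] : exists t, chain_flip r (c j) = h :: t :> seq _.
    have sz : 0 < size (chain_flip r (c j)) by rewrite size_chain_flip (chain_gt0 sep).
    by case: (chain_flip r (c j) : seq _) sz Eh => // h' t _ /= ->; exists t.
  have Bh : ~~ end_var e h.1 by have := int_all' i; rewrite Ec' => /andP[].
  have [] := @walk_unique S (end_var e) h s' (e' i).2 t (flip r (e j)).2 uS Bh.
  - by have := int_all' i; rewrite Ec' => /andP[].
  - have : all [predC end_var e] (unzip1 (chain_flip r (c j))).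
      by rewrite (eq_all_r (@chain_flip_vars r (c j))).
    by rewrite Et => /andP[].
  - by rewrite -ev end_var2.
  - by case: (r); rewrite ?end_var1 ?end_var2.
  - by move=> d dt; apply: (chainS' i); rewrite Ec' chain_cons inE dt orbT.
  - move=> d dt; apply: (chainS j); rewrite -(flip_chain r) Et chain_cons inE dt orbT.
    by [].
  move=> Es Ev; split; last by apply: val_inj; rewrite /= Ec' Es -Et.
  by rewrite [e' i]surjective_pairing -/u' Eu Ev -surjective_pairing.
have [f f_eq] := fin_all_exists match_chain.
(* Two chains of [c'] matched to the same chain of [c] would share inner variables. *)
have f_inj : injective (fun i => (f i).1).
  move=> i j /= Eij; have := chain_gt0 sep' i.
  case Ec: (c' i : seq _) => [|y s] // _.
  have yi : y.1 \in unzip1 (c' i) by rewrite Ec mem_head.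
  apply: (chain_var_inj sep' yi); have [_ Ej] := f_eq j; have [_ Ei] := f_eq i.
  by rewrite Ej -Eij chain_flip_vars -(chain_flip_vars (f i).2) -Ei.
exists (perm f_inj, [ffun i => (f i).2]); split; apply/ffunP => i.
  by rewrite !ffunE permE; case: (f_eq i).
by rewrite !ffunE permE; case: (f_eq i).
Qed.

End Symmetries.

(** * From bicycles to subdivisions *)

Section Cores.
Variable n : nat.
Implicit Types (x y z u v : literal n) (s w : seq (literal n)) (S G F : formula n).
Implicit Type V : {set 'I_n}.
Implicit Type a : {ffun 'I_n -> bool}.
Implicit Types (e : ends n) (c : chains n).

(** A chain entails the kernel clause that it subdivides: [-u] propagates to [v]. *)
Lemma subdivision_unsat e c F : cubic true e -> subdivision e c \subset F ->
  ~~ satisfiable F.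
Proof.
case/andP=> _ /forallP unsat sF; apply/existsPn => a; apply/negP => /(satisfiesS sF) sat.
have /existsP[i /andP[h1 h2]] := unsat a.
have: satisfies a [set d in trail (neg (e i).1) (rcons (c i) (e i).2)].
  by apply: satisfiesS sat; apply: (bigcup_sup i).
rewrite satisfies_trail => hp; case/negP: h2.
suff: holds a (last (neg (e i).1) (rcons (c i) (e i).2)) by rewrite last_rcons.
have: holds a (neg (e i).1) by rewrite holds_neg.
elim: (rcons _ _) (neg (e i).1) hp => //= t s IH y /andP[/implyP yt hs] /yt ht.
exact: IH.
Qed.

Definition subdivision_vars e c : {set 'I_n} :=
  [set t | end_var e t || [exists i, t \in unzip1 (c i)]].

Lemma subdivision_varsP e c d y : separated e c -> d \in subdivision e c -> y \in d ->
  y.1 \in subdivision_vars e c.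
Proof.
move=> sep dS yd; rewrite inE; case: (subdivision_var dS yd) => [->//|[i yi]].
by apply/orP; right; apply/existsP; exists i.
Qed.

Lemma card_subdivision_vars b e c : cubic b e ->
  #|subdivision_vars e c| <= (\sum_i size (c i)).+2.
Proof.
case/andP=> /existsP[x /existsP[y /andP[_ /forallP h]]] _.
have -> : (\sum_i size (c i)).+2 =
    size (x.1 :: y.1 :: flatten [seq unzip1 (c i) | i <- enum 'I_3]).
  rewrite /= size_flatten /shape -map_comp sumnE big_map big_enum /=.
  by congr _.+2; apply: eq_bigr => i _; rewrite size_map.
apply: leq_trans (card_size _); apply/subset_leq_card/subsetP => t.
rewrite !inE => /orP[|/existsP[i ti]]; last first.
  by apply/orP; right; apply/orP; right; apply/flatten_mapP; exists i; rewrite ?mem_enum.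
have inj z : z \in [:: x; x; neg x; y; y; neg y] -> (z.1 == x.1) || (z.1 == y.1).
  by rewrite !inE => /or4P[/eqP->|/eqP->|/eqP->|/or3P[]/eqP->]; rewrite /= eqxx ?orbT.
rewrite orbA -[t]/(t, true).1 end_countP !(eqP (h _)) -!has_count !has_pred1.
by case/orP=> /inj->.
Qed.

Lemma ear_mono V S G F y w z : G \subset F -> ear V S G y w z -> ear V S F y w z.
Proof.
move=> sGF /and5P[yV uw wV zV /andP[/allP wG wS]]; rewrite /ear yV uw wV zV wS andbT /=.
by apply/allP => d /wG; exact: (subsetP sGF).
Qed.

(* If the second subdivision touches the first one, its connectedness yields a clause outside the
   first one on one of its variables, from which an ear starts. *)
Lemma other_subdivision b e c e' c' F (S := subdivision e c) (S' := subdivision e' c') :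
    separated e c -> cubic b e -> separated e' c' -> cubic b e' ->
    S' \subset F -> ~~ (S' \subset S) ->
  (exists y w z, ear (subdivision_vars e c) S F y w z) \/
  (forall d d' y y', d \in S -> d' \in S' -> y \in d -> y' \in d' -> y.1 != y'.1).
Proof.
move=> sep cub sep' cub' S'F nS; pose V := subdivision_vars e c.
have touch : {subset S' <= clauses n} := subsetP (subdivision_clauses sep').
have [|out] := boolP [exists d in S', [exists y in d, y.1 \in V]]; last first.
  right=> d d' y y' dS d'S yd y'd'; apply: contraNneq out => E.
  apply/exists_inP; exists d' => //; apply/exists_inP; exists y' => //.
  by rewrite -E (subdivision_varsP sep dS).
case/exists_inP=> d0 d0S /exists_inP[y0 y0d y0V]; left.
have [|none] := boolP [exists d in S' :\: S, [exists y in d, y.1 \in V]].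
  case/exists_inP=> d; rewrite inE => /andP[dS dS'] /exists_inP[y yd yV].
  have [x [w [z h]]] := ear_exists (subdivision_clauses sep') (subdivision_pure_free sep' cub') dS' dS yd yV.
  by exists x, w, z; exact: ear_mono S'F h.
have inS d y : d \in S' -> y \in d -> y.1 \in V -> d \in S.
  move=> dS' yd yV; apply: contraNT none => dS; apply/exists_inP; exists d; rewrite ?inE ?dS //.
  by apply/exists_inP; exists y.
case/subsetPn: nS => d dS'; case/negP.
have [y yd] : exists y, y \in d.
  by case/imsetP: (touch d dS') => -[u v] _ ->; exists u; rewrite !inE eqxx.
have closed d1 y1 z1 : d1 \in S' -> y1 \in d1 -> z1 \in d1 -> y1.1 \in V -> z1.1 \in V.
  by move=> d1S y1d z1d y1V; exact: (subdivision_varsP sep (inS d1 y1 d1S y1d y1V)).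
apply: (inS d y) => //.
exact: (subdivision_connected cub' closed d0S y0d y0V dS' yd).
Qed.

Definition tri (X : Type) (x0 x1 x2 : X) (i : 'I_3) : X :=
  match val i with 0 => x0 | 1 => x1 | _ => x2 end.

Lemma forall_ord3 (P : 'I_3 -> Prop) : P ord0 -> P 1%R -> P ord_max -> forall i, P i.
Proof.
move=> P0 P1 P2 [[|[|[|//]]] i3].
- by rewrite (_ : Ordinal i3 = ord0) //; apply: val_inj.
- by rewrite (_ : Ordinal i3 = 1%R) //; apply: val_inj.
- by rewrite (_ : Ordinal i3 = ord_max) //; apply: val_inj.
Qed.

Lemma sum_ord3 (F : 'I_3 -> nat) : \sum_i F i = F ord0 + F 1%R + F ord_max.
Proof.
by rewrite !big_ord_recr big_ord0 /= add0n; congr (F _ + F _ + F _); apply: val_inj.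
Qed.

Lemma regroup_pairs (U U' P P' Q Q' V V' : nat) : P + P' + (Q + Q') = U + U' + (V + V') ->
  U + P + (P' + Q) + (Q' + V) = U + (U + (U' + (V + (V + (V' + 0))))).
Proof. lia. Qed.

(* A bicycle whose loops close at two interior variables p, q of its word is a subdivision:
   the three chains are the parts of the word around p and q. *)
Lemma bicycle_subdivision F u v w A B C p q : bicycle F u w v ->
    w = A ++ p :: B ++ q :: C -> 0 < size A -> 0 < size B -> 0 < size C ->
    (u.1 == p.1) && (v.1 == q.1) || (u.1 == q.1) && (v.1 == p.1) ->
  exists e c, [/\ separated e c, subdivision e c = [set d in chain u w v], cubic false e
    & u = p -> v = neg q -> cubic true e].
Proof.
move=> bic Ew A0 B0 C0 uvpq; have /and5P[uw _ _ _ _] := bic.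
have sz : size w <= n by rewrite -(size_map fst); exact: size_uniq_ord.
have sA : size A <= n by apply: leq_trans sz; rewrite Ew size_cat /=; lia.
have sB : size B <= n by apply: leq_trans sz; rewrite Ew size_cat /= size_cat /=; lia.
have sC : size C <= n by apply: leq_trans sz; rewrite Ew size_cat /= size_cat /=; lia.
(* Cutting the path [-u -> A -> p -> B -> q -> C -> v] at [p] and [q]; each cut leaves the positive
   literal as the end of one chain and the negated one as the start of the next. *)
pose e : ends n := [ffun i => tri (u, p) (neg p, q) (neg q, v) i].
pose c : chains n := [ffun i => tri (Bseq sA) (Bseq sB) (Bseq sC) i].
have cE : [/\ c ord0 = A :> seq _, c 1%R = B :> seq _ & c ord_max = C :> seq _].
  by rewrite /c !ffunE.
have eE : [/\ e ord0 = (u, p), e 1%R = (neg p, q) & e ord_max = (neg q, v)].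
  by rewrite /e !ffunE.
case: cE => cA cB cC; case: eE => e0 e1 e2.
have ecount z : end_count e z =
    (u == z) + (p == z) + ((neg p == z) + (q == z)) + ((neg q == z) + (v == z)).
  by rewrite /end_count sum_ord3 e0 e1 e2.
have evar t : end_var e t -> (t == p.1) || (t == q.1).
  case/existsP; elim/forall_ord3; rewrite ?e0 ?e1 ?e2 /=.
  - by case/orP=> [/eqP->|->//]; case/orP: uvpq => /andP[-> _]; rewrite ?orbT.
  - by case/orP=> ->; rewrite ?orbT.
  - by case/orP=> [->|/eqP->]; rewrite ?orbT //; case/orP: uvpq => /andP[_ ->]; rewrite ?orbT.
have uniqs : [/\ uniq (unzip1 A), uniq (unzip1 B), uniq (unzip1 C) & p.1 != q.1].
  move: uw; rewrite Ew /unzip1 map_cat /= map_cat /= cat_uniq => /and3P[-> _ /=].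
  rewrite mem_cat inE !negb_or => /andP[/and3P[_ -> _]].
  by rewrite cat_uniq => /and3P[-> _ /= /andP[_ ->]].
case: uniqs => uA uB uC pq.
have outA t : t \in unzip1 A -> [&& t != p.1, t != q.1, t \notin unzip1 B & t \notin unzip1 C].
  move: uw; rewrite Ew /unzip1 map_cat /= map_cat /= cat_uniq => /and3P[_ /hasPn h _] tA.
  rewrite -!negb_or; apply: contraL tA => tin; apply: h.
  by rewrite inE mem_cat inE; case/or4P: tin => ->; rewrite ?orbT.
have outB t : t \in unzip1 B -> [&& t != p.1, t != q.1 & t \notin unzip1 C].
  move: uw; rewrite Ew /unzip1 map_cat /= map_cat /= cat_uniq => /and3P[_ _ /=].
  rewrite mem_cat inE !negb_or cat_uniq => /andP[/and3P[pB _ _] /and3P[_ /hasPn h _]] tB.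
  apply/and3P; split; first by apply: contraNneq pB => <-.
    by apply: contraTneq tB => ->; apply: h; rewrite mem_head.
  by apply: contraL tB => tC; apply: h; rewrite inE tC orbT.
have outC t : t \in unzip1 C -> (t != p.1) && (t != q.1).
  move: uw; rewrite Ew /unzip1 map_cat /= map_cat /= cat_uniq => /and3P[_ _ /=].
  rewrite mem_cat inE !negb_or cat_uniq => /andP[/and3P[_ _ pC] /and3P[_ _ /= /andP[qC _]]] tC.
  by apply/andP; split; [apply: contraNneq pC => <- | apply: contraNneq qC => <-].
have not_end t : t != p.1 -> t != q.1 -> [predC end_var e] t.
  by move=> tp tq; apply/negP => /evar; rewrite (negPf tp) (negPf tq).
have cub : cubic false e.
  (* The slots hold both signs of [p] and of [q], together with [u] and [v]; hence the doubled
     literals are [u] and [v]. *)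
  rewrite /cubic andbT; apply/existsP; exists u; apply/existsP; exists v.
  apply/andP; split.
    by case/orP: uvpq => /andP[/eqP-> /eqP->] //; rewrite eq_sym.
  apply/forallP => z; rewrite ecount /=.
  have pair x y : x.1 == y.1 -> (x == z) + (neg x == z) = (y == z) + (neg y == z).
    by move/eqP/same_var=> [->//|->]; rewrite negK addnC.
  apply/eqP/regroup_pairs; case/orP: uvpq => /andP[up vq].
    by rewrite (pair u p) ?(pair v q).
  by rewrite (pair u q) ?(pair v p) // addnC.
exists e, c; split=> //.
- apply/andP; split; apply/forallP.
    apply: forall_ord3; rewrite ?cA ?cB ?cC ?A0 ?B0 ?C0 ?uA ?uB ?uC /=; apply/allP => t.
    + by move=> /outA/and4P[tp tq _ _]; exact: not_end.
    + by move=> /outB/and3P[tp tq _]; exact: not_end.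
    + by move=> /outC/andP[tp tq]; exact: not_end.
  suff disj (i j : 'I_3) : i < j -> forall t, t \in unzip1 (c i) -> t \notin unzip1 (c j).
    move=> i; apply/forallP => j; apply/implyP => ij; apply/allP => t ti.
    case: (ltngtP i j) => [/disj/(_ t ti)//|ji|/val_inj E]; last by rewrite E eqxx in ij.
    by apply: contraL ti => tj; exact: disj ji t tj.
  move: i; apply: forall_ord3; move: j; apply: forall_ord3; rewrite ?cA ?cB ?cC //= => _ t.
  + by case/outA/and4P.
  + by case/outA/and4P.
  + by case/outB/and3P.
- apply/setP => d; rewrite inE.
  have -> : chain u w v = chain u A p ++ chain (neg p) B q ++ chain (neg q) C v.
    rewrite !chainE Ew !negK.
    have -> : (A ++ p :: B ++ q :: C) ++ [:: v] = (A ++ [:: p]) ++ (B ++ [:: q]) ++ C ++ [:: v].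
      by rewrite -!catA /= -!catA.
    by rewrite !cats1 trail_cat last_rcons trail_cat last_rcons.
  rewrite !mem_cat; apply/bigcupP/or3P => [[i _]|].
    rewrite inE; move: i; apply: forall_ord3; rewrite ?cA ?cB ?cC ?e0 ?e1 ?e2 /= => h;
    by [apply: Or31 | apply: Or32 | apply: Or33].
  case=> h; [exists ord0 | exists 1%R | exists ord_max] => //;
  by rewrite inE ?cA ?cB ?cC ?e0 ?e1 ?e2.
(* The kernel is now [p \/ p], [-p \/ q], [-q \/ -q], which no assignment satisfies. *)
move=> Eu Ev; rewrite /cubic; case/andP: cub => -> _ /=; apply/forallP => a.
apply/existsP; case: (boolP (holds a p)) => hp; last first.
  by exists ord0; rewrite e0 /= Eu (negPf hp).
case: (boolP (holds a q)) => hq.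
  by exists ord_max; rewrite e2 /= Ev !holds_neg hq.
by exists 1%R; rewrite e1 /= holds_neg hp hq.
Qed.

End Cores.

(** * The product measure on formulas *)

Import Order.TTheory GRing.Theory Num.Theory.

Section Probability.
Local Open Scope ring_scope.
Variables (R : realFieldType) (n : nat) (p : R).
Hypothesis p01 : 0 <= p <= 1.
Implicit Types (S F : formula n) (E : pred (formula n)).

Let p_ge0 : 0 <= p. Proof. by case/andP: p01. Qed.
Let q_ge0 : 0 <= 1 - p. Proof. by rewrite subr_ge0; case/andP: p01. Qed.

Lemma weight_ge0 F : 0 <= \prod_(d in clauses n) (if d \in F then p else 1 - p).
Proof. by apply: prodr_ge0 => d _; case: ifP. Qed.

Lemma Pr_ge0 E : 0 <= Pr p E.
Proof. by apply: sumr_ge0 => F _; exact: weight_ge0. Qed.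

Lemma Pr_le E E' : (forall F, F \subset clauses n -> E F -> E' F) -> Pr p E <= Pr p E'.
Proof.
move=> sE; rewrite /Pr [leRHS]big_mkcondr /= [leLHS]big_mkcondr /=.
apply: ler_sum => F; rewrite inE => FC; case: ifP => [/(sE F FC)->//|_].
by case: ifP => // _; exact: weight_ge0.
Qed.

Lemma Pr_sub S : S \subset clauses n -> Pr p (fun F => S \subset F) = p ^+ #|S|.
Proof.
(* Expand the product of [f d + g d] over all subsets, [f] weighing presence and [g] absence. Only
   the sets between [S] and [clauses n] survive, while [f d + g d] is [p] on [S] and 1 elsewhere. *)
move=> SC; pose f d := if d \in clauses n then p else 0.
pose g d := if d \in S then 0 else if d \in clauses n then 1 - p else 1.
transitivity (\prod_d (f d + g d)); last first.
  rewrite -prodr_const [RHS]big_mkcond /=; apply: eq_bigr => d _; rewrite /f /g.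
  by have [/(subsetP SC)->|] := boolP (d \in S); rewrite ?addr0 //; case: ifP; rewrite ?add0r ?subrKC // addrC subrK.
rewrite bigA_distr /Pr /= big_mkcond /=; apply: eq_bigr => F _.
rewrite inE; have [FC|/subsetPn[d dF dC]] := boolP (F \subset clauses n); last first.
  by rewrite [RHS](bigD1 d) //= dF /f (negPf dC) mul0r.
have [SF|/subsetPn[d dS dF]] := boolP (S \subset F); last first.
  by rewrite [RHS](bigD1 d) //= (negPf dF) /g dS mul0r.
rewrite big_mkcond /=; apply: eq_bigr => d _; rewrite /f /g.
have [dF|dF] := boolP (d \in F); first by rewrite (subsetP FC).
by have /negPf-> : d \notin S by apply: contraNN dF; exact: (subsetP SF).
Qed.

Lemma Pr_true : Pr p (fun _ : formula n => true) = 1.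
Proof.
rewrite -[RHS](expr0 p) -(cards0 {set literal n}) -Pr_sub ?sub0set //.
by apply: eq_bigl => F; rewrite sub0set.
Qed.

Lemma PrC E : Pr p (predC E) = 1 - Pr p E.
Proof.
rewrite -Pr_true; apply/eqP; rewrite eq_sym subr_eq eq_sym; apply/eqP.
rewrite /Pr [RHS](bigID E) /= addrC; congr (_ + _); apply: eq_bigl => F.
  by rewrite andbT.
by rewrite andbT.
Qed.

Lemma Pr_eq E E' : (forall F, F \subset clauses n -> E F = E' F) -> Pr p E = Pr p E'.
Proof. by move=> h; apply/eqP; rewrite eq_le !Pr_le // => F /h ->. Qed.

(** The conditions on [S] are requested only for formulas in [E], so that an index whose structure
    is impossible simply yields a void event. *)
Lemma Pr_le_card E S m :
  (forall F, F \subset clauses n -> E F -> S \subset F /\ #|S| = m) -> Pr p E <= p ^+ m.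
Proof.
move=> h; have [/existsP[F /andP[FC EF]]|/existsPn none] :=
    boolP [exists F : formula n, (F \subset clauses n) && E F].
  have [SF <-] := h F FC EF; rewrite -Pr_sub; last exact: subset_trans SF FC.
  by apply: Pr_le => G GC /(h G GC)[].
rewrite /Pr big_pred0 ?exprn_ge0 // => F; rewrite inE.
by apply/negbTE.
Qed.

Lemma Pr_union (I : finType) E (E_ : I -> pred (formula n)) :
    (forall F, F \subset clauses n -> E F -> exists i, E_ i F) ->
  Pr p E <= \sum_i Pr p (E_ i).
Proof.
move=> h; rewrite /Pr [leLHS]big_mkcondr /=.
under [leRHS]eq_bigr => i _ do rewrite big_mkcondr /=.
rewrite exchange_big /=; apply: ler_sum => F; rewrite inE => FC.
case: ifP => [/(h F FC)[i Ei]|_].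
  rewrite (bigD1 i) //= Ei lerDl; apply: sumr_ge0 => j _.
  by case: ifP => // _; exact: weight_ge0.
by apply: sumr_ge0 => j _; case: ifP => // _; exact: weight_ge0.
Qed.

Lemma Pr_union2 E E1 E2 :
    (forall F, F \subset clauses n -> E F -> E1 F || E2 F) ->
  Pr p E <= Pr p E1 + Pr p E2.
Proof.
move=> h; rewrite -(big_bool _ (fun b : bool => Pr p (if b then E1 else E2))).
by apply: Pr_union => F FC /(h F FC)/orP[]; [exists true | exists false].
Qed.

(** Both sides are the expected number of indices [i] with [E_ i]. The two lemmas that follow
    compare it with [Pr p E] when every formula carries at least, respectively at most, [m] of
    them. *)
Lemma sum_Pr_count (I : finType) (E_ : I -> pred (formula n)) :
  \sum_i Pr p (E_ i) = \sum_(F in powerset (clauses n))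
     \prod_(d in clauses n) (if d \in F then p else 1 - p) * #|[set i | E_ i F]|%:R.
Proof.
rewrite /Pr; under eq_bigr => i _ do rewrite big_mkcondr /=.
rewrite exchange_big /=; apply: eq_bigr => F _.
rewrite -big_mkcond /= sumr_const mulr_natr; congr (_ *+ _); apply: eq_card => i.
by rewrite !inE.
Qed.

Lemma Pr_count_le (I : finType) E (E_ : I -> pred (formula n)) m :
    (forall F, F \subset clauses n -> E F -> (m <= #|[set i | E_ i F]|)%N) ->
  m%:R * Pr p E <= \sum_i Pr p (E_ i).
Proof.
move=> h; rewrite sum_Pr_count /Pr big_mkcondr /= mulr_sumr; apply: ler_sum => F; rewrite inE => FC.
case: ifP => [/(h F FC) hm|_]; last by rewrite mulr0 mulr_ge0 ?weight_ge0.
by rewrite mulrC ler_wpM2l ?weight_ge0 // ler_nat.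
Qed.

Lemma Pr_count_ge (I : finType) E (E_ : I -> pred (formula n)) m :
    (forall F, F \subset clauses n -> (#|[set i | E_ i F]| <= m)%N) ->
    (forall F i, F \subset clauses n -> E_ i F -> E F) ->
  \sum_i Pr p (E_ i) <= m%:R * Pr p E.
Proof.
move=> h sE; rewrite sum_Pr_count /Pr [in leRHS]big_mkcondr /= mulr_sumr; apply: ler_sum => F; rewrite inE => FC.
case: ifP => [_|/negP nE]; first by rewrite mulrC ler_wpM2r ?weight_ge0 // ler_nat h.
rewrite (_ : [set i | E_ i F] = set0) ?cards0 ?mulr0 //.
by apply/setP => i; rewrite !inE; apply/negbTE/negP => /(sE F i FC).
Qed.

End Probability.

(** * First moments of bicycles and ears *)

Section FirstMoments.
Local Open Scope ring_scope.
Variables (R : realFieldType) (n : nat) (p : R).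
Hypothesis p01 : 0 <= p <= 1.
Implicit Types (S F : formula n) (E : pred (formula n)) (V : {set 'I_n}).
Local Notation q := ((2 * n)%:R * p).

Let p_ge0 : 0 <= p. Proof. by case/andP: p01. Qed.

Lemma card_literal : #|literal n| = (2 * n)%N.
Proof. by rewrite card_prod card_ord card_bool mulnC. Qed.

Lemma card_literals_on V : #|[set z : literal n | z.1 \in V]| = (2 * #|V|)%N.
Proof.
rewrite (_ : [set z | _] = setX V [set: bool]); last by apply/setP => z; rewrite !inE andbT.
by rewrite cardsX cardsT card_bool mulnC.
Qed.

Definition ear_index l := (literal n * l.-tuple (literal n) * literal n)%type.

Definition has_ear V S F :=
  [exists l : 'I_n.+1, exists t : ear_index l, ear V S F t.1.1 t.1.2 t.2].

Lemma has_earP V S F y w z : ear V S F y w z -> has_ear V S F.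
Proof.
move=> h; have /and5P[_ uw _ _ _] := h.
have sw : (size w < n.+1)%N by have := size_uniq_ord uw; rewrite size_map.
apply/existsP; exists (Ordinal sw); apply/existsP.
by exists (y, in_tuple w, z).
Qed.

(** For [l] inner literals: at most [2K] starting literals, [(2n)^l] words, [2(K+l)] final literals,
    and [l+1] new clauses. *)
Definition ear_sum K : R := \sum_(l < n.+1) (4 * K * (K + l))%:R * q ^+ l * p.

Lemma Pr_ear V S K :
    (forall d y, d \in S -> y \in d -> y.1 \in V) -> (#|V| <= K)%N ->
  Pr p (fun F => (S \subset F) && has_ear V S F) <= p ^+ #|S| * ear_sum K.
Proof.
move=> SV VK; rewrite /ear_sum mulr_sumr.
apply: le_trans (Pr_union p01 (I := 'I_n.+1) (E_ := fun l F => (S \subset F) &&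
   [exists t : ear_index l, ear V S F t.1.1 t.1.2 t.2]) _) _.
  by move=> F _ /andP[SF /existsP[l hl]]; exists l; rewrite SF.
apply: ler_sum => l _.
apply: le_trans (Pr_union p01 (I := ear_index l) (E_ := fun t F => (S \subset F) &&
   ear V S F t.1.1 t.1.2 t.2) _) _.
  by move=> F _ /andP[SF /existsP[t ht]]; exists t; rewrite SF.
pose A := [set z : literal n | z.1 \in V].
pose B (w : l.-tuple (literal n)) := [set z : literal n | z.1 \in V :|: [set i in unzip1 w]].
have step (t : ear_index l) : Pr p (fun F => (S \subset F) && ear V S F t.1.1 t.1.2 t.2) <=
    if (t.1.1 \in A) && (t.2 \in B t.1.2) then p ^+ (#|S| + l.+1) else 0.
  case: ifP => [_|/negP no].
    apply: (Pr_le_card p01 (S := S :|: [set d in chain t.1.1 t.1.2 t.2])) => F FC /andP[SF he].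
    by have [? ->] := ear_card FC SF SV he; rewrite size_tuple.
  rewrite /Pr big_pred0 // => F; apply/negbTE/negP => /and3P[_ _ he].
  by apply: no; case/and5P: he => yV _ _ zV _; rewrite !inE yV.
apply: le_trans (ler_sum _ (fun t _ => step t)) _.
rewrite -big_mkcond /= -(pair_big_dep (fun s => s.1 \in A) (fun s z => z \in B s.2) (fun _ _ => p ^+ (#|S| + l.+1))) /=.
apply: (@le_trans _ _ (\sum_(s : literal n * l.-tuple (literal n) | s.1 \in A)
                        (2 * (K + l))%:R * p ^+ (#|S| + l.+1))).
  apply: ler_sum => s _; rewrite sumr_const -[leLHS]mulr_natl ler_wpM2r ?exprn_ge0 // ler_nat.
  rewrite card_literals_on leq_mul2l /=; apply: leq_trans (leq_card_setU _ _) _.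
  by rewrite leq_add // cardsE; apply: leq_trans (card_size _) _; rewrite size_map size_tuple.
rewrite sumr_const -[leLHS]mulr_natl.
have -> : #|(fun s : literal n * l.-tuple (literal n) => s.1 \in A)| = (2 * #|V| * (2 * n) ^ l)%N.
  rewrite -card_literals_on -card_literal -card_tuple -[RHS](cardX (mem A) predT).
  by apply: eq_card => -[y w]; rewrite !inE andbT unfold_in /= inE.
rewrite exprD exprMn !natrM !natrX !natrM exprS.
have Vle : (#|V|%:R : R) <= K%:R by rewrite ler_nat.
have: 0 <= (K + l)%:R * (2 * n%:R) ^+ l * p ^+ #|S| * (p * p ^+ l).
  by rewrite !mulr_ge0 ?exprn_ge0 ?mulr_ge0.
move: (#|V|%:R : R) (K%:R : R) Vle (p ^+ #|S|) ((K + l)%:R : R) ((2 * n%:R) ^+ l) (p ^+ l).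
move=> x y xy P a b c h.
rewrite [leLHS](_ : _ = 4 * (a * b * P * (p * c)) * x); last by ring.
rewrite [leRHS](_ : _ = 4 * (a * b * P * (p * c)) * y); last by ring.
by rewrite ler_wpM2l // mulr_ge0.
Qed.

(** The outer literals of a bicycle lie over its own word, so each costs only a position and a sign;
    this is the source of the factor [4 k^2]. *)
Definition on_var k (w : k.-tuple (literal n)) (t : 'I_k * bool) : literal n :=
  ((tnth w t.1).1, t.2).

Definition bicycle_index k := (k.-tuple (literal n) * (('I_k * bool) * ('I_k * bool)))%type.

Definition bicycle_at k (t : bicycle_index k) F :=
  bicycle F (on_var t.1 t.2.1) t.1 (on_var t.1 t.2.2).

Lemma on_varP (w : seq (literal n)) u : u.1 \in unzip1 w ->
  exists i, u = on_var (in_tuple w) (i, u.2).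
Proof.
move=> /mapP[y yw E]; have iw : (index y w < size w)%N by rewrite index_mem.
exists (Ordinal iw); rewrite /on_var /= (tnth_nth y) /= nth_index //.
by rewrite -E; case: u {E}.
Qed.

Lemma bicycle_indexP F u w v : bicycle F u w v ->
  (size w < n.+1)%N /\ exists i j,
    u = on_var (in_tuple w) (i, u.2) /\ v = on_var (in_tuple w) (j, v.2).
Proof.
case/and5P=> uw _ /on_varP[i ui] /on_varP[j vj] _; split; last by exists i, j.
by have := size_uniq_ord uw; rewrite size_map.
Qed.

Lemma Pr_bicycle_at k (t : bicycle_index k) E :
  Pr p (fun F => bicycle_at t F && E F) <= p ^+ k.+1.
Proof.
apply: (Pr_le_card p01 (S := [set d in chain (on_var t.1 t.2.1) t.1 (on_var t.1 t.2.2)])).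
move=> F _ /andP[b _]; rewrite (bicycle_card b) size_tuple; split=> //.
by case/and5P: b => _ _ _ _ /andP[_ /allP cF]; apply/subsetP => d; rewrite inE => /cF.
Qed.

Definition some_bicycle (D : forall k, bicycle_index k -> pred (formula n)) : pred (formula n) :=
  fun F => [exists k : 'I_n.+1, exists t : bicycle_index k, bicycle_at t F && D k t F].

Lemma some_bicycleP (D : forall k, bicycle_index k -> pred (formula n)) F u w v i j :
    bicycle F u w v -> u = on_var (in_tuple w) (i, u.2) -> v = on_var (in_tuple w) (j, v.2) ->
    D _ (in_tuple w, ((i, u.2), (j, v.2))) F ->
  some_bicycle D F.
Proof.
move=> b Eu Ev dD; have [sw _] := bicycle_indexP b.
apply/existsP; exists (Ordinal sw); apply/existsP; exists (in_tuple w, ((i, u.2), (j, v.2))).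
by rewrite dD andbT /bicycle_at /= -Eu -Ev.
Qed.

Lemma Pr_some_bicycle (D : forall k, bicycle_index k -> pred (formula n)) :
  Pr p (some_bicycle D) <=
  \sum_(k < n.+1) \sum_(t : bicycle_index k) Pr p (fun F => bicycle_at t F && D k t F).
Proof.
apply: le_trans (Pr_union p01 (I := 'I_n.+1) (E_ := fun k F =>
   [exists t : bicycle_index k, bicycle_at t F && D k t F]) _) _.
  by move=> F _ /existsP.
by apply: ler_sum => k _; apply: (Pr_union p01) => F _ /existsP.
Qed.

Lemma card_bicycle_index k : #|{: bicycle_index k}| = ((2 * n) ^ k * (4 * k ^ 2))%N.
Proof. by rewrite !card_prod card_tuple card_literal card_ord card_bool; nia. Qed.

Definition bicycle_sum : R := \sum_(k < n.+1) (4 * k ^ 2)%:R * q ^+ k * p.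

Lemma Pr_bicycle E :
    (forall F, F \subset clauses n -> E F -> exists u w v, bicycle F u w v) ->
  Pr p E <= bicycle_sum.
Proof.
move=> h; apply: le_trans (Pr_le p01 (E' := some_bicycle (fun _ _ _ => true)) _) _.
  move=> F FC /(h F FC)[u [w [v b]]]; have [_ [i [j [Eu Ev]]]] := bicycle_indexP b.
  exact: some_bicycleP b Eu Ev _.
apply: le_trans (Pr_some_bicycle _) _.
apply: ler_sum => k _.
apply: le_trans (ler_sum _ (fun t _ => Pr_bicycle_at t (fun=> true))) _.
rewrite sumr_const -[leLHS]mulr_natl card_bicycle_index natrM natrX exprMn exprS.
by rewrite [leLHS](_ : _ = (4 * k ^ 2)%:R * ((2 * n)%:R ^+ k * p ^+ k) * p) //; ring.
Qed.

(* The positions i, j of the two closing variables leave one of the three chains empty. *)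
Definition degenerate k (i j : 'I_k) : bool :=
  [|| i == 0 :> nat, j == 0 :> nat, i.+1 == k, j.+1 == k, i == j, i.+1 == j :> nat
    | j.+1 == i :> nat].

(** Each of the seven conditions fixes one position or determines it from the other, so it is met by
    at most [k] pairs. *)
Lemma card_degenerate k : (#|[set s : 'I_k * 'I_k | degenerate s.1 s.2]| <= 7 * k)%N.
Proof.
have card_graph (A : {set 'I_k * 'I_k}) : {in A &, injective fst} -> (#|A| <= k)%N.
  by move=> /card_in_imset <-; rewrite -[k in leqRHS]card_ord max_card.
have card_graph' (A : {set 'I_k * 'I_k}) : {in A &, injective snd} -> (#|A| <= k)%N.
  by move=> /card_in_imset <-; rewrite -[k in leqRHS]card_ord max_card.
pose A1 := [set s : 'I_k * 'I_k | s.1 == 0 :> nat].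
pose A2 := [set s : 'I_k * 'I_k | s.2 == 0 :> nat].
pose A3 := [set s : 'I_k * 'I_k | s.1.+1 == k].
pose A4 := [set s : 'I_k * 'I_k | s.2.+1 == k].
pose A5 := [set s : 'I_k * 'I_k | s.1 == s.2].
pose A6 := [set s : 'I_k * 'I_k | s.1.+1 == s.2 :> nat].
pose A7 := [set s : 'I_k * 'I_k | s.2.+1 == s.1 :> nat].
have [k1 k2] : (#|A1| <= k /\ #|A2| <= k)%N.
  split; [apply: card_graph' | apply: card_graph] => -[i j] [i' j']; rewrite !inE /=;
  by move=> /eqP Ei /eqP Ei' E; congr (_, _) => //; apply: val_inj; rewrite /= Ei Ei'.
have [k3 k4] : (#|A3| <= k /\ #|A4| <= k)%N.
  split; [apply: card_graph' | apply: card_graph] => -[i j] [i' j']; rewrite !inE /=;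
  by move=> /eqP Ei /eqP Ei' E; congr (_, _) => //; apply: val_inj; apply: succn_inj; rewrite /= Ei Ei'.
have k5 : (#|A5| <= k)%N.
  by apply: card_graph => -[i j] [i' j']; rewrite !inE /= => /eqP-> /eqP-> ->.
have [k6 k7] : (#|A6| <= k /\ #|A7| <= k)%N.
  split; [apply: card_graph | apply: card_graph'] => -[i j] [i' j']; rewrite !inE /=;
  by move=> /eqP Ei /eqP Ei' E; congr (_, _) => //; apply: val_inj; rewrite /= -Ei -Ei' E.
have U (A B : {set 'I_k * 'I_k}) a b : (#|A| <= a -> #|B| <= b -> #|A :|: B| <= a + b)%N.
  by move=> hA hB; apply: leq_trans (leq_card_setU A B) _; exact: leq_add.
have -> : [set s : 'I_k * 'I_k | degenerate s.1 s.2] =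
    A1 :|: (A2 :|: (A3 :|: (A4 :|: (A5 :|: (A6 :|: A7))))).
  by apply/setP => s; rewrite !inE.
apply: leq_trans (U _ _ _ _ k1 (U _ _ _ _ k2 (U _ _ _ _ k3 (U _ _ _ _ k4 (U _ _ _ _ k5 (U _ _ _ _ k6 k7)))))) _.
by rewrite !mulSn mul0n addn0.
Qed.

(** Here 28 is 7 conditions times 4 sign choices. The loss of one factor [k] against [bicycle_sum]
    makes this [O(1/(sigma^2 n))]. *)
Definition degenerate_sum : R := \sum_(k < n.+1) (28 * k)%:R * q ^+ k * p.

Lemma Pr_degenerate :
  Pr p (some_bicycle (fun k t _ => degenerate t.2.1.1 t.2.2.1)) <= degenerate_sum.
Proof.
apply: le_trans (Pr_some_bicycle _) _.
apply: ler_sum => k _.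
apply: (@le_trans _ _ (\sum_(t : bicycle_index k | degenerate t.2.1.1 t.2.2.1) p ^+ k.+1)).
  rewrite [leRHS]big_mkcond /=; apply: ler_sum => t _; case: ifP => dt.
    exact: (Pr_bicycle_at t (fun=> true)).
  by rewrite /Pr big_pred0 // => F; rewrite andbF andbF.
rewrite sumr_const -[leLHS]mulr_natl.
have card_le : (#|[set t : bicycle_index k | degenerate t.2.1.1 t.2.2.1]| <= (2 * n) ^ k * (28 * k))%N.
  pose f (t : bicycle_index k) := ((t.1, (t.2.1.2, t.2.2.2)), (t.2.1.1, t.2.2.1)).
  have f_inj : injective f by move=> [w [[i b] [j c]]] [w' [[i' b'] [j' c']]] [-> -> -> -> ->].
  rewrite -(card_imset _ f_inj).
  apply: (@leq_trans #|setX [set: k.-tuple (literal n) * (bool * bool)]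
                          [set s : 'I_k * 'I_k | degenerate s.1 s.2]|).
    by apply/subset_leq_card/subsetP => _ /imsetP[t + ->]; rewrite !inE.
  rewrite cardsX cardsT !card_prod card_tuple card_literal card_bool -mulnA leq_mul2l.
  by apply/orP; right; have := card_degenerate k; lia.
apply: (@le_trans _ _ (((2 * n) ^ k * (28 * k))%:R * p ^+ k.+1)).
  rewrite ler_wpM2r ?exprn_ge0 // ler_nat; apply: leq_trans card_le.
  by rewrite leq_eqVlt; apply/orP; left; apply/eqP/eq_card => t; rewrite !inE.
by rewrite natrM natrX exprMn exprS le_eqVlt; apply/orP; left; apply/eqP; ring.
Qed.

Definition bicycle_ear_sum : R := \sum_(k < n.+1) (4 * k ^ 2)%:R * q ^+ k * p * ear_sum k.

Definition bicycle_has_ear k (t : bicycle_index k) : pred (formula n) :=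
  has_ear [set i in unzip1 t.1] [set d in chain (on_var t.1 t.2.1) t.1 (on_var t.1 t.2.2)].

Lemma Pr_bicycle_ear : Pr p (some_bicycle bicycle_has_ear) <= bicycle_ear_sum.
Proof.
apply: le_trans (Pr_some_bicycle _) _.
apply: ler_sum => k _.
have step (t : bicycle_index k) : Pr p (fun F => bicycle_at t F && bicycle_has_ear t F)
    <= p ^+ k.+1 * ear_sum k.
  rewrite /bicycle_has_ear; set V := [set i in unzip1 _]; set S := [set d in chain _ _ _].
  have ear_ge0 : 0 <= ear_sum k.
    by apply: sumr_ge0 => l _; rewrite !mulr_ge0 ?exprn_ge0 ?mulr_ge0.
  have [/existsP[F0 b0]|/existsPn none] := boolP [exists F, bicycle_at t F]; last first.
    rewrite /Pr big_pred0 ?mulr_ge0 ?exprn_ge0 // => F.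
    by rewrite (negPf (none F)) andbF.
  have <- : #|S| = k.+1 by have := bicycle_card b0; rewrite size_tuple.
  apply: le_trans (Pr_le p01 (E' := fun F => (S \subset F) && has_ear V S F) _) _.
    move=> F _ /andP[b ->]; rewrite andbT; case/and5P: b => _ _ _ _ /andP[_ /allP cF].
    by apply/subsetP => d; rewrite inE => /cF.
  apply: Pr_ear.
    move=> d y; rewrite !inE => dS /(chain_var_sub dS)/or3P[/eqP->|/eqP->|//];
    by case/and5P: b0.
  by rewrite /V cardsE; apply: leq_trans (card_size _) _; rewrite size_map size_tuple.
apply: le_trans (ler_sum _ (fun t _ => step t)) _.
rewrite sumr_const -[leLHS]mulr_natl card_bicycle_index natrM natrX exprMn exprS.
by rewrite le_eqVlt; apply/orP; left; apply/eqP; ring.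
Qed.

End FirstMoments.

(** * Counting the kernels *)

Section KernelCount.

(* A literal slot of the kernel: (second vertex?, negated?). *)
Definition slot := (bool * bool)%type.

(** Doubling the unnegated slot is no restriction: [x] and [y] range over literals. *)
Definition kernel_slots : seq slot :=
  [:: (false, false); (false, false); (false, true); (true, false); (true, false); (true, true)].

Definition pair_false (X : Type) (f : X -> bool) (s : seq X) : bool :=
  if s is [:: a0; a1; b0; b1; c0; c1] then
    [|| ~~ f a0 && ~~ f a1, ~~ f b0 && ~~ f b1 | ~~ f c0 && ~~ f c1] else false.

Definition slot_value (h : bool * bool) (m : slot) := (if m.1 then h.2 else h.1) (+) m.2.

(** The multiset has 6!/(2! 2!) = 180 arrangements. Requiring the first slot to belong to the first
    vertex removes the exchange of the two vertices and keeps 90 of them. *)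
Definition patterns (b : bool) : seq (seq slot) :=
  [seq m <- permutations kernel_slots | ~~ (head (true, true) m).1 &
     b ==> all (fun h => pair_false (slot_value h) m)
               [:: (false, false); (false, true); (true, false); (true, true)]].

(** The unsatisfiable kernels are the arrangements of [x \/ x], [y \/ y], [-x \/ -y]: 3! orders and
    2 directions of the mixed clause, halved by the exchange of vertices. *)
Lemma size_patterns b : size (patterns b) = if b then 6 else 90.
Proof. by case: b; vm_compute. Qed.

Lemma pair_false_map (X Y : Type) (h : X -> Y) (f : Y -> bool) s :
  pair_false f (map h s) = pair_false (fun x => f (h x)) s.
Proof. by move: s => [|a0 [|a1 [|b0 [|b1 [|c0 [|c1 [|]]]]]]]. Qed.

Lemma eq_pair_false (X : Type) (f g : X -> bool) s : f =1 g ->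
  pair_false f s = pair_false g s.
Proof. by move=> E; move: s => [|a0 [|a1 [|b0 [|b1 [|c0 [|c1 [|]]]]]]] //=; rewrite !E. Qed.

Variable n : nat.
Implicit Types (x y z : literal n) (e : ends n).

Definition interp x y (m : slot) : literal n :=
  let z := if m.1 then y else x in if m.2 then neg z else z.

Definition slot_of x y z : slot := (z.1 == y.1, z == neg (if z.1 == y.1 then y else x)).

Lemma interpK x y : x.1 != y.1 -> cancel (interp x y) (slot_of x y).
Proof.
move=> xy [[] []]; rewrite /interp /slot_of /= ?eqxx ?(negPf xy) /= ?eqxx //;
by rewrite eq_sym (negPf (neg_neq _)).
Qed.

Definition end_seq e : seq (literal n) :=
  [:: (e ord0).1; (e ord0).2; (e 1%R).1; (e 1%R).2; (e ord_max).1; (e ord_max).2].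

Lemma end_countE e z : end_count e z = count_mem z (end_seq e).
Proof. by rewrite /end_count sum_ord3 /= addn0 !addnA. Qed.

Lemma end_seq_inj : injective end_seq.
Proof.
move=> e e' [E1 E2 E3 E4 E5 E6]; apply/ffunP; apply: forall_ord3;
by apply/eqP; rewrite [e _]surjective_pairing [e' _]surjective_pairing xpair_eqE
  ?E1 ?E2 ?E3 ?E4 ?E5 ?E6 !eqxx.
Qed.

Lemma end_seq_surj s : size s = 6 -> exists e, end_seq e = s.
Proof.
move: s => [|a0 [|a1 [|b0 [|b1 [|c0 [|c1 [|]]]]]]] // _.
by exists [ffun i => tri (a0, a1) (b0, b1) (c0, c1) i]; rewrite /end_seq !ffunE.
Qed.

Lemma exists_pair_false a e :
  [exists i, ~~ holds a (e i).1 && ~~ holds a (e i).2] = pair_false (holds a) (end_seq e).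
Proof.
apply/existsP/or3P => [[i]|].
  by move: i; apply: forall_ord3 => h; [apply: Or31 | apply: Or32 | apply: Or33].
by case=> h; [exists ord0 | exists 1%R | exists ord_max].
Qed.

Lemma cubicP (b : bool) e : reflect
  ((exists x y, x.1 != y.1 /\ perm_eq (end_seq e) (map (interp x y) kernel_slots)) /\
   (b -> forall a : {ffun 'I_n -> bool}, pair_false (holds a) (end_seq e))) (cubic b e).
Proof.
apply: (iffP andP) => -[h1 h2]; split.
- case/existsP: h1 => x /existsP[y /andP[xy /forallP h]]; exists x, y; split=> //.
  by apply/allP => z _; have := h z; rewrite end_countE.
- by move=> hb a; rewrite -exists_pair_false; exact: (forallP (implyP h2 hb)).
- case: h1 => x [y [xy h]]; apply/existsP; exists x; apply/existsP; exists y.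
  by rewrite xy; apply/forallP => z; rewrite end_countE (seq.permP h).
by apply/implyP => hb; apply/forallP => a; rewrite exists_pair_false; exact: h2.
Qed.

Lemma holds_interp a x y m : holds a (interp x y m) = slot_value (holds a x, holds a y) m.
Proof. by case: m => [[] []]; rewrite /interp /slot_value /= ?holds_neg ?addbT ?addbF. Qed.

(** Over distinct variables the four truth values of [(x, y)] all occur, which makes
    unsatisfiability of a kernel a finite check. *)
Lemma all_values x y (P : pred (bool * bool)) : x.1 != y.1 ->
  (forall a, P (holds a x, holds a y)) <->
  all P [:: (false, false); (false, true); (true, false); (true, true)].
Proof.
move=> xy; split=> [h|/and5P[h1 h2 h3 h4 _] a]; last first.
  by case: (holds a x) (holds a y) => [] [].
suff val (bx by_ : bool) : P (bx, by_) by rewrite /= !val.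
have [|a ha] := @assignment_of n [:: if bx then x else neg x; if by_ then y else neg y].
  by case: bx by_ => [] [] /=; rewrite inE xy.
have := h a; suff -> : (holds a x, holds a y) = (bx, by_) by [].
congr (_, _).
  by have := ha _ (mem_head _ _); case: (bx) => //; rewrite holds_neg => /negPf.
have := ha (if by_ then y else neg y); rewrite !inE eqxx orbT => /(_ isT).
by case: (by_) => //; rewrite holds_neg => /negPf.
Qed.

Lemma count_slots1 x y z : z.1 != y.1 ->
  count_mem z (map (interp x y) kernel_slots) = (x == z) + (x == z) + (neg x == z).
Proof.
move=> zy; have ny u : u.1 = y.1 -> (u == z) = false.
  by move=> uy; apply: contraNF zy => /eqP<-; rewrite uy.
by rewrite /= /interp /= !(ny y) // (ny (neg y)) // !addn0 addnA.
Qed.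

Lemma count_slots2 x y z : z.1 != x.1 ->
  count_mem z (map (interp x y) kernel_slots) = (y == z) + (y == z) + (neg y == z).
Proof.
move=> zx; have nx u : u.1 = x.1 -> (u == z) = false.
  by move=> ux; apply: contraNF zx => /eqP<-; rewrite ux.
by rewrite /= /interp /= !(nx x) // (nx (neg x)) // !add0n addn0 addnA.
Qed.

Lemma card_cubic b : #|[set e : ends n | cubic b e]| = 2 * n * (2 * n.-1) * size (patterns b).
Proof.
pose D := [set t : (literal n * literal n) * 'I_(size (patterns b)) | t.1.1.1 != t.1.2.1].
have cardD : #|D| = 2 * n * (2 * n.-1) * size (patterns b).
  have -> : D = setX [set t : literal n * literal n | t.1.1 != t.2.1] setT.
    by apply/setP => t; rewrite !inE andbT.
  rewrite cardsX cardsT card_ord; congr (_ * _).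
  rewrite -sum1dep_card -(pair_big_dep xpredT (fun x y : literal n => x.1 != y.1) (fun _ _ => 1)) /=.
  under eq_bigr => x _.
    have -> : \sum_(y : literal n | x.1 != y.1) 1 = 2 * n.-1.
      rewrite -[n in RHS]card_ord -(cardsC1 x.1) -card_literals_on sum1dep_card.
      by apply: eq_card => y; rewrite !inE eq_sym.
    over.
  by rewrite sum_nat_const card_literal.
have pat_props k : [/\ perm_eq (nth [::] (patterns b) k) kernel_slots,
    ~~ (head (true, true) (nth [::] (patterns b) k)).1 &
    b -> all (fun h => pair_false (slot_value h) (nth [::] (patterns b) k))
               [:: (false, false); (false, true); (true, false); (true, true)]] \/ size (patterns b) <= k.
  have [kb|] := ltnP k (size (patterns b)); [left | by right].
  have := mem_nth [::] kb; rewrite mem_filter mem_permutations => /andP[/andP[h1 /implyP h2] h3].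
  by split.
have pat_ord (k : 'I_(size (patterns b))) := pat_props k.
have g_ex (t : (literal n * literal n) * 'I_(size (patterns b))) : exists e,
    end_seq e = map (interp t.1.1 t.1.2) (nth [::] (patterns b) t.2).
  apply: end_seq_surj; rewrite size_map; case: (pat_ord t.2) => [[/perm_size ->]//|].
  by rewrite leqNgt ltn_ord.
have [g gE] := fin_all_exists g_ex.
have g_inj : {in D &, injective g}.
  move=> [[x y] k] [[x' y'] k']; rewrite !inE /= => xy xy' E.
  have := gE (x, y, k); rewrite E gE /=.
  case: (pat_ord k) => [[pm hm _]|]; last by rewrite leqNgt ltn_ord.
  case: (pat_ord k') => [[pm' hm' _]|]; last by rewrite leqNgt ltn_ord.
  have kE : nth [::] (patterns b) k = nth [::] (patterns b) k' -> k = k'.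
    move=> /eqP; rewrite nth_uniq ?ltn_ord // ?filter_uniq ?permutations_uniq //.
    by move=> /eqP; exact: val_inj.
  move: {E} pm hm pm' hm' kE.
  set m := nth _ _ k; set m' := nth _ _ k' => pm hm pm' hm' kE E.
  (* The first slot of a pattern belongs to the first vertex, so the first end reveals the variable
     of [x]. *)
  have Ex : x.1 = x'.1.
    case: (m) (m') (perm_size pm) (perm_size pm') hm hm' E => [|[v s] r] [|[v' s'] r'] //= _ _.
    by case: v v' => [] [] //= _ _ [/(congr1 fst) + _]; rewrite /interp /=; case: s s' => [] [].
  have in_k z : z \in map (interp x y) m -> z.1 = x.1 \/ z.1 = y.1.
    by case/mapP=> -[[] []] _ ->; rewrite /interp /=; auto.
  have Ey : y.1 = y'.1.
    have yin : y' \in map (interp x y) m.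
      rewrite -E; apply/mapP; exists (true, false) => //.
      by rewrite (perm_mem pm').
    case: (in_k y' yin) => // y'x; move: xy'; rewrite -Ex y'x eqxx //.
  have cnt u : count_mem u (map (interp x y) kernel_slots) = count_mem u (map (interp x' y') kernel_slots).
    by rewrite -(seq.permP (perm_map _ pm)) -(seq.permP (perm_map _ pm')) E.
  have xy1 : x.1 != y'.1 by rewrite -Ey.
  have yx1 : y.1 != x.1 by rewrite eq_sym.
  have yx1' : y.1 != x'.1 by rewrite -Ex.
  (* The sign is recovered from multiplicities: [x] occurs twice, [neg x] once. *)
  have Exx : x = x'.
    case: (same_var Ex) => // xx; have := cnt x; rewrite (count_slots1 _ xy) (count_slots1 _ xy1).
    by rewrite xx ?negK !eqxx ?(negPf (neq_neg _)).
  have Eyy : y = y'.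
    case: (same_var Ey) => // yy; have := cnt y; rewrite (count_slots2 _ yx1) (count_slots2 _ yx1').
    by rewrite yy ?negK !eqxx ?(negPf (neq_neg _)).
  move: E; rewrite -Exx -Eyy => /(inj_map (can_inj (interpK xy))) Em.
  by rewrite (kE (esym Em)).
rewrite -cardD -(card_in_imset g_inj); apply: eq_card => e; rewrite inE.
apply/cubicP/imsetP => [[[x [y [xy pe]]] hb]|[[[x y] k]]]; last first.
  rewrite inE /= => xy ->; have := gE (x, y, k) => /= ge.
  case: (pat_ord k) => [[pm hm pb]|]; last by rewrite leqNgt ltn_ord.
  split; first by exists x, y; split=> //; rewrite ge; exact: perm_map pm.
  move=> /pb/(all_values _ xy) h a; suff: pair_false (holds a) (end_seq (g (x, y, k))) by [].
  rewrite ge pair_false_map.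
  by rewrite (eq_pair_false _ (holds_interp a x y)); exact: h.
(* The definition of [cubic] is symmetric in its two vertices; name [x] the one met first. *)
wlog head_x : x y xy pe / (head x (end_seq e)).1 = x.1.
  move=> gen; have := perm_mem pe (head x (end_seq e)); rewrite mem_head => /esym/mapP[[v s] _ Eh].
  case: v Eh => Eh; last by apply: (gen x y) => //; rewrite Eh /interp /=; case: (s).
  apply: (gen y x); rewrite 1?eq_sym //; last by move: Eh; rewrite /= => ->; case: (s).
  apply: perm_trans pe _; apply/seq.permP => u; rewrite /= /interp /=; lia.
pose m := map (slot_of x y) (end_seq e).
have pm : perm_eq m kernel_slots.
  by rewrite -(mapK (interpK xy) kernel_slots); exact: perm_map.
have me : map (interp x y) m = end_seq e.
  rewrite -map_comp -[RHS]map_id; apply/eq_in_map => z /=.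
  by rewrite (perm_mem pe) => /mapP[s _ ->]; rewrite /= (interpK xy).
have mp : m \in patterns b.
  rewrite mem_filter mem_permutations pm andbT; apply/andP; split.
    by move: head_x; rewrite /m /= => ->.
  apply/implyP => /hb h; apply/(all_values _ xy) => a.
  by have := h a; rewrite -me pair_false_map (eq_pair_false _ (holds_interp a x y)).
have kb : index m (patterns b) < size (patterns b) by rewrite index_mem.
exists ((x, y), Ordinal kb); first by rewrite inE.
by apply: end_seq_inj; rewrite gE /= nth_index.
Qed.

End KernelCount.

(** * Moments of subdivisions *)

Section SubdivisionMoments.
Local Open Scope ring_scope.
Variables (R : realFieldType) (n : nat) (p : R).
Hypothesis p01 : 0 <= p <= 1.
Implicit Types (S F : formula n) (E : pred (formula n)) (V : {set 'I_n}).
Implicit Types (e : ends n) (c : chains n) (A : seq 'I_n).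
Local Notation q := ((2 * n)%:R * p).
Local Notation configuration := (ends n * chains n)%type.

Let p_ge0 : 0 <= p. Proof. by case/andP: p01. Qed.

Lemma sum_bseq (X : finType) N (f : seq X -> R) :
  \sum_(s : N.-bseq X) f s = \sum_(l < N.+1) \sum_(w : l.-tuple X) f w.
Proof.
rewrite (sig_big_dep _ _ (fun (l : 'I_N.+1) (w : l.-tuple X) => f w)) /=.
rewrite (reindex (@bseq_tagged_tuple N X)) /=; last first.
  exact: onW_bij (@bseq_tagged_tuple_bij N X).
by apply: eq_bigr => s _; case: s.
Qed.

Definition chain_sum : R := \sum_(l < n.+1) q ^+ l.

Lemma sum_chain_weight : \sum_(s : n.-bseq (literal n)) p ^+ (size s).+1 = p * chain_sum.
Proof.
rewrite (sum_bseq n (fun s => p ^+ (size s).+1)) mulr_sumr; apply: eq_bigr => l _.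
under eq_bigr => w _ do rewrite size_tuple.
rewrite sumr_const card_tuple card_literal -[LHS]mulr_natl natrX exprMn exprS.
by rewrite mulrCA.
Qed.

(** The first two conditions do not involve the formula; inside the event they let sums run over all
    configurations, the bad ones having probability 0. *)
Definition present b (t : configuration) F :=
  [&& separated t.1 t.2, cubic b t.1 & subdivision t.1 t.2 \subset F].

Definition config_weight (t : configuration) : R := \prod_i p ^+ (size (t.2 i)).+1.

Lemma config_weight_ge0 t : 0 <= config_weight t.
Proof. by apply: prodr_ge0 => i _; rewrite exprn_ge0. Qed.

Lemma config_weightE (t : configuration) : separated t.1 t.2 ->
  config_weight t = p ^+ #|subdivision t.1 t.2|.
Proof. by move=> sep; rewrite /config_weight card_subdivision // prodrXr. Qed.

Lemma sum_config_weight b : \sum_(t : configuration | cubic b t.1) config_weight t =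
  #|[set e : ends n | cubic b e]|%:R * (p * chain_sum) ^+ 3.
Proof.
transitivity (\sum_(e : ends n | cubic b e) \sum_c config_weight (e, c)).
  by rewrite pair_big_dep /=; apply: eq_big => [[e c]|[e c] _] //=; rewrite andbT.
under eq_bigr => e _.
  have -> : \sum_c config_weight (e, c) = (p * chain_sum) ^+ 3.
    rewrite -sum_chain_weight -[3%N in RHS]card_ord -prodr_const.
    by rewrite (bigA_distr_bigA (fun (i : 'I_3) (s : n.-bseq (literal n)) => p ^+ (size s).+1)).
  over.
by rewrite sumr_const -[LHS]mulr_natl; congr (_%:R * _); apply: eq_card => e; rewrite !inE.
Qed.

Lemma Pr_present b (t : configuration) :
  Pr p (present b t) <= if cubic b t.1 then config_weight t else 0.
Proof.
have [/andP[sep cub]|no] := boolP (separated t.1 t.2 && cubic b t.1).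
  rewrite cub config_weightE //; apply: (Pr_le_card p01) => F _ /and3P[_ _ sF].
  by split; [exact: sF |].
rewrite /Pr big_pred0; last first.
  move=> F; apply/negbTE; rewrite negb_and; apply/orP; right.
  by apply: contraNN no => /and3P[-> ->].
by case: ifP => // _; exact: config_weight_ge0.
Qed.

(* The relabelling group acts freely on the configurations present in F. *)
Lemma Pr_subdivision_le b :
  48%:R * Pr p (fun F => [exists t, present b t F]) <=
  #|[set e : ends n | cubic b e]|%:R * (p * chain_sum) ^+ 3.
Proof.
rewrite -sum_config_weight [leRHS]big_mkcond /=.
apply: (@le_trans _ _ (\sum_t Pr p (present b t))); last first.
  by apply: ler_sum => t _; exact: Pr_present.
apply: (Pr_count_le p01) => F _ /existsP[t /and3P[sep cub sF]].
pose f (g : relabelling) : configuration := (relabel_ends g t.1, relabel_chains g t.2).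
have f_inj : injective f by move=> g g' [_]; exact: (relabel_inj sep).
rewrite -card_relabelling -(card_imset _ f_inj); apply/subset_leq_card/subsetP => _ /imsetP[g _ ->].
by rewrite inE /present /= relabel_separated // relabel_cubic // relabel_subdivision.
Qed.

Variable L : nat.
Local Notation m := (3 * L + 2)%N.

Definition short c := [forall i, (size (c i) <= L)%N].

(** A short subdivision has at most [m = 3L + 2] variables, so at least [2(n - m)] literals are
    available for each new letter. *)
Definition chain_sum_short : R := \sum_(l < n.+1 | (0 < l <= L)%N) ((2 * (n - m))%:R * p) ^+ l.

Definition avoiding A (s : seq (literal n)) :=
  uniq (unzip1 s) && all [predC A] (unzip1 s).

(** Choose letters one at a time: each has to avoid at most [m] variables, those of [A] and those
    already used. *)
Lemma card_avoiding A l : (size A + l <= m)%N ->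
  ((2 * (n - m)) ^ l <= #|[set w : l.-tuple (literal n) | avoiding A w]|)%N.
Proof.
elim: l => [|l IH] le_m.
  rewrite expn0; apply/card_gt0P; exists [tuple]; by rewrite inE.
have {}IH : ((2 * (n - m)) ^ l <= #|[set w : l.-tuple (literal n) | avoiding A w]|)%N.
  by apply: IH; lia.
pose f (t : l.-tuple (literal n) * literal n) := [tuple of t.2 :: t.1].
have f_inj : injective f.
  move=> [w x] [w' x'] /(congr1 (@tval _ _)) [-> E].
  by congr (_, _); apply: val_inj.
pose D := [set t : l.-tuple (literal n) * literal n |
  avoiding A t.1 && (t.2.1 \notin A ++ unzip1 t.1)].
have -> : #|[set w : l.+1.-tuple (literal n) | avoiding A w]| = #|D|.
  rewrite -(card_imset _ f_inj); apply: eq_card => w; rewrite inE.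
  apply/idP/imsetP => [|[[w' x]]].
    case/tupleP: w => x w' h; exists (w', x); last by apply: val_inj.
    by move: h; rewrite inE mem_cat negb_or /avoiding /=; case: (_ \in A) => /=;
      rewrite ?andbF // => /andP[/andP[-> ->] ->].
  rewrite inE /= mem_cat negb_or => /andP[/andP[u1 u2] /andP[xA xw]] ->.
  by rewrite /avoiding /= xw u1 u2 xA.
have -> : #|D| = (\sum_(w : l.-tuple (literal n) | avoiding A w)
    #|[set x : literal n | x.1 \in ~: [set i in A ++ unzip1 w]]|)%N.
  rewrite -sum1_card; under [RHS]eq_bigr => w _ do rewrite -sum1_card.
  by rewrite pair_big_dep /=; apply: eq_bigl => t; rewrite !inE.
rewrite expnS mulnC; apply: (@leq_trans (\sum_(w : l.-tuple (literal n) | avoiding A w) 2 * (n - m))%N).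
  by rewrite sum_nat_const leq_mul2r -[in leqRHS]cardsE IH orbT.
apply: leq_sum => w _; rewrite card_literals_on leq_mul2l /=.
rewrite cardsCs setCK card_ord leq_sub2l // cardsE; apply: leq_trans (card_size _) _.
rewrite size_cat size_map size_tuple. by apply: leq_trans le_m; rewrite leq_add2l.
Qed.

Lemma sum_avoiding A : (size A + L <= m)%N ->
  p * chain_sum_short <=
  \sum_(s : n.-bseq (literal n) | [&& (0 < size s)%N, (size s <= L)%N & avoiding A s]) p ^+ (size s).+1.
Proof.
move=> le_m; rewrite [leRHS]big_mkcond /=.
rewrite (sum_bseq n (fun s => if [&& (0 < size s)%N, (size s <= L)%N & avoiding A s]
   then p ^+ (size s).+1 else 0)) /chain_sum_short mulr_sumr [leLHS]big_mkcond /=.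
apply: ler_sum => l _; case: ifP => [/andP[l0 lL]|_]; last first.
  by apply: sumr_ge0 => w _; case: ifP; rewrite // exprn_ge0.
rewrite -big_mkcond /= (eq_bigl (fun w : l.-tuple _ => w \in [set w : l.-tuple _ | avoiding A w])); last first.
  by move=> w; rewrite inE size_tuple l0 lL.
rewrite (eq_bigr (fun=> p ^+ l.+1)); last by move=> w _; rewrite size_tuple.
rewrite sumr_const -[leRHS]mulr_natl exprMn mulrCA -exprS ler_wpM2r ?exprn_ge0 //.
by rewrite -natrX ler_nat card_avoiding //; lia.
Qed.

Lemma sum_chains (f : chains n -> R) :
  \sum_c f c = \sum_s0 \sum_s1 \sum_s2 f [ffun i => tri s0 s1 s2 i].
Proof.
under [RHS]eq_bigr => s0 _ do rewrite pair_bigA /=.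
rewrite pair_bigA /=.
pose h (s : n.-bseq (literal n) * (n.-bseq (literal n) * n.-bseq (literal n))) : chains n :=
  [ffun i => tri s.1 s.2.1 s.2.2 i].
rewrite (reindex h) //; apply: onW_bij.
exists (fun c => (c ord0, (c 1%R, c ord_max))) => [[s0 [s1 s2]]|c].
  by rewrite /h !ffunE.
by apply/ffunP; apply: forall_ord3; rewrite ffunE.
Qed.

Lemma prod_ord3 (F : 'I_3 -> R) : \prod_i F i = F ord0 * (F 1%R * F ord_max).
Proof.
by rewrite !big_ord_recl big_ord0 mulr1; congr (_ * (F _ * F _)); apply: val_inj.
Qed.

(** For fixed ends choose the three words in turn, each avoiding the two end variables and the
    earlier words; the total stays within [m], so one bound serves all three. *)
Lemma sum_short_weight b :
  #|[set e : ends n | cubic b e]|%:R * (p * chain_sum_short) ^+ 3 <=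
  \sum_(t : configuration | [&& separated t.1 t.2, cubic b t.1 & short t.2]) config_weight t.
Proof.
have X_ge0 : 0 <= p * chain_sum_short.
  by rewrite mulr_ge0 // sumr_ge0 // => l _; rewrite exprn_ge0 // mulr_ge0.
rewrite [leRHS](_ : _ = \sum_(e : ends n | cubic b e) \sum_(c | separated e c && short c) config_weight (e, c)); last first.
  by rewrite [RHS]pair_big_dep /=; apply: eq_big => [[e c]|[e c] _] //=; rewrite andbCA.
rewrite [leLHS](_ : _ = \sum_(e : ends n | cubic b e) (p * chain_sum_short) ^+ 3); last first.
  by rewrite sumr_const -[RHS]mulr_natl; congr (_%:R * _); apply: eq_card => e; rewrite !inE.
apply: ler_sum => e cub.
have [A0 sA0 A0P] : exists2 A0 : seq 'I_n, (size A0 <= 2)%N & forall t, end_var e t -> t \in A0.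
  case/cubicP: cub => -[x [y [_ pe]]] _; exists [:: x.1; y.1] => // t.
  rewrite -[t]/((t, true) : literal n).1 end_countP !end_countE -!has_count !has_pred1 !(perm_mem pe).
  have inj z : z \in map (interp x y) kernel_slots -> z.1 \in [:: x.1; y.1].
    by case/mapP=> -[[] []] _ ->; rewrite !inE /interp /= eqxx ?orbT.
  by case/orP=> /inj.
rewrite big_mkcond /= sum_chains.
pose ok A (s : n.-bseq (literal n)) := [&& (0 < size s)%N, (size s <= L)%N & avoiding A s].
pose g (s : n.-bseq (literal n)) : R := p ^+ (size s).+1.
apply: (@le_trans _ _ (\sum_(s0 | ok A0 s0) \sum_(s1 | ok (A0 ++ unzip1 s0) s1)
   \sum_(s2 | ok (A0 ++ unzip1 s0 ++ unzip1 s1) s2) g s0 * (g s1 * g s2))).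
  rewrite exprS; apply: le_trans (ler_wpM2r _ (sum_avoiding (A := A0) _)) _; first by rewrite exprn_ge0.
    by lia.
  rewrite mulr_suml; apply: ler_sum => s0 /and3P[_ s0L _].
  under eq_bigr => s1 _ do rewrite -mulr_sumr.
  rewrite -mulr_sumr ler_wpM2l ?exprn_ge0 //.
  apply: le_trans (ler_wpM2r X_ge0 (sum_avoiding (A := A0 ++ unzip1 s0) _)) _.
    rewrite size_cat size_map; apply: (@leq_trans (2 + L + L)); last by lia.
    by rewrite !leq_add.
  rewrite mulr_suml; apply: ler_sum => s1 /and3P[_ s1L _].
  rewrite -mulr_sumr ler_wpM2l ?exprn_ge0 //.
  apply: sum_avoiding; rewrite !size_cat !size_map.
  by apply: (@leq_trans (2 + (L + L) + L)); [rewrite !leq_add | lia].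
rewrite [leLHS]big_mkcond /=; apply: ler_sum => s0 _; case: ifP => ok0; last first.
  by do 2!(apply: sumr_ge0 => ? _); case: ifP => // _; exact: config_weight_ge0.
rewrite [leLHS]big_mkcond /=; apply: ler_sum => s1 _; case: ifP => ok1; last first.
  by apply: sumr_ge0 => ? _; case: ifP => // _; exact: config_weight_ge0.
rewrite [leLHS]big_mkcond /=; apply: ler_sum => s2 _; case: ifP => ok2; last first.
  by case: ifP => // _; exact: config_weight_ge0.
set c := [ffun i => _].
have [c0 c1 c2] : [/\ c ord0 = s0, c 1%R = s1 & c ord_max = s2] by rewrite /c !ffunE.
have -> : separated e c && short c; last first.
  by rewrite /config_weight prod_ord3 /= c0 c1 c2.
case/and3P: ok0 => z0 l0 /andP[u0 a0]; case/and3P: ok1 => z1 l1 /andP[u1 a1].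
case/and3P: ok2 => z2 l2 /andP[u2 a2].
have sub_end (s : seq 'I_n) A : all [predC A0 ++ A] s -> all [predC end_var e] s.
  move=> /allP h; apply/allP => t /h; rewrite /= mem_cat negb_or => /andP[tA _].
  by apply: contraNN tA => /A0P.
apply/andP; split; [apply/andP; split; apply/forallP | apply/forallP].
- apply: forall_ord3; rewrite ?c0 ?c1 ?c2 ?z0 ?z1 ?z2 ?u0 ?u1 ?u2 /=.
  + by apply: (sub_end _ [::]); rewrite cats0.
  + exact: sub_end a1.
  + exact: sub_end a2.
- suff disj (i j : 'I_3) : (i < j)%N -> forall t, t \in unzip1 (c j) -> t \notin unzip1 (c i).
    move=> i; apply/forallP => j; apply/implyP => ij; apply/allP => t ti.
    case: (ltngtP i j) => [ij'|/disj/(_ t ti)//|/val_inj E]; last by rewrite E eqxx in ij.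
    by apply: contraL ti => tj; exact: disj ij' t tj.
  move: i; apply: forall_ord3; move: j; apply: forall_ord3; rewrite ?c0 ?c1 ?c2 //= => _ t.
  + by move=> /(allP a1); rewrite /= mem_cat negb_or => /andP[].
  + by move=> /(allP a2); rewrite /= !mem_cat !negb_or => /and3P[].
  + by move=> /(allP a2); rewrite /= !mem_cat !negb_or => /and3P[].
- by apply: forall_ord3; rewrite ?c0 ?c1 ?c2.
Qed.

Definition apart (t t' : configuration) :=
  [forall d in subdivision t.1 t.2, forall d' in subdivision t'.1 t'.2,
   forall y in d, forall y' in d', y.1 != y'.1].

Lemma apart_disjoint (t t' : configuration) : separated t.1 t.2 -> apart t t' ->
  [disjoint subdivision t.1 t.2 & subdivision t'.1 t'.2].
Proof.
move=> sep ap; apply/pred0P => d /=; apply/negbTE/negP => /andP[dS dS'].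
have [y yd] : exists y, y \in d.
  by case/imsetP: (subsetP (subdivision_clauses sep) d dS) => -[u v] _ ->; exists u; rewrite !inE eqxx.
have := forall_inP ap d dS => /forall_inP/(_ d dS')/forall_inP/(_ y yd)/forall_inP/(_ y yd).
by rewrite eqxx.
Qed.

(** Excluding short competitors is enough for uniqueness, since isolated configurations are short
    themselves. *)
Definition isolated b (t : configuration) F :=
  [&& present b t F, short t.2,
     ~~ has_ear (subdivision_vars t.1 t.2) (subdivision t.1 t.2) F &
     ~~ [exists t', [&& present b t' F, short t'.2 & apart t t']]].

Lemma isolated_unique b t t' F : isolated b t F -> isolated b t' F ->
  subdivision t.1 t.2 = subdivision t'.1 t'.2.
Proof.
suff half t1 t2 : isolated b t1 F -> isolated b t2 F ->
    subdivision t2.1 t2.2 \subset subdivision t1.1 t1.2.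
  by move=> h h'; apply/eqP; rewrite eqEsubset !half.
case/and4P=> /and3P[sep1 cub1 sF1] _ no_ear no_apart /and4P[pr2 sh2 _ _].
have /and3P[sep2 cub2 sF2] := pr2; apply: contraT => nsub.
case: (other_subdivision sep1 cub1 sep2 cub2 sF2 nsub) => [[y [w [z h]]]|h].
  by case/negP: no_ear; exact: has_earP h.
case/negP: no_apart; apply/existsP; exists t2; rewrite pr2 sh2 /=.
apply/forall_inP => d dS; apply/forall_inP => d' dS'; apply/forall_inP => y yd.
by apply/forall_inP => y' yd'; exact: h dS dS' yd yd'.
Qed.

(** All isolated configurations of a formula have the same subdivision, hence differ by a
    relabelling. *)
Lemma card_isolated b F : (#|[set t | isolated b t F]| <= 48)%N.
Proof.
have [->|[t0]] := set_0Vmem [set t | isolated b t F]; first by rewrite cards0.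
rewrite inE => iso0; have /and4P[/and3P[sep0 cub0 _] _ _ _] := iso0.
pose f (g : relabelling) : configuration := (relabel_ends g t0.1, relabel_chains g t0.2).
rewrite -card_relabelling; apply: leq_trans (leq_imset_card f predT).
apply/subset_leq_card/subsetP => -[e c]; rewrite inE => iso.
have /and4P[/and3P[/= sep cub _] _ _ _] := iso.
have [g [Ee Ec]] := subdivision_relabel sep0 cub0 sep cub (isolated_unique iso iso0).
by apply/imsetP; exists g; rewrite // /f -Ee -Ec.
Qed.

Definition error_sum b : R :=
  ear_sum n p m + #|[set e : ends n | cubic b e]|%:R * (p * chain_sum) ^+ 3.

(** Ears and apart subdivisions use clauses outside [S], so each failure probability contains the
    factor [p^|S|], multiplied by an unconditional first moment. *)
Lemma Pr_isolated b (t : configuration) :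
    separated t.1 t.2 -> cubic b t.1 -> short t.2 ->
  config_weight t * (1 - error_sum b) <= Pr p (isolated b t).
Proof.
move=> sep cub sh; set S := subdivision t.1 t.2; set V := subdivision_vars t.1 t.2.
(* Shortness of [t'] is dropped here: the first moment of all configurations is already small. *)
pose Ap (t' : configuration) : pred (formula n) := fun F =>
   [&& separated t'.1 t'.2, cubic b t'.1, apart t t' & S :|: subdivision t'.1 t'.2 \subset F].
have SC : S \subset clauses n := subdivision_clauses sep.
have bound : Pr p (fun F => S \subset F) <= Pr p (isolated b t) +
    (Pr p (fun F => (S \subset F) && has_ear V S F) + \sum_t' Pr p (Ap t')).
  apply: (@le_trans _ _ (Pr p (isolated b t) + (Pr p (fun F => (S \subset F) && has_ear V S F) +
      Pr p (fun F => [exists t', Ap t' F])))).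
    apply: le_trans (Pr_union2 p01 (E1 := isolated b t) (E2 := fun F =>
      (S \subset F) && has_ear V S F || [exists t', Ap t' F]) _) _; last first.
      by rewrite lerD2l; exact: (Pr_union2 p01).
    move=> F _ SF; have [//|] := boolP (isolated b t F).
    rewrite /isolated /present sep cub sh SF /= negb_and !negbK => /orP[->//|].
    case/existsP=> t' /and3P[/and3P[sep' cub' sF'] _ ap]; apply/orP; right; apply/existsP; exists t'.
    by rewrite /Ap sep' cub' ap subUset SF sF'.
  by rewrite !lerD2l; apply: (Pr_union p01) => F _ /existsP.
have ear_le : Pr p (fun F => (S \subset F) && has_ear V S F) <= p ^+ #|S| * ear_sum n p m.
  apply: (Pr_ear p01); first by move=> d y; exact: subdivision_varsP.
  apply: leq_trans (card_subdivision_vars t.2 cub) _.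
  have sL i : (size (t.2 i) <= L)%N by exact: (forallP sh i).
  by rewrite sum_ord3; apply: (@leq_trans (L + L + L).+2); [rewrite !ltnS !leq_add | lia].
have ap_le : \sum_t' Pr p (Ap t') <=
    p ^+ #|S| * (#|[set e : ends n | cubic b e]|%:R * (p * chain_sum) ^+ 3).
  rewrite -sum_config_weight mulr_sumr [leRHS]big_mkcond /=; apply: ler_sum => t' _.
  have [/and3P[sep' cub' ap]|no] := boolP [&& separated t'.1 t'.2, cubic b t'.1 & apart t t'].
    rewrite cub' config_weightE // -exprD; apply: (Pr_le_card p01 (S := S :|: subdivision t'.1 t'.2)).
    move=> F _ /and4P[_ _ _ sF]; split=> //; rewrite cardsU.
    by have /disjoint_setI0 -> := apart_disjoint sep ap; rewrite cards0 subn0.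
  rewrite /Pr big_pred0; first by case: ifP => // _; rewrite mulr_ge0 ?exprn_ge0 ?config_weight_ge0.
  move=> F; apply/negbTE; rewrite negb_and; apply/orP; right.
  by apply: contraNN no => /and4P[-> -> ->].
rewrite (Pr_sub p SC) in bound.
rewrite config_weightE // mulrBr mulr1 lerBlDr /error_sum mulrDr.
by apply: le_trans bound _; rewrite lerD2l lerD.
Qed.

Lemma Pr_subdivision_ge b : error_sum b <= 1 ->
  #|[set e : ends n | cubic b e]|%:R * (p * chain_sum_short) ^+ 3 * (1 - error_sum b) <=
  48%:R * Pr p (fun F => [exists t, present b t F]).
Proof.
move=> err1; apply: (@le_trans _ _ (\sum_(t : configuration) Pr p (isolated b t))); last first.
  apply: (Pr_count_ge p01) => [F _|F t _ /and4P[pr _ _ _]]; first exact: card_isolated.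
  by apply/existsP; exists t.
apply: le_trans (ler_wpM2r _ (sum_short_weight b)) _; first by rewrite subr_ge0.
rewrite mulr_suml big_mkcond /=; apply: ler_sum => t _.
case: ifP => [/and3P[sep cub sh]|_]; first exact: Pr_isolated.
exact: (Pr_ge0 p01).
Qed.

End SubdivisionMoments.

(** * Unsatisfiable formulas and nonempty kernels *)

Section Events.
Local Open Scope ring_scope.
Variables (R : realFieldType) (n : nat) (p : R).
Hypothesis p01 : 0 <= p <= 1.
Implicit Types (F : formula n) (u v : literal n) (w : seq (literal n)).

Lemma split_at2 (T : Type) (x0 : T) (s : seq T) i j : (i < j < size s)%N ->
  s = take i s ++ nth x0 s i :: take (j - i.+1) (drop i.+1 s) ++ nth x0 s j :: drop j.+1 s.
Proof.
case/andP=> ij js; rewrite -{1}(cat_take_drop i s) (drop_nth x0); last exact: ltn_trans ij js.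
congr (_ ++ _ :: _); rewrite -{1}(cat_take_drop (j - i.+1) (drop i.+1 s)) drop_drop.
by rewrite subnK // -(drop_nth x0).
Qed.

Lemma nondegenerate_split w (i j : 'I_(size w)) : ~~ degenerate i j -> (i < j)%N ->
  exists A B C : seq (literal n),
    [/\ w = A ++ tnth (in_tuple w) i :: B ++ tnth (in_tuple w) j :: C,
       (0 < size A)%N, (0 < size B)%N & (0 < size C)%N].
Proof.
rewrite /degenerate !negb_or => /and5P[i0 j0 ik jk /and3P[_ ij1 ji1]] ij.
have x0 := tnth (in_tuple w) i; have js := ltn_ord j.
exists (take i w), (take (j - i.+1) (drop i.+1 w)), (drop j.+1 w).
rewrite !(tnth_nth x0) /= -split_at2 ?ij ?js //.
have iw := ltn_ord i; rewrite size_take iw size_take !size_drop.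
split=> //; first by rewrite lt0n.
  by case: ifP => _; rewrite subn_gt0; [rewrite ltn_neqAle ij1 | exact: leq_ltn_trans ij js].
by rewrite subn_gt0 ltn_neqAle jk.
Qed.

Lemma bicycle_present F u w v (i j : 'I_(size w)) : bicycle F u w v ->
    u = on_var (in_tuple w) (i, u.2) -> v = on_var (in_tuple w) (j, v.2) ->
    ~~ degenerate i j ->
  (exists t, present false t F) /\
  (~~ satisfiable [set d in chain u w v] -> exists t, present true t F).
Proof.
move=> bic Eu Ev nd; have /and5P[uw _ _ _ /andP[_ /allP cF]] := bic.
have sF : [set d in chain u w v] \subset F by apply/subsetP => d; rewrite inE => /cF.
have u1 : u.1 = (tnth (in_tuple w) i).1 by rewrite {1}Eu.
have v1 : v.1 = (tnth (in_tuple w) j).1 by rewrite {1}Ev.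
have pos y (k : 'I_(size w)) : y.1 = (tnth (in_tuple w) k).1 -> y \in w ->
    y = tnth (in_tuple w) k /\ index y w = k.
  move=> Ey yw; have iy : (index y w < size w)%N by rewrite index_mem.
  have E : index y w = k.
    apply/eqP; rewrite -(nth_uniq y.1 _ _ uw) ?size_map ?ltn_ord //.
    by rewrite !(nth_map y) ?ltn_ord // nth_index // Ey (tnth_nth y) /= eqxx.
  by split=> //; rewrite (tnth_nth y) /= -E nth_index.
have [ij|ij] := ltnP i j.
  have [A [B [C [Ew A0 B0 C0]]]] := nondegenerate_split nd ij.
  have [|e [c [sep ES cub unsat]]] := bicycle_subdivision bic Ew A0 B0 C0.
    by rewrite u1 v1 !eqxx.
  split; first by exists (e, c); rewrite /present sep cub /= ES.
  move=> uns; have [uin vin _] := bicycle_unsat bic uns.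
  have [up _] := pos u i u1 uin; have [vq _] := pos (neg v) j v1 vin.
  exists (e, c); rewrite /present sep unsat //= ?ES //.
  by rewrite -vq negK.
have {ij}ji : (j < i)%N.
  rewrite ltn_neqAle ij andbT; apply: contraNneq nd => E.
  by rewrite /degenerate (_ : (i == j) = true) ?orbT //; apply/eqP/val_inj.
have nd' : ~~ degenerate j i.
  apply: contraNN nd; rewrite /degenerate => /or4P[->|->|->|/or4P[->|/eqP->|->|->]];
  by rewrite ?eqxx ?orbT.
have [A [B [C [Ew A0 B0 C0]]]] := nondegenerate_split nd' ji.
have [|e [c [sep ES cub _]]] := bicycle_subdivision bic Ew A0 B0 C0.
  by rewrite u1 v1 !eqxx orbT.
split; first by exists (e, c); rewrite /present sep cub /= ES.
(* An unsatisfiable bicycle has [u] no later than [neg v], which contradicts the order [j < i]. *)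
move=> uns; have [uin vin] := bicycle_unsat bic uns.
have [_ ->] := pos u i u1 uin; have [_ ->] := pos (neg v) j v1 vin.
by rewrite leqNgt ji.
Qed.

(** The same Boolean selects the kernels in [cubic b], so both asymptotic statements are proved at
    once. *)
Definition bad_event (b : bool) : pred (formula n) := fun F =>
  if b then ~~ satisfiable F else kernel_vars F != finset.set0.

Lemma present_bad b t F : present b t F -> bad_event b F.
Proof.
case/and3P=> sep cub sF; case: b cub => cub /=; first exact: subdivision_unsat cub sF.
have [y dy] := cubic_degree sep cub.
exact: kernel_nonempty sF (subdivision_pure_free sep cub) dy.
Qed.

Lemma bad_cases b F : F \subset clauses n -> bad_event b F ->
  [\/ exists t, present b t F,
      exists u w v i j, [/\ bicycle F u w v, u = on_var (in_tuple w) (i, u.2),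
          v = on_var (in_tuple w) (j, v.2) & degenerate i j] |
      exists u w v, bicycle F u w v /\
       has_ear [set i in unzip1 w] [set d in chain u w v] F].
Proof.
move=> FC; case: b => /= bad; last first.
  have [u [w [v bic]]] := kernel_bicycle FC bad; have [_ [i [j [Eu Ev]]]] := bicycle_indexP bic.
  have [dg|nd] := boolP (degenerate i j); first by apply: Or32; exists u, w, v, i, j.
  by apply: Or31; case: (bicycle_present bic Eu Ev nd).
have [u [w [v [bic [uns|[x [c [z he]]]]]]]] := unsat_bicycle FC bad; last first.
  by apply: Or33; exists u, w, v; split=> //; exact: has_earP he.
have [_ [i [j [Eu Ev]]]] := bicycle_indexP bic.
have [dg|nd] := boolP (degenerate i j); first by apply: Or32; exists u, w, v, i, j.
by apply: Or31; case: (bicycle_present bic Eu Ev nd) => _; exact.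
Qed.

Lemma Pr_bad_le b : Pr p (bad_event b) <=
  #|[set e : ends n | cubic b e]|%:R * (p * chain_sum n p) ^+ 3 / 48%:R +
  (degenerate_sum n p + bicycle_ear_sum n p).
Proof.
pose E1 : pred (formula n) := fun F => [exists t, present b t F].
pose E2 : pred (formula n) := some_bicycle (fun k t _ => degenerate t.2.1.1 t.2.2.1).
pose E3 : pred (formula n) := some_bicycle (@bicycle_has_ear n).
have h2 : Pr p E2 <= degenerate_sum n p := Pr_degenerate n p01.
have h3 : Pr p E3 <= bicycle_ear_sum n p := Pr_bicycle_ear n p01.
apply: (@le_trans _ _ (Pr p E1 + (Pr p E2 + Pr p E3))).
  apply: le_trans (Pr_union2 p01 (E1 := E1) (E2 := fun F => E2 F || E3 F) _) _; last first.
    by rewrite lerD2l; exact: (Pr_union2 p01).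
  move=> F FC /(bad_cases FC)[/existsP h|[u [w [v [i [j [bic Eu Ev dg]]]]]]|[u [w [v [bic he]]]]].
  - by apply/orP; left; exact: h.
  - by apply/orP; right; apply/orP; left; exact: some_bicycleP bic Eu Ev dg.
  have [_ [i [j [Eu Ev]]]] := bicycle_indexP bic.
  apply/orP; right; apply/orP; right; apply: (some_bicycleP bic Eu Ev).
  by rewrite /bicycle_has_ear /= -Eu -Ev.
apply: lerD; last exact: lerD.
by rewrite ler_pdivlMr ?ltr0n // [leLHS]mulrC; exact: Pr_subdivision_le.
Qed.

Lemma Pr_bad_ge b L : error_sum n p L b <= 1 ->
  #|[set e : ends n | cubic b e]|%:R * (p * chain_sum_short n p L) ^+ 3
    * (1 - error_sum n p L b) / 48%:R <= Pr p (bad_event b).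
Proof.
move=> err1; rewrite ler_pdivrMr ?ltr0n // [leRHS]mulrC.
apply: le_trans (Pr_subdivision_ge p01 err1) _.
by rewrite ler_wpM2l ?ler0n // (Pr_le p01) // => F _ /existsP[t /present_bad].
Qed.

(** The plain first moment of bicycles, with a worse constant, serves the bound over the whole range
    of [sigma]. *)
Lemma Pr_kernel_le : Pr p (bad_event false) <= bicycle_sum n p.
Proof. by apply: (Pr_bicycle p01) => F FC; exact: kernel_bicycle. Qed.

End Events.

(** * Power sums *)

Section PowerSums.
Local Open Scope ring_scope.
Variables (R : realFieldType) (q : R).
Hypotheses (q_ge0 : 0 <= q) (q_lt1 : q < 1).
Let d_gt0 : 0 < 1 - q. Proof. by rewrite subr_gt0. Qed.

(** Pascal's rule gives [A_(m+1) <= q A_(m+1) + A_m] for the truncated sums, the shift dropping a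
    nonnegative last term; then divide by [1 - q]. *)
Lemma sum_binomial_le m N : \sum_(k < N) 'C(k + m, m)%:R * q ^+ k <= (1 - q) ^- m.+1.
Proof.
elim: m N => [|m IH] N.
  rewrite expr1 -[leRHS]mul1r ler_pdivlMr //.
  under eq_bigr => k _ do rewrite bin0 mul1r.
  have := subrX1 q N; rewrite -opprB => E.
  by rewrite mulrC -opprB mulNr -subrX1 opprB lerBlDr lerDl exprn_ge0.
have pos M : 0 <= \sum_(k < M) 'C(k + m.+1, m.+1)%:R * q ^+ k.
  by apply: sumr_ge0 => k _; rewrite mulr_ge0 ?exprn_ge0.
have rec : \sum_(k < N) 'C(k + m.+1, m.+1)%:R * q ^+ k <=
    q * (\sum_(k < N) 'C(k + m.+1, m.+1)%:R * q ^+ k) +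
    \sum_(k < N) 'C(k + m, m)%:R * q ^+ k.
  under [leLHS]eq_bigr => k _ do rewrite addnS binS natrD mulrDl.
  rewrite big_split lerD2r /=.
  case: N => [|N]; first by rewrite !big_ord0 mulr0.
  rewrite big_ord_recl /= add0n bin_small // mul0r add0r.
  rewrite [X in q * X]big_ord_recr /= mulrDr -[leLHS]addr0 lerD //; last first.
    by rewrite !mulr_ge0 ?exprn_ge0.
  rewrite mulr_sumr ler_sum // => k _.
  by rewrite /bump /= add1n addSnnS exprS mulrCA.
rewrite exprS invfM -[leLHS](mulKf (lt0r_neq0 d_gt0)).
rewrite ler_wpM2l ?invr_ge0 ?(ltW d_gt0) //.
by apply: le_trans (IH N); rewrite mulrBl mul1r lerBlDl.
Qed.

Lemma expn_le_binomial k m : (k ^ m <= 'C(k + m, m) * m`!)%N.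
Proof.
rewrite bin_ffact; elim: m => [|m IH]; first by rewrite ffactn0.
by rewrite addnS ffactSS expnS leq_mul // -addnS leq_addr.
Qed.

Lemma sum_power_le m N : \sum_(k < N) (k ^ m)%:R * q ^+ k <= m`!%:R / (1 - q) ^+ m.+1.
Proof.
apply: (@le_trans _ _ (m`!%:R * \sum_(k < N) 'C(k + m, m)%:R * q ^+ k)).
  rewrite mulr_sumr; apply: ler_sum => k _; rewrite mulrA ler_wpM2r ?exprn_ge0 //.
  by rewrite -natrM ler_nat mulnC expn_le_binomial.
by rewrite ler_wpM2l // sum_binomial_le.
Qed.

(** Bernoulli's inequality in the form [q^L (1 + L(1-q)) <= 1]; this rational bound replaces
    exponentials in the truncation error. *)
Lemma expr_le_inv L : q ^+ L <= (1 + L%:R * (1 - q))^-1.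
Proof.
have pos : 0 < 1 + L%:R * (1 - q) by rewrite ltr_pwDl // mulr_ge0 // ltW.
rewrite -[leRHS]mul1r ler_pdivlMr //.
elim: L {pos} => [|L IH]; first by rewrite expr0 mul0r addr0 mulr1.
have qL : 0 <= q ^+ L by exact: exprn_ge0.
apply: le_trans IH; rewrite exprS -natr1.
have := mulr_ge0 qL (mulr_ge0 (ler0n R L.+1) (mulr_ge0 (ltW d_gt0) (ltW d_gt0))).
rewrite -natr1; set x := q ^+ L; set l := L%:R; nra.
Qed.

End PowerSums.

(** * Closed forms for the first moments *)

Section Bounds.
Local Open Scope ring_scope.
Variables (R : realFieldType) (n : nat) (p : R).
Hypothesis p01 : 0 <= p <= 1.
Local Notation q := ((2 * n)%:R * p).
Local Notation d := (1 - q).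
Hypothesis d_gt0 : 0 < d.

Let p_ge0 : 0 <= p. Proof. by case/andP: p01. Qed.
Let q_ge0 : 0 <= q. Proof. by rewrite mulr_ge0. Qed.
Let q_lt1 : q < 1. Proof. by rewrite -subr_gt0. Qed.

Lemma chain_sum_le : p * chain_sum n p <= p / d.
Proof.
rewrite ler_wpM2l //; have := sum_power_le q_ge0 q_lt1 0 n.+1.
by rewrite fact0 mul1r expr1; apply: le_trans; apply: ler_sum => k _; rewrite expn0 mul1r.
Qed.

Lemma bicycle_sum_le : bicycle_sum n p <= 8 * p / d ^+ 3.
Proof.
have := sum_power_le q_ge0 q_lt1 2 n.+1; rewrite -[2`!]/2%N => h.
rewrite /bicycle_sum (_ : \sum_(k < _) _ = 4 * p * \sum_(k < n.+1) (k ^ 2)%:R * q ^+ k).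
  by apply: le_trans (ler_wpM2l _ h) _; [rewrite mulr_ge0 | rewrite le_eqVlt; apply/orP; left; apply/eqP; ring].
by rewrite mulr_sumr; apply: eq_bigr => k _; rewrite natrM; ring.
Qed.

Lemma degenerate_sum_le : degenerate_sum n p <= 28 * p / d ^+ 2.
Proof.
have := sum_power_le q_ge0 q_lt1 1 n.+1; rewrite -[1`!]/1%N => h.
rewrite /degenerate_sum (_ : \sum_(k < _) _ = 28 * p * \sum_(k < n.+1) (k ^ 1)%:R * q ^+ k).
  by apply: le_trans (ler_wpM2l _ h) _; [rewrite mulr_ge0 | rewrite le_eqVlt; apply/orP; left; apply/eqP; ring].
by rewrite mulr_sumr; apply: eq_bigr => k _; rewrite natrM expn1; ring.
Qed.

Lemma ear_sum_le K : ear_sum n p K <= 4 * K%:R * p * (K%:R / d + d ^- 2).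
Proof.
have := sum_power_le q_ge0 q_lt1 0 n.+1; rewrite fact0 mul1r expr1 => h0.
have := sum_power_le q_ge0 q_lt1 1 n.+1; rewrite -[1`!]/1%N mul1r => h1.
rewrite /ear_sum (_ : \sum_(l < _) _ = 4 * K%:R * p * (K%:R * (\sum_(k < n.+1) (k ^ 0)%:R * q ^+ k) +
   \sum_(k < n.+1) (k ^ 1)%:R * q ^+ k)).
  by rewrite ler_wpM2l ?mulr_ge0 // lerD // ler_wpM2l.
rewrite [K%:R * _]mulr_sumr -big_split mulr_sumr /=; apply: eq_bigr => k _.
by rewrite natrM natrM natrD expn0 expn1; ring.
Qed.

(** Two power sums appear, of exponents 4 and 3, and 480 = 16 (4! + 3!). *)
Lemma bicycle_ear_sum_le : bicycle_ear_sum n p <= 480 * p ^+ 2 / d ^+ 6.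
Proof.
have := sum_power_le q_ge0 q_lt1 4 n.+1; rewrite -[4`!]/24%N => h4.
have := sum_power_le q_ge0 q_lt1 3 n.+1; rewrite -[3`!]/6%N => h3.
apply: (@le_trans _ _ (\sum_(k < n.+1) (4 * k ^ 2)%:R * q ^+ k * p * (4 * k%:R * p * (k%:R / d + d ^- 2)))).
  by apply: ler_sum => k _; rewrite ler_wpM2l ?ear_sum_le // !mulr_ge0 ?exprn_ge0.
rewrite (_ : \sum_(k < _) _ = 16 * p ^+ 2 * ((\sum_(k < n.+1) (k ^ 4)%:R * q ^+ k) / d +
   (\sum_(k < n.+1) (k ^ 3)%:R * q ^+ k) * d ^- 2)); last first.
  rewrite mulr_suml mulr_suml -big_split mulr_sumr; apply: eq_bigr => k _ /=.
  by rewrite natrM !natrX; ring.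
apply: (@le_trans _ _ (16 * p ^+ 2 * (24%:R / d ^+ 5 / d + 6%:R / d ^+ 4 * d ^- 2))).
  have i_ge0 : 0 <= d^-1 by rewrite invr_ge0 ltW.
  by rewrite ler_wpM2l ?mulr_ge0 ?exprn_ge0 // lerD // ler_wpM2r // invr_ge0 exprn_ge0 // ltW.
have dn : d != 0 by exact: lt0r_neq0.
rewrite le_eqVlt; apply/orP; left; apply/eqP.
move: d dn => x xn; field.
exact: xn.
Qed.

Lemma Pr_bad_upper b : Pr p (@bad_event n b) <=
  #|[set e : ends n | cubic b e]|%:R * (p / d) ^+ 3 / 48%:R + (28 * p / d ^+ 2 + 480 * p ^+ 2 / d ^+ 6).
Proof.
apply: le_trans (Pr_bad_le n p01 b) _; apply: lerD; last exact: lerD degenerate_sum_le bicycle_ear_sum_le.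
rewrite ler_wpM2r ?invr_ge0 ?ler0n // ler_wpM2l ?ler0n // lerXn2r ?nnegrE ?chain_sum_le //.
  by rewrite mulr_ge0 // sumr_ge0 // => l _; rewrite exprn_ge0.
by rewrite divr_ge0 // ltW.
Qed.

Lemma error_sum_le L b : error_sum n p L b <=
  4 * (3 * L + 2)%:R * p * ((3 * L + 2)%:R / d + d ^- 2)
  + #|[set e : ends n | cubic b e]|%:R * (p / d) ^+ 3.
Proof.
apply: lerD; first exact: ear_sum_le.
rewrite ler_wpM2l ?ler0n // lerXn2r ?nnegrE ?chain_sum_le //.
  by rewrite mulr_ge0 // sumr_ge0 // => l _; rewrite exprn_ge0.
by rewrite divr_ge0 // ltW.
Qed.

(** The geometric sum from 1 to [L] is [q'/(1-q') (1 - q'^L)]; [expr_le_inv] bounds the missing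
    tail. *)
Lemma chain_sum_short_ge L (q' := (2 * (n - (3 * L + 2)))%:R * p) : (L <= n)%N -> q' < 1 ->
  q' / (1 - q') * (1 - (1 + L%:R * (1 - q'))^-1) <= chain_sum_short n p L.
Proof.
move=> Ln q'1; have q'0 : 0 <= q' by rewrite mulr_ge0.
have d'0 : 0 < 1 - q' by rewrite subr_gt0.
rewrite /chain_sum_short -/q' big_mkcond big_ord_recl /= add0r.
rewrite (eq_bigr (fun l : 'I_n => if (l < L)%N then q' * q' ^+ l else 0)); last first.
  by move=> l _; rewrite /bump /= add1n exprS.
rewrite -big_mkcond /= -(big_ord_widen n (fun l => q' * q' ^+ l) Ln) -mulr_sumr -mulrA ler_wpM2l //.
rewrite mulrC ler_pdivrMr //.
have -> : (\sum_(l < L) q' ^+ l) * (1 - q') = 1 - q' ^+ L.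
  by rewrite mulrC -opprB mulNr -subrX1 opprB.
by rewrite lerD2l lerN2 expr_le_inv.
Qed.

End Bounds.

(** * Estimates in the window *)

Section Estimates.
Local Open Scope ring_scope.
Variables (R : realFieldType) (N p sg th k : R).
Hypotheses (N_ge1 : 1 <= N) (p_ge0 : 0 <= p) (sg_gt0 : 0 < sg) (sg_le1 : sg <= 1).
Hypotheses (lamE : p * (2 * N - 1) = 1 - sg) (th_gt0 : 0 < th) (thE : th ^+ 3 * N = 1).
Hypotheses (k_ge0 : 0 <= k).

Local Notation t := (th / sg).
Hypothesis t_lt1 : t < 1.
Local Notation s := ((1 - t ^+ 3)^-1).
Local Notation d := (sg - p).

Let t_gt0 : 0 < t. Proof. exact: divr_gt0. Qed.
Let thE' : th = t * sg. Proof. by rewrite divfK // gt_eqF. Qed.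
Let N_gt0 : 0 < N. Proof. exact: lt_le_trans ltr01 N_ge1. Qed.
Let t3_lt1 : t ^+ 3 < 1. Proof. by rewrite exprn_ilt1 // ltW. Qed.
Let s_gt0 : 0 < s. Proof. by rewrite invr_gt0 subr_gt0. Qed.

Ltac sec_lra := move: (N_ge1) (p_ge0) (sg_gt0) (sg_le1) (lamE); lra.

(** This is [p <= 1/N], since [N <= 2N - 1] and [p(2N - 1) <= 1]. *)
Lemma p_le_th3 : p <= th ^+ 3.
Proof.
have -> : th ^+ 3 = N^-1 by rewrite -[LHS](mulfK (lt0r_neq0 N_gt0)) thE mul1r.
rewrite -[leRHS]mul1r ler_pdivlMr //.
by apply: (@le_trans _ _ (p * (2 * N - 1))); [rewrite ler_wpM2l //; sec_lra | sec_lra].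
Qed.

Lemma p_le_sg3 : p <= t ^+ 3 * sg ^+ 3.
Proof. by rewrite -exprMn -thE' p_le_th3. Qed.

Let sg3_le : sg ^+ 3 <= sg.
Proof. by rewrite exprS ger_pMr // exprn_ile1 // ltW. Qed.

Lemma p_le_sg : p <= t ^+ 3 * sg.
Proof. by apply: le_trans p_le_sg3 _; rewrite ler_wpM2l // exprn_ge0 // ltW. Qed.

Lemma p_le_t3 : p <= t ^+ 3.
Proof. by apply: le_trans p_le_sg _; rewrite ger_pMr // exprn_gt0. Qed.

Lemma d_gt0 : 0 < d.
Proof.
rewrite subr_gt0; apply: le_lt_trans p_le_sg _.
by rewrite gtr_pMl.
Qed.

Lemma inv_d_le : d^-1 <= s / sg.
Proof.
rewrite -invfM lef_pV2 ?posrE ?d_gt0 ?mulr_gt0 ?subr_gt0 //.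
by have := p_le_sg; sec_lra.
Qed.

Lemma sg_div_d_le : sg / d <= s.
Proof. by rewrite mulrC -ler_pdivlMr // inv_d_le. Qed.

Lemma Np_le : N * p <= (1 + t ^+ 3) / 2.
Proof. by have := p_le_t3; rewrite ler_pdivlMr //; sec_lra. Qed.

Lemma Np_le1 : N * p <= 1.
Proof. by have := Np_le; have := t3_lt1; sec_lra. Qed.

(** The factor 1/6 is 16 * 4 / (48 * 8), with [(2Np)^3 <= (1 + t^3)^3] and [sg/d <= s]; so [k = 90]
    gives 15 and [k = 6] gives 1. The other constants are 448 = 16 * 28 and 7680 = 16 * 480, for
    degenerate bicycles and bicycles with an ear. *)
Definition upper_bound : R :=
  k / 6 * (1 + t ^+ 3) ^+ 3 * s ^+ 3 + 448 * sg * s ^+ 2 + 7680 * t ^+ 3 * s ^+ 6.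

Lemma upper_estimate :
  16 * sg ^+ 3 * N * (2 * N * (2 * (N - 1)) * k * (p / d) ^+ 3 / 48 +
    (28 * p / d ^+ 2 + 480 * p ^+ 2 / d ^+ 6)) <= upper_bound.
Proof.
set r := sg / d; have r_ge0 : 0 <= r by rewrite divr_ge0 // ltW // d_gt0.
have dn : d != 0 by rewrite gt_eqF // d_gt0.
have sn : sg != 0 by rewrite gt_eqF.
have -> : 16 * sg ^+ 3 * N * (2 * N * (2 * (N - 1)) * k * (p / d) ^+ 3 / 48 +
    (28 * p / d ^+ 2 + 480 * p ^+ 2 / d ^+ 6)) =
  4 * k / 3 * (N * p) ^+ 2 * ((N - 1) * p) * r ^+ 3 + 448 * sg * (N * p) * r ^+ 2
    + 7680 * (N * p) * (p / sg ^+ 3) * r ^+ 6.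
  rewrite /r; field; by rewrite dn sn.
have Np_ge0 : 0 <= N * p by rewrite mulr_ge0 // ltW.
have rs := sg_div_d_le; rewrite -/r in rs.
have rsX m : r ^+ m <= s ^+ m by apply: lerXn2r => //; rewrite nnegrE // ltW.
have rX m : 0 <= r ^+ m by rewrite exprn_ge0.
rewrite /upper_bound; apply: lerD; first apply: lerD.
- have h : (N * p) ^+ 2 * ((N - 1) * p) <= ((1 + t ^+ 3) / 2) ^+ 3.
    apply: (@le_trans _ _ ((N * p) ^+ 3)).
      by rewrite [leRHS]exprSr ler_wpM2l ?exprn_ge0 // ler_wpM2r //; sec_lra.
    apply: lerXn2r Np_le; rewrite nnegrE //.
    by rewrite divr_ge0 // addr_ge0 // exprn_ge0 // ltW.
  have -> : k / 6 * (1 + t ^+ 3) ^+ 3 * s ^+ 3 = 4 * k / 3 * ((1 + t ^+ 3) / 2) ^+ 3 * s ^+ 3.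
    by move: s => s'; field.
  rewrite -(mulrA (4 * k / 3) ((N * p) ^+ 2)).
  apply: ler_pM; [| exact: rX | | exact: rsX].
    by rewrite !mulr_ge0 ?exprn_ge0 //; sec_lra.
  by rewrite ler_wpM2l // !mulr_ge0 ?invr_ge0 //; sec_lra.
- rewrite -[448 * sg * (N * p) * r ^+ 2]mulrA ler_wpM2l //.
    by rewrite mulr_ge0 // ltW.
  rewrite -[leRHS]mul1r; apply: ler_pM; [exact: Np_ge0 | exact: rX | exact: Np_le1 | exact: rsX].
have p_sg0 : 0 <= p / sg ^+ 3 by rewrite divr_ge0 // exprn_ge0 // ltW.
have psg : p / sg ^+ 3 <= t ^+ 3 by rewrite ler_pdivrMr ?exprn_gt0 // p_le_sg3.
apply: ler_pM; [| exact: rX | | exact: rsX].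
  by apply: mulr_ge0 => //; apply: mulr_ge0.
rewrite -[7680 * (N * p) * (p / sg ^+ 3)]mulrA ler_wpM2l //.
rewrite -[leRHS]mul1r; apply: ler_pM; [exact: Np_ge0 | exact: p_sg0 | exact: Np_le1 | exact: psg].
Qed.

Variables (L m : R).
Hypotheses (L_low : 1 <= 2 * (th * L)) (m_ge0 : 0 <= m) (m_le : th * m <= 5) (L_ge0 : 0 <= L).
Local Notation q' := (2 * (N - m) * p).
Local Notation d' := (1 - q').

Lemma mp_le : m * p <= 5 * t ^+ 2 * sg ^+ 2.
Proof.
apply: (@le_trans _ _ (m * th ^+ 3)); first by rewrite ler_wpM2l // p_le_th3.
have -> : 5 * t ^+ 2 * sg ^+ 2 = 5 * th ^+ 2 by rewrite -mulrA -exprMn -thE'.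
have -> : m * th ^+ 3 = (th * m) * th ^+ 2 by ring.
by rewrite ler_wpM2r ?m_le // exprn_ge0 // ltW.
Qed.

Lemma m2p_le : m ^+ 2 * p <= 25 * t * sg.
Proof.
apply: (@le_trans _ _ (m ^+ 2 * th ^+ 3)); first by rewrite ler_wpM2l ?exprn_ge0 // p_le_th3.
have -> : m ^+ 2 * th ^+ 3 = (th * m) ^+ 2 * th by ring.
rewrite -mulrA -thE' ler_wpM2r ?(ltW th_gt0) //.
have -> : 25 = 5 ^+ 2 :> R by ring.
by apply: lerXn2r; rewrite ?nnegrE // mulr_ge0 // ltW.
Qed.

Lemma d'E : d' = sg - p + 2 * (m * p).
Proof. by have := lamE; sec_lra. Qed.

Lemma mp_le_sg : m * p <= 5 * t ^+ 2 * sg.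
Proof.
apply: le_trans mp_le _; rewrite ler_wpM2l //; first by rewrite mulr_ge0 ?exprn_ge0 // ltW.
by rewrite expr2 ger_pMr.
Qed.

Lemma d'_le : d' <= sg * (1 + 10 * t ^+ 2).
Proof. by rewrite d'E; have := mp_le_sg; have := p_ge0; sec_lra. Qed.

Lemma d_le_d' : d <= d'.
Proof. by rewrite d'E lerDl mulr_ge0 // mulr_ge0. Qed.

Lemma d'_gt0 : 0 < d'.
Proof. exact: lt_le_trans d_gt0 d_le_d'. Qed.

Lemma q'_ge : 1 - sg - 10 * t ^+ 2 <= q'.
Proof.
have := mp_le_sg; have : 5 * t ^+ 2 * sg <= 5 * t ^+ 2.
  by rewrite ger_pMr // mulr_gt0 // exprn_gt0.
have := d'E; have := p_ge0; sec_lra.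
Qed.

(** With [L] at least [1/(2 th)] and [1/d <= s/sg], the tail is at most [1/(L d) <= 2 t s]. *)
Lemma tail_le : (1 + L * d')^-1 <= 2 * t * s.
Proof.
have L_gt0 : 0 < L.
  rewrite lt0r L_ge0 andbT; apply/eqP => L0; move: L_low; rewrite L0; sec_lra.
have Ld : 0 < L * d' by rewrite mulr_gt0 // d'_gt0.
apply: (@le_trans _ _ (L^-1 * d^-1)).
  rewrite -invfM lef_pV2 ?posrE ?addr_gt0 ?mulr_gt0 ?d_gt0 ?d'_gt0 //.
  by apply: (@le_trans _ _ (L * d')); [rewrite ler_wpM2l // d_le_d' | sec_lra].
have -> : 2 * t * s = (2 * th) * (s / sg) by rewrite -!mulrA [sg^-1 * s]mulrC.
apply: ler_pM; rewrite ?invr_ge0 ?(ltW d_gt0) ?inv_d_le //.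
rewrite -[leLHS]mul1r ler_pdivrMr //; move: L_low; sec_lra.
Qed.

(** The first two terms bound the ears, through [m^2 p/d] and [mp/d^2]; the third bounds a second,
    apart subdivision. *)
Definition error_bound : R := 100 * t * s + 20 * t ^+ 2 * s ^+ 2 + 4 * k * t ^+ 3 * s ^+ 3.

Lemma error_estimate :
  4 * m * p * (m / d + d ^- 2) + 2 * N * (2 * (N - 1)) * k * (p / d) ^+ 3 <= error_bound.
Proof.
have s0 := ltW s_gt0; have t0 := ltW t_gt0; have sn : sg != 0 by rewrite gt_eqF.
have i0 : 0 <= d^-1 by rewrite invr_ge0 ltW // d_gt0.
have iX j : d ^- j <= (s / sg) ^+ j.
  by rewrite -exprVn; apply: lerXn2r inv_d_le; rewrite nnegrE // divr_ge0 // ltW.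
have iX0 j : 0 <= d ^- j by rewrite invr_ge0 exprn_ge0 // ltW // d_gt0.
have sgX j : 0 <= sg ^+ j by rewrite exprn_ge0 // ltW.
rewrite /error_bound mulrDr; apply: lerD; first apply: lerD.
- have -> : 4 * m * p * (m / d) = 4 * (m ^+ 2 * p * d^-1) by ring.
  have -> : 100 * t * s = 4 * (25 * t * sg * (s / sg)).
    by move: s => s'; field.
  rewrite ler_wpM2l //; apply: ler_pM => //; [by rewrite mulr_ge0 // exprn_ge0 | exact: m2p_le | exact: inv_d_le].
- have -> : 4 * m * p * d ^- 2 = 4 * (m * p * d ^- 2) by ring.
  have -> : 20 * t ^+ 2 * s ^+ 2 = 4 * (5 * t ^+ 2 * sg ^+ 2 * (s / sg) ^+ 2).
    by move: s => s'; field.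
  by rewrite ler_wpM2l //; apply: ler_pM => //; [rewrite mulr_ge0 | exact: mp_le].
have -> : 2 * N * (2 * (N - 1)) * k * (p / d) ^+ 3 = 4 * k * ((N * p) * ((N - 1) * p) * (p * d ^- 3)).
  by rewrite exprMn exprVn; move: (d ^- 3) => x; ring.
have -> : 4 * k * t ^+ 3 * s ^+ 3 = 4 * k * (1 * (t ^+ 3 * sg ^+ 3 * (s / sg) ^+ 3)).
  by move: s => s'; field.
have Np0 : 0 <= N * p by rewrite mulr_ge0 // ltW.
have N1p0 : 0 <= (N - 1) * p by rewrite mulr_ge0 // subr_ge0.
have k4 : 0 <= 4 * k by rewrite mulr_ge0.
have pd0 : 0 <= p * d ^- 3 by rewrite mulr_ge0.
have pd : p * d ^- 3 <= t ^+ 3 * sg ^+ 3 * (s / sg) ^+ 3.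
  by apply: ler_pM; [exact: p_ge0 | exact: iX0 | exact: p_le_sg3 | exact: iX].
have NNp : N * p * ((N - 1) * p) <= 1.
  rewrite -[leRHS]mulr1; apply: ler_pM; [exact: Np0 | exact: N1p0 | exact: Np_le1 |].
  by apply: le_trans Np_le1; rewrite ler_wpM2r //; sec_lra.
rewrite ler_wpM2l //; apply: ler_pM; [exact: mulr_ge0 | exact: pd0 | exact: NNp | exact: pd].
Qed.

(** The factors bound, in turn, [(2Np)^3], [1 - 1/N], the cube of [sg] times the truncated chain
    sum, and the chance of isolation. *)
Definition lower_bound : R :=
  k / 6 * (1 - sg) ^+ 3 * (1 - t ^+ 3) *
  ((1 - sg - 10 * t ^+ 2) / (1 + 10 * t ^+ 2) * (1 - 2 * t * s)) ^+ 3 * (1 - error_bound).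

Lemma lower_estimate (G err : R) :
    q' / d' * (1 - (1 + L * d')^-1) <= G -> err <= error_bound -> error_bound <= 1 ->
    0 <= 1 - sg - 10 * t ^+ 2 -> 0 <= 1 - 2 * t * s ->
  lower_bound <= 16 * sg ^+ 3 * N * (2 * N * (2 * (N - 1)) * k * (p * G) ^+ 3 * (1 - err) / 48).
Proof.
move=> hG herr err1 c_ge0 u_ge0.
have t0 := ltW t_gt0; have tX j : 0 <= t ^+ j by exact: exprn_ge0.
have e_ge0 : 0 <= 1 + 10 * t ^+ 2 by rewrite addr_ge0 // mulr_ge0.
have e_gt0 : 0 < 1 + 10 * t ^+ 2 by rewrite ltr_pwDl // mulr_ge0.
have sG : (1 - sg - 10 * t ^+ 2) / (1 + 10 * t ^+ 2) * (1 - 2 * t * s) <= sg * G.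
  apply: (@le_trans _ _ (sg * (q' / d' * (1 - (1 + L * d')^-1)))); last first.
    by rewrite ler_wpM2l // ltW.
  have -> : sg * (q' / d' * (1 - (1 + L * d')^-1)) = q' * (sg / d') * (1 - (1 + L * d')^-1).
    by move: (d'^-1) ((1 + L * d')^-1) => x y; ring.
  apply: ler_pM; rewrite ?mulr_ge0 ?invr_ge0 //.
    apply: ler_pM; rewrite ?invr_ge0 //; first exact: q'_ge.
    rewrite -[leLHS]mul1r ler_pdivrMr // mulrAC ler_pdivlMr ?d'_gt0 // mul1r.
    exact: d'_le.
  by rewrite lerD2l lerN2 tail_le.
have X_ge0 : 0 <= (1 - sg - 10 * t ^+ 2) / (1 + 10 * t ^+ 2) * (1 - 2 * t * s).
  by rewrite mulr_ge0 // divr_ge0.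
have -> : 16 * sg ^+ 3 * N * (2 * N * (2 * (N - 1)) * k * (p * G) ^+ 3 * (1 - err) / 48) =
  k / 6 * (2 * N * p) ^+ 3 * (1 - N^-1) * (sg * G) ^+ 3 * (1 - err).
  by field; rewrite gt_eqF.
have k6 : 0 <= k / 6 by rewrite divr_ge0.
have sg1 : 0 <= 1 - sg by rewrite subr_ge0.
have t31 : 0 <= 1 - t ^+ 3 by rewrite subr_ge0 ltW.
have hA : (1 - sg) ^+ 3 <= (2 * N * p) ^+ 3.
  apply: lerXn2r; rewrite ?nnegrE //; first by rewrite !mulr_ge0 // ltW.
  by sec_lra.
have hB : 1 - t ^+ 3 <= 1 - N^-1.
  have -> : N^-1 = th ^+ 3 by rewrite -[RHS](mulfK (lt0r_neq0 N_gt0)) thE mul1r.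
  rewrite lerD2l lerN2; apply: lerXn2r; rewrite ?nnegrE ?(ltW th_gt0) //.
  by rewrite ler_pdivlMr // ger_pMr.
have hC : ((1 - sg - 10 * t ^+ 2) / (1 + 10 * t ^+ 2) * (1 - 2 * t * s)) ^+ 3 <= (sg * G) ^+ 3.
  by apply: lerXn2r; rewrite ?nnegrE // (le_trans X_ge0).
have hD : 1 - error_bound <= 1 - err by rewrite lerD2l lerN2.
have A0 : 0 <= (1 - sg) ^+ 3 by exact: exprn_ge0.
have C0 := exprn_ge0 3 X_ge0.
have D0 : 0 <= 1 - error_bound by rewrite subr_ge0.
have kA0 := mulr_ge0 k6 A0; have kAB0 := mulr_ge0 kA0 t31.
rewrite /lower_bound; apply: ler_pM; [exact: mulr_ge0 kAB0 C0 | exact: D0 | | exact: hD].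
apply: ler_pM; [exact: kAB0 | exact: C0 | | exact: hC].
apply: ler_pM; [exact: kA0 | exact: t31 | | exact: hB].
by rewrite ler_wpM2l.
Qed.

End Estimates.

(** * Limits *)

From mathcomp Require Import all_classical all_reals all_analysis.
Import Order.TTheory GRing.Theory Num.Theory.
Import numFieldNormedType.Exports.
Local Open Scope classical_set_scope.
Local Open Scope ring_scope.

Section Limits.
Variable R : realType.
Implicit Types f g : nat -> R.

Lemma cvg_exprn f (a : R) k : f @ \oo --> a -> (fun n => f n ^+ k) @ \oo --> a ^+ k.
Proof. by move=> fa; exact: (cvg_comp _ _ fa (@exprn_continuous R k a)). Qed.

Lemma cvg_add f g (a b : R) : f @ \oo --> a -> g @ \oo --> b ->
  (fun n => f n + g n) @ \oo --> a + b.
Proof. exact: cvgD. Qed.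

Lemma cvg_sub f g (a b : R) : f @ \oo --> a -> g @ \oo --> b ->
  (fun n => f n - g n) @ \oo --> a - b.
Proof. exact: cvgB. Qed.

Lemma cvg_mul f g (a b : R) : f @ \oo --> a -> g @ \oo --> b ->
  (fun n => f n * g n) @ \oo --> a * b.
Proof. exact: cvgM. Qed.

Lemma cvg_inv f (a : R) : a != 0 -> f @ \oo --> a -> (fun n => (f n)^-1) @ \oo --> a^-1.
Proof. exact: cvgV. Qed.

Definition kappa (b : bool) : R := (size (patterns b))%:R.

Variables sg th : nat -> R.
Hypothesis tcvg : (fun n => th n / sg n) @ \oo --> (0 : R).

Let one_sub_cvg : (fun n => 1 - (th n / sg n) ^+ 3) @ \oo --> (1 - 0 ^+ 3 : R).
Proof. by apply: cvg_sub; [exact: cvg_cst | exact: cvg_exprn]. Qed.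

Lemma s_cvg : (fun n => (1 - (th n / sg n) ^+ 3)^-1) @ \oo --> (1 : R).
Proof.
have := cvg_inv _ one_sub_cvg; rewrite expr0n /= subr0 invr1; apply.
exact: oner_neq0.
Qed.

Lemma error_cvg k : (fun n => error_bound (sg n) (th n) k) @ \oo --> (0 : R).
Proof.
have sc := s_cvg; have tc := tcvg.
rewrite (_ : 0 = 100 * 0 * 1 + 20 * 0 ^+ 2 * 1 ^+ 2 + 4 * k * 0 ^+ 3 * 1 ^+ 3); last by ring.
apply: cvg_add; first apply: cvg_add; apply: cvg_mul.
- by apply: cvg_mul => //; exact: cvg_cst.
- exact: sc.
- by apply: cvg_mul; [exact: cvg_cst | exact: cvg_exprn].
- exact: cvg_exprn.
- by apply: cvg_mul; [exact: cvg_cst | exact: cvg_exprn].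
- exact: cvg_exprn.
Qed.

Lemma tail_cvg : (fun n => 1 - 2 * (th n / sg n) * (1 - (th n / sg n) ^+ 3)^-1) @ \oo --> (1 : R).
Proof.
rewrite [X in _ --> X](_ : 1 = 1 - 2 * 0 * 1); last by ring.
apply: cvg_sub; first exact: cvg_cst.
by apply: cvg_mul; [apply: cvg_mul => //; exact: cvg_cst | exact: s_cvg].
Qed.

Hypothesis scvg : sg @ \oo --> (0 : R).

Lemma upper_cvg k : (fun n => upper_bound (sg n) (th n) k) @ \oo --> k / 6.
Proof.
have sc := s_cvg; have tc := tcvg.
rewrite (_ : k / 6 = k / 6 * (1 + 0 ^+ 3) ^+ 3 * 1 ^+ 3 + 448 * 0 * 1 ^+ 2 + 7680 * 0 ^+ 3 * 1 ^+ 6); last by ring.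
apply: cvg_add; first apply: cvg_add; apply: cvg_mul.
- apply: cvg_mul; first exact: cvg_cst.
  by apply: cvg_exprn; apply: cvg_add; [exact: cvg_cst | exact: cvg_exprn].
- exact: cvg_exprn.
- by apply: cvg_mul => //; exact: cvg_cst.
- exact: cvg_exprn.
- by apply: cvg_mul; [exact: cvg_cst | exact: cvg_exprn].
- exact: cvg_exprn.
Qed.

Lemma head_cvg : (fun n => 1 - sg n - 10 * (th n / sg n) ^+ 2) @ \oo --> (1 : R).
Proof.
rewrite [X in _ --> X](_ : 1 = 1 - 0 - 10 * 0 ^+ 2); last by ring.
apply: cvg_sub; first by apply: cvg_sub => //; exact: cvg_cst.
by apply: cvg_mul; [exact: cvg_cst | exact: cvg_exprn].
Qed.

Lemma lower_cvg k : (fun n => lower_bound (sg n) (th n) k) @ \oo --> k / 6.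
Proof.
have tc := tcvg.
rewrite (_ : k / 6 = k / 6 * (1 - 0) ^+ 3 * (1 - 0 ^+ 3) * (1 * (1 + 10 * 0 ^+ 2)^-1 * 1) ^+ 3 * (1 - 0)); last first.
  rewrite !expr0n /= mulr0 addr0 invr1; ring.
apply: cvg_mul; last by apply: cvg_sub; [exact: cvg_cst | exact: error_cvg].
apply: cvg_mul; first apply: cvg_mul; first apply: cvg_mul.
- exact: cvg_cst.
- by apply: cvg_exprn; apply: cvg_sub => //; exact: cvg_cst.
- by apply: cvg_sub; [exact: cvg_cst | exact: cvg_exprn].
apply: cvg_exprn; apply: cvg_mul; last exact: tail_cvg.
apply: cvg_mul; first exact: head_cvg.
apply: cvg_inv; first by rewrite expr0n /= mulr0 addr0 oner_neq0.
by apply: cvg_add; [exact: cvg_cst | apply: cvg_mul; [exact: cvg_cst | exact: cvg_exprn]].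
Qed.

End Limits.

(** * The estimates along the sequences [p] and [sigma] *)

Section Asymptotics.
Variables (R : realType) (p sigma : nat -> R).
Hypothesis p01 : forall n : nat, 0 <= p n <= 1.
Hypothesis lambdaE : forall n : nat, p n * (2 * n%:R - 1) = 1 - sigma n.

Definition theta (n : nat) : R := n%:R `^ (- (1 / 3)).

Lemma theta_gt0 n : (0 < n)%N -> 0 < theta n.
Proof. by move=> n0; rewrite powR_gt0 // ltr0n. Qed.

Lemma theta_expr3 n : (0 < n)%N -> theta n ^+ 3 * n%:R = 1.
Proof.
move=> n0; rewrite /theta -powR_mulrn ?powR_ge0 // -powRrM.
have -> : - (1 / 3) * 3 = -1 :> R by field.
by rewrite powR_inv1 ?ler0n // mulVf // pnatr_eq0 -lt0n.
Qed.

Lemma theta_le1 n : (0 < n)%N -> theta n <= 1.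
Proof.
move=> n0; rewrite -(@expr_le1 _ 3) // ?(ltW (theta_gt0 n0)) //.
rewrite -(theta_expr3 n0) ler_peMr ?exprn_ge0 ?(ltW (theta_gt0 n0)) //.
by rewrite ler1n.
Qed.

(** The first moments involve [2n p], whereas [1 - sigma] is [(2n-1) p]; hence the shift by [p]. *)
Lemma dE n : 1 - (2 * n)%:R * p n = sigma n - p n.
Proof. have := lambdaE n; rewrite natrM; lra. Qed.

Lemma scaled_upper b n : (0 < n)%N -> 0 < sigma n <= 1 -> theta n / sigma n < 1 ->
  16 * sigma n ^+ 3 * n%:R * Pr (p n) (@bad_event n b) <=
  upper_bound (sigma n) (theta n) (kappa R b).
Proof.
move=> n0 /andP[s0 s1] t1; have p0 : 0 <= p n by case/andP: (p01 n).
have N1 : 1 <= n%:R :> R by rewrite ler1n.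
have k0 : 0 <= kappa R b by exact: ler0n.
have d0 := d_gt0 N1 p0 s0 s1 (lambdaE n) (theta_gt0 n0) (theta_expr3 n0) t1.
have := upper_estimate N1 p0 s0 s1 (lambdaE n) (theta_gt0 n0) (theta_expr3 n0) k0 t1.
apply: le_trans; rewrite ler_wpM2l ?mulr_ge0 ?exprn_ge0 ?(ltW s0) //.
have := @Pr_bad_upper R n (p n) (p01 n); rewrite dE => /(_ d0 b).
rewrite card_cubic !natrM -[n.-1%:R]/((n.-1)%:R) (_ : n.-1%:R = n%:R - 1 :> R) //.
by rewrite -[in RHS](prednK n0) -natr1 addrK.
Qed.

Definition cutoff n : nat := Num.truncn (theta n)^-1.

Lemma cutoff_le n : (0 < n)%N -> theta n * (cutoff n)%:R <= 1.
Proof.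
move=> n0; have th0 := theta_gt0 n0.
have /truncn_itv/andP[h _] : 0 <= (theta n)^-1 by rewrite invr_ge0 ltW.
by rewrite mulrC -ler_pdivlMr // mul1r.
Qed.

(** Rounding down loses at most a factor 2, because [1/theta] is at least 1. *)
Lemma cutoff_ge n : (0 < n)%N -> 1 <= 2 * (theta n * (cutoff n)%:R).
Proof.
move=> n0; have th0 := theta_gt0 n0; have th1 := theta_le1 n0.
have /truncn_itv/andP[_ h] : 0 <= (theta n)^-1 by rewrite invr_ge0 ltW.
have c1 : (1 <= cutoff n)%N.
  by rewrite /cutoff; have := lt_le_trans (y := (theta n)^-1) _ _; rewrite truncn_gt0 invf_ge1.
have h' : 1 < theta n * ((cutoff n).+1)%:R.
  by rewrite mulrC -ltr_pdivrMr // mul1r.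
have : theta n * ((cutoff n).+1)%:R <= theta n * (2 * (cutoff n)%:R).
  by rewrite ler_wpM2l ?(ltW th0) // -natrM ler_nat; lia.
lra.
Qed.

Lemma scaled_lower b n : (0 < n)%N -> 0 < sigma n <= 1 -> 3 * (theta n / sigma n) < 1 ->
    error_bound (sigma n) (theta n) (kappa R b) <= 1 ->
    0 <= 1 - sigma n - 10 * (theta n / sigma n) ^+ 2 ->
    0 <= 1 - 2 * (theta n / sigma n) * (1 - (theta n / sigma n) ^+ 3)^-1 ->
  lower_bound (sigma n) (theta n) (kappa R b) <=
  16 * sigma n ^+ 3 * n%:R * Pr (p n) (@bad_event n b).
Proof.
move=> n0 /andP[s0 s1] t3 err1 c0 u0; have p0 : 0 <= p n by case/andP: (p01 n).
have th0 := theta_gt0 n0; have th1 := theta_le1 n0.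
have t0 : 0 < theta n / sigma n by exact: divr_gt0.
have t1 : theta n / sigma n < 1 by lra.
have N1 : 1 <= n%:R :> R by rewrite ler1n.
have k0 : 0 <= kappa R b by exact: ler0n.
have d0 := d_gt0 N1 p0 s0 s1 (lambdaE n) th0 (theta_expr3 n0) t1.
set L := cutoff n; pose m := (3 * L + 2)%N.
have L_low := cutoff_ge n0; have L_high := cutoff_le n0; rewrite -/L in L_low L_high.
have m_le5 : theta n * m%:R <= 5 by rewrite /m natrD natrM; lra.
(* As [sigma <= 1], [theta] is at most [theta/sigma < 1/3]. This gives
   [m <= 5/theta <= theta^(-3) = n], so [n - m] is a true subtraction. *)
have th3 : 5 * theta n ^+ 2 <= 1.
  have : theta n <= theta n / sigma n by rewrite ler_pdivlMr // ler_piMr // ltW.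
  nra.
have m_le_n : (m <= n)%N.
  rewrite -(ler_nat R) -(ler_pM2l th0) (le_trans m_le5) //.
  have E : 5 * theta n ^+ 2 * (theta n * n%:R) = 5.
    by rewrite mulrA -[5 * _ * theta n]mulrA -exprSr -mulrA theta_expr3 // mulr1.
  by rewrite -[leLHS]E ler_piMl // mulr_ge0 // ltW.
have L_le_n : (L <= n)%N by apply: leq_trans m_le_n; rewrite /m (leq_trans (leq_pmull L _) (leq_addr _ _)).
have q'E : (2 * (n - m))%:R * p n = 2 * (n%:R - m%:R) * p n by rewrite natrM natrB.
have m0 : 0 <= m%:R :> R by exact: ler0n.
have d'0 := d'_gt0 N1 p0 s0 s1 (lambdaE n) th0 (theta_expr3 n0) t1 m0.
have cE : #|[set e : ends n | cubic b e]%SET|%:R = 2 * n%:R * (2 * (n%:R - 1)) * kappa R b.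
  rewrite card_cubic !natrM (_ : n.-1%:R = n%:R - 1 :> R) //.
  by rewrite -[in RHS](prednK n0) -natr1 addrK.
have err_le : error_sum n (p n) L b <= error_bound (sigma n) (theta n) (kappa R b).
  have := @error_sum_le R n (p n) (p01 n); rewrite dE => /(_ d0 L b) h.
  apply: le_trans h _; rewrite cE -/m.
  exact: (error_estimate N1 p0 s0 s1 (lambdaE n) th0 (theta_expr3 n0) k0 t1 m0 m_le5).
have G_ge : 2 * (n%:R - m%:R) * p n / (1 - 2 * (n%:R - m%:R) * p n) *
    (1 - (1 + L%:R * (1 - 2 * (n%:R - m%:R) * p n))^-1) <= chain_sum_short n (p n) L.
  rewrite -q'E; apply: (chain_sum_short_ge (p01 n) L_le_n).
  by rewrite -subr_gt0 -/m q'E.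
have L0 : 0 <= L%:R :> R by exact: ler0n.
have h := lower_estimate N1 p0 s0 s1 (lambdaE n) th0 (theta_expr3 n0) k0 t1 L_low m0 m_le5 L0 G_ge err_le err1 c0 u0.
apply: le_trans h _; rewrite ler_wpM2l ?mulr_ge0 ?exprn_ge0 ?(ltW s0) //.
by rewrite -cE; apply: (Pr_bad_ge (p01 n)); exact: le_trans err_le err1.
Qed.

(** Since [theta/sigma < 1/2] forces [sigma - p >= sigma/2], the bound [8p/(sigma - p)^3] is at most
    [8 * 2^3 / (sigma^3 n)]. *)
Lemma kernel_bound n : (0 < n)%N -> 0 < sigma n < 1 -> 2 * (theta n / sigma n) < 1 ->
  Pr (p n) (@bad_event n false) <= 64 * (sigma n ^+ 3 * n%:R)^-1.
Proof.
move=> n0 /andP[s0 s1'] t2; have p0 : 0 <= p n by case/andP: (p01 n).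
have th0 := theta_gt0 n0; have s1 := ltW s1'.
have t0 : 0 < theta n / sigma n by exact: divr_gt0.
have t1 : theta n / sigma n < 1 by lra.
have N1 : 1 <= n%:R :> R by rewrite ler1n.
have d0 := d_gt0 N1 p0 s0 s1 (lambdaE n) th0 (theta_expr3 n0) t1.
have d_half : sigma n / 2 <= sigma n - p n.
  have := p_le_sg N1 p0 s0 s1 (lambdaE n) th0 (theta_expr3 n0).
  have : (theta n / sigma n) ^+ 3 <= (1 / 2) ^+ 3.
    by apply: lerXn2r; rewrite ?nnegrE ?(ltW t0) //; lra.
  move: ((theta n / sigma n) ^+ 3) => x x_le p_le.
  have : x * sigma n <= (1 / 2) ^+ 3 * sigma n by rewrite ler_wpM2r // ltW.
  lra.
apply: le_trans (Pr_kernel_le n (p01 n)) _.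
have := @bicycle_sum_le R n (p n) (p01 n); rewrite dE => /(_ d0) h; apply: le_trans h _.
apply: (@le_trans _ _ (8 * (n%:R)^-1 / (sigma n / 2) ^+ 3)).
  apply: ler_pM; rewrite ?mulr_ge0 ?invr_ge0 ?exprn_ge0 ?(ltW d0) //.
    rewrite ler_wpM2l //; have -> : n%:R^-1 = theta n ^+ 3.
      by rewrite -[RHS](mulfK (lt0r_neq0 (lt_le_trans ltr01 N1))) theta_expr3 // mul1r.
    exact: (p_le_th3 N1 p0 s0 s1 (lambdaE n) (theta_expr3 n0)).
  rewrite lef_pV2 ?posrE ?exprn_gt0 ?divr_gt0 //.
  by apply: lerXn2r; rewrite ?nnegrE ?divr_ge0 ?(ltW s0) ?(ltW d0).
have nn : n%:R != 0 :> R by rewrite pnatr_eq0 -lt0n.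
rewrite le_eqVlt; apply/orP; left; apply/eqP; field.
by rewrite nn gt_eqF.
Qed.

End Asymptotics.

(** * The asymptotic probabilities of the two events *)

Section Main.
Variables (R : realType) (p sigma : nat -> R).
Hypothesis p01 : forall n : nat, 0 <= p n <= 1.
Hypothesis lambdaE : forall n : nat, p n * (2 * n%:R - 1) = 1 - sigma n.
Hypothesis sigma_gt0 : \forall n \near \oo, 0 < sigma n.
Hypothesis tcvg : (fun n => theta R n / sigma n) @ \oo --> (0 : R).

Lemma bad_probability b (a : R) : kappa R b / 6 = a -> sigma @ \oo --> (0 : R) ->
  exists2 eps : nat -> R, eps @ \oo --> (0 : R) &
    \forall n \near \oo,
      Pr (p n) (@bad_event n b) = (a + eps n) / (16 * sigma n ^+ 3 * n%:R).
Proof.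
move=> aE scvg; pose k := kappa R b.
have near_n0 : \forall n \near \oo, (0 < n)%N by exact: nbhs_infty_gt.
have near_s1 : \forall n \near \oo, sigma n < 1 by exact: cvgr_lt scvg 1 ltr01.
have near_t : \forall n \near \oo, theta R n / sigma n < 3^-1.
  have h : (0 : R) < 3^-1 by rewrite invr_gt0.
  exact: cvgr_lt tcvg _ h.
have near_err : \forall n \near \oo, error_bound (sigma n) (theta R n) k < 1.
  exact: cvgr_lt (error_cvg tcvg k) _ ltr01.
have near_head : \forall n \near \oo, 0 < 1 - sigma n - 10 * (theta R n / sigma n) ^+ 2.
  exact: cvgr_gt (head_cvg tcvg scvg) _ ltr01.
have near_tail : \forall n \near \oo,
    0 < 1 - 2 * (theta R n / sigma n) * (1 - (theta R n / sigma n) ^+ 3)^-1.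
  exact: cvgr_gt (tail_cvg tcvg) _ ltr01.
have scaled : (fun n => 16 * sigma n ^+ 3 * n%:R * Pr (p n) (@bad_event n b)) @ \oo --> a.
  rewrite -aE; apply: (squeeze_cvgr (f := fun n => lower_bound (sigma n) (theta R n) k)
    (h := fun n => upper_bound (sigma n) (theta R n) k)); [|exact: lower_cvg|exact: upper_cvg].
  near=> n.
  have n0 : (0 < n)%N by near: n.
  have s01 : 0 < sigma n <= 1.
    by apply/andP; split; [near: n | apply: ltW; near: n].
  have t3 : theta R n / sigma n < 3^-1 by near: n.
  apply/andP; split.
    apply: scaled_lower => //.
    - by move: t3; rewrite -[3^-1]mul1r ltr_pdivlMr // mulrC.
    - by apply: ltW; near: n.
    - by apply: ltW; near: n.
    - by apply: ltW; near: n.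
  by apply: scaled_upper => //; apply: lt_trans t3 _; rewrite invf_lt1 // ltr1n.
(* The error is defined as the scaled probability minus its limit, so the required equality becomes
   a field identity. *)
exists (fun n => 16 * sigma n ^+ 3 * n%:R * Pr (p n) (@bad_event n b) - a).
  by rewrite -(subrr a); apply: cvg_sub => //; exact: cvg_cst.
near=> n.
have n0 : (0 < n)%N by near: n.
have s0 : 0 < sigma n by near: n.
have nn : n%:R != 0 :> R by rewrite pnatr_eq0 -lt0n.
by field; rewrite nn gt_eqF.
Unshelve. all: by end_near. Qed.

Lemma kernel_O : (\forall n \near \oo, sigma n < 1) ->
  (fun n : nat => Pr (p n) (@bad_event n false)) =O_\oo (fun n : nat => (sigma n ^+ 3 * n%:R)^-1).
Proof.
move=> near_s1; have h2 : (0 : R) < 2^-1 by rewrite invr_gt0.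
have near_t : \forall n \near \oo, theta R n / sigma n < 2^-1 by exact: cvgr_lt tcvg _ h2.
apply/eqO_exP; exists 64 => //; near=> n.
have n0 : (0 < n)%N by near: n; exact: nbhs_infty_gt.
have s0 : 0 < sigma n by near: n.
have s1 : sigma n < 1 by near: n.
have t2 : theta R n / sigma n < 2^-1 by near: n.
rewrite !ger0_norm ?invr_ge0 ?mulr_ge0 ?exprn_ge0 ?(ltW s0) ?Pr_ge0 //.
apply: kernel_bound => //; first by rewrite s0.
by move: t2; rewrite -[2^-1]mul1r ltr_pdivlMr // mulrC.
Unshelve. all: by end_near. Qed.

End Main.

Theorem theorem1p7 (R : realType) (p sigma : nat -> R)
  (p01 : forall n : nat, 0 <= p n <= 1)
  (lambdaE : forall n : nat, p n * (2 * n%:R - 1) = 1 - sigma n)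
  (sigma_gt0 : \forall n \near \oo, 0 < sigma n)
  (sigma_large : much_less (fun n : nat => n%:R `^ (- (1 / 3))) sigma) :
  ((exists2 c : R, 0 < c & \forall n \near \oo, c <= p n * (2 * n%:R - 1)) ->
   much_less sigma (fun=> 1) ->
   (exists2 eps : nat -> R, eps @ \oo --> (0 : R) &
      \forall n \near \oo,
        Pr (p n) [pred F : formula n |
            [forall x in core_vars F, var_type (core F) x == (1, 1)%N]]
          = 1 - (15 + eps n) / (16 * sigma n ^+ 3 * n%:R) /\
        Pr (p n) [pred F : formula n | kernel_vars F == finset.set0]
          = 1 - (15 + eps n) / (16 * sigma n ^+ 3 * n%:R)) /\
   (exists2 eps : nat -> R, eps @ \oo --> (0 : R) &
      \forall n \near \oo,
        Pr (p n) (@satisfiable n)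
          = 1 - (1 + eps n) / (16 * sigma n ^+ 3 * n%:R))) /\
  ((\forall n \near \oo, sigma n < 1) ->
   (fun n : nat =>
      1 - Pr (p n) [pred F : formula n | kernel_vars F == finset.set0])
     =O_\oo (fun n : nat => (sigma n ^+ 3 * n%:R)^-1)).
Proof.
have good_kernel n : Pr (p n) [pred F : formula n | kernel_vars F == finset.set0]
    = 1 - Pr (p n) (@bad_event n false).
  by rewrite -PrC; apply: Pr_eq => // F _; rewrite /= negbK.
have good_sat n : Pr (p n) (@satisfiable n) = 1 - Pr (p n) (@bad_event n true).
  by rewrite -PrC; apply: Pr_eq => // F _; rewrite /= negbK.
split=> [_ sigma_small|sigma_lt1]; last first.
  rewrite (_ : (fun n => _) = (fun n => Pr (p n) (@bad_event n false))); last first.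
    by apply: boolp.funext => n; rewrite good_kernel opprB addrC subrK.
  exact: kernel_O.
have scvg : sigma @ \oo --> (0 : R).
  by move: sigma_small; rewrite /much_less; under boolp.eq_fun do rewrite divr1.
split.
  have [|eps eps0 near_eps] := bad_probability p01 lambdaE sigma_gt0 sigma_large (b := false) (a := 15) _ scvg.
    by rewrite /kappa size_patterns; field.
  exists eps => //; apply: filterS near_eps => n En.
  split; last by rewrite good_kernel En.
  (* Having all core variables of type (1,1) and having an empty kernel are the same event, so one
     error sequence serves both. *)
  by rewrite -En -good_kernel; apply: Pr_eq => // F _; rewrite /= all_type11.
have [|eps eps0 near_eps] := bad_probability p01 lambdaE sigma_gt0 sigma_large (b := true) (a := 1) _ scvg.
  by rewrite /kappa size_patterns; field.
by exists eps => //; apply: filterS near_eps => n En; rewrite good_sat En.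
Qed.
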